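(* Let $S$ be the minimal Laplacian on $L_2(0,1)$: $\mathcal{D}(S)=\{f\in H^2(0,1): f(0)=f(1)=f'(0)=f'(1)=0\}$, $Sf=-f''$, let $V\ge0$ be a bounded operator on $L_2(0,1)$ and $A=S+\mathrm{i}V$ with $\mathcal{D}(A)=\mathcal{D}(S)$. An extension of $A$ is a maximally dissipative extension of $A$ if and only if it is of the form $$A_{\mathcal W,\mathcal L}:\qquad\mathcal{D}(A_{\mathcal W,\mathcal L})=\mathcal{D}(S)\dot+\mathcal{W},\qquad A_{\mathcal W,\mathcal L}(f_0+w)=(S^*+\mathrm{i}V)(f_0+w)+\mathcal{L}w\quad(f_0\in\mathcal{D}(S),\ w\in\mathcal{W}),$$ where $\mathcal{W}$ is a subspace of $\mathcal{D}(S^* )=H^2(0,1)$ with $\mathcal{W}\cap\mathcal{D}(S)=\{0\}$, $\dim\mathcal{W}=2$, $\mathcal{L}:\mathcal{W}\to\operatorname{rg}(V^{1/2})$ is linear, and $$\operatorname{Im}\left(\begin{pmatrix} u(0) & v(0) \\ u(1) & v(1) \end{pmatrix}^*\begin{pmatrix} u'(0) & v'(0) \\ -u'(1) & -v'(1) \end{pmatrix}\right)\ge\frac14\begin{pmatrix} \|V^{-1/2}\mathcal{L}u\|^2 & \langle V^{-1/2}\mathcal{L}u,V^{-1/2}\mathcal{L}v\rangle \\ \langle V^{-1/2}\mathcal{L}v,V^{-1/2}\mathcal{L}u\rangle & \|V^{-1/2}\mathcal{L}v\|^2 \end{pmatrix}$$ for one, and hence for every, basis $\{u,v\}$ of $\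mathcal{W}$.
   Context: $L_2(0,1)$ is complex with inner product linear in the second argument. The adjoint of $S$ is $S^*f=-f''$ with $\mathcal{D}(S^* )=H^2(0,1)$. A densely defined operator $T$ is dissipative if $\operatorname{Im}\langle x,Tx\rangle\ge0$ for all $x\in\mathcal{D}(T)$, and maximally dissipative if it is dissipative and has no non-trivial dissipative extension. $V^{-1/2}:\operatorname{rg}(V^{1/2})\to(\ker V)^\perp$ is the inverse of $V^{1/2}$ restricted to $(\ker V)^\perp$; $\operatorname{rg}$ denotes range. For a square matrix $M$, $\operatorname{Im}M:=\frac1{2\mathrm{i}}(M-M^* )$; matrix inequalities are in the sense of quadratic forms. *)

(* Defs.v *)
From HB Require Import structures.
From mathcomp Require Import all_boot all_order all_algebra.
From mathcomp Require Import all_classical all_reals all_analysis.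
From mathcomp Require Import generic_quotient ring_quotient complex.
From mathcomp Require Import measurable_realfun ring lra.
Set Implicit Arguments.
Unset Strict Implicit.
Unset Printing Implicit Defensive.
Import Order.TTheory GRing.Theory Num.Theory.
Import numFieldNormedType.Exports.
Local Open Scope classical_set_scope.
Local Open Scope ring_scope.
Local Open Scope complex_scope.
Local Open Scope quotient_scope.

Notation Re := complex.Re.
Notation Im := complex.Im.
Notation leb := lebesgue_measure.

(* Functions are defined on the whole line, but only their restriction to
   ]0, 1[ matters: elements of [L2] are classes modulo a.e. equality there. *)
Definition I01 (R : realType) : set (measurableTypeR R) := `]0, 1[%classic.

Definition sqint (R : realType) : {pred measurableTypeR R -> R[i]} :=
  [pred f : measurableTypeR R -> R[i] | `[< [/\ measurable_fun (@I01 R) (fun x => Re (f x) : R),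
      measurable_fun (@I01 R) (fun x => Im (f x) : R) &
      (\int[leb]_(x in @I01 R) (Re (f x) ^+ 2 + Im (f x) ^+ 2)%:E < +oo)%E] >]].

Lemma sqint_submod_closed (R : realType) : submod_closed (@sqint R).
Proof.
have mI : measurable (@I01 R) by exact: measurable_itv.
split.
  apply/asboolP; split => /=; try exact: measurable_cst.
  under eq_integral do rewrite expr0n addr0.
  by rewrite integral0.
move=> a f g /asboolP[mf1 mf2 lf] /asboolP[mg1 mg2 lg].
have eRe x : Re ((a *: f + g) x) = Re a * Re (f x) - Im a * Im (f x) + Re (g x).
  by rewrite [(a *: f + g) x]/(a * f x + g x); case: (a) (f x) (g x) => [? ?] [? ?] [? ?].
have eIm x : Im ((a *: f + g) x) = Re a * Im (f x) + Im a * Re (f x) + Im (g x).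
  by rewrite [(a *: f + g) x]/(a * f x + g x); case: (a) (f x) (g x) => [? ?] [? ?] [? ?].
have m1 : measurable_fun (@I01 R) (fun x => Re ((a *: f + g) x)).
  under eq_fun do rewrite eRe.
  by apply: measurable_funD => //; apply: measurable_funB;
    apply: measurable_funM => //; exact: measurable_cst.
have m2 : measurable_fun (@I01 R) (fun x => Im ((a *: f + g) x)).
  under eq_fun do rewrite eIm.
  by apply: measurable_funD => //; apply: measurable_funD;
    apply: measurable_funM => //; exact: measurable_cst.
have msq (h : measurableTypeR R -> R[i]) :
    measurable_fun (@I01 R) (fun x => Re (h x)) ->
    measurable_fun (@I01 R) (fun x => Im (h x)) ->
    measurable_fun (@I01 R) (fun x => (Re (h x) ^+ 2 + Im (h x) ^+ 2)%:E).
  move=> h1 h2; apply/measurable_EFinP.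
  by apply: measurable_funD; exact: measurable_funX.
apply/asboolP; split => //.
pose K := 2 * (Re a ^+ 2 + Im a ^+ 2).
have K0 : 0 <= K by rewrite mulr_ge0// addr_ge0// sqr_ge0.
have q0 (h : measurableTypeR R -> R[i]) x :
    (0 <= (Re (h x) ^+ 2 + Im (h x) ^+ 2)%:E)%E.
  by rewrite lee_fin addr_ge0// sqr_ge0.
apply: (@le_lt_trans _ _ (\int[leb]_(x in @I01 R)
    (K%:E * (Re (f x) ^+ 2 + Im (f x) ^+ 2)%:E
     + 2%:E * (Re (g x) ^+ 2 + Im (g x) ^+ 2)%:E))%E).
  apply: ge0_le_integral => //.
  - exact: msq.
  - by apply: emeasurable_funD; apply: emeasurable_funM => //; exact: msq.
  - move=> x _; rewrite -!EFinM -EFinD lee_fin eRe eIm /K.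
    have t := (sqr_ge0 (Re a * Re (f x) - Im a * Im (f x) - Re (g x)),
               sqr_ge0 (Re a * Im (f x) + Im a * Re (f x) - Im (g x))).
    rewrite -subr_ge0; apply: le_trans (addr_ge0 t.1 t.2) _.
    by rewrite le_eqVlt; apply/orP; left; apply/eqP; ring.
rewrite ge0_integralD//; first last.
- by apply: emeasurable_funM => //; exact: msq.
- by move=> x _; rewrite mule_ge0.
- by apply: emeasurable_funM => //; exact: msq.
- by move=> x _; rewrite mule_ge0.
rewrite !ge0_integralZl//; try exact: msq.
by rewrite lte_add_pinfty// lte_mul_pinfty.
Qed.

HB.instance Definition _ (R : realType) :=
  GRing.isSubmodClosed.Build R[i] (measurableTypeR R -> R[i]) (@sqint R)
    (@sqint_submod_closed R).

Record L2fun (R : realType) := MkL2fun {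
  L2fun_val :> measurableTypeR R -> R[i] ;
  _ : L2fun_val \in @sqint R }.

HB.instance Definition _ (R : realType) := [isSub for @L2fun_val R].
HB.instance Definition _ (R : realType) := [Choice of L2fun R by <:].
HB.instance Definition _ (R : realType) :=
  [SubChoice_isSubLmodule of L2fun R by <:].

Definition ae_eq01 (R : realType) (f g : measurableTypeR R -> R[i]) : Prop :=
  {ae leb, forall x, @I01 R x -> f x = g x}.

Definition ae_null (R : realType) : {pred L2fun R} :=
  [pred f : L2fun R | `[< ae_eq01 f (fun=> 0) >]].

Lemma ae_null_zmod_closed (R : realType) : zmod_closed (@ae_null R).
Proof.
split; first by apply/asboolP; exact: aeW.
move=> f g /asboolP f0 /asboolP g0; apply/asboolP.
move: f0 g0; apply: filterS2 => x fx gx Ix.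
by rewrite [LHS]/(f x - g x) fx// gx//= subr0.
Qed.

HB.instance Definition _ (R : realType) :=
  GRing.isZmodClosed.Build (L2fun R) (@ae_null R) (@ae_null_zmod_closed R).

Definition L2 (R : realType) : Type := Quotient.quot (@ae_null R).

HB.instance Definition _ (R : realType) := GRing.Zmodule.on (L2 R).
HB.instance Definition _ (R : realType) := EqQuotient.on (L2 R).

Definition L2_scale (R : realType) (a : R[i]) (f : L2 R) : L2 R :=
  \pi_(L2 R) (a *: repr f).

Lemma pi_L2_scale (R : realType) (a : R[i]) (f : L2fun R) :
  \pi_(L2 R) (a *: f) = L2_scale a (\pi_(L2 R) f).
Proof.
rewrite /L2_scale; apply/eqP; rewrite -Quotient.idealrBE -scalerBr.
have : f - repr (\pi_(L2 R) f) \in @ae_null R.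
  by rewrite Quotient.idealrBE reprK.
move=> /asboolP h; apply/asboolP; move: h; apply: filterS => x /[apply] h.
by rewrite [LHS]/(a * (f - repr (\pi_(L2 R) f)) x) h; exact: mulr0.
Qed.

Lemma L2_scaleA (R : realType) (a b : R[i]) (f : L2 R) :
  L2_scale a (L2_scale b f) = L2_scale (a * b) f.
Proof. by elim/quotW: f => f; rewrite -!(pi_L2_scale _ f) -pi_L2_scale scalerA. Qed.

Lemma L2_scale1 (R : realType) : left_id 1 (@L2_scale R).
Proof. by elim/quotW=> f; rewrite -pi_L2_scale scale1r. Qed.

Lemma L2_scaleDr (R : realType) : right_distributive (@L2_scale R) +%R.
Proof.
move=> a; elim/quotW=> f; elim/quotW=> g.
by rewrite -!(pi_L2_scale _ f) -!(pi_L2_scale _ g) -!raddfD -(pi_L2_scale a (f + g)).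
Qed.

Lemma L2_scaleDl (R : realType) (f : L2 R) :
  {morph (@L2_scale R)^~ f : a b / a + b}.
Proof.
by move=> a b /=; elim/quotW: f => f; rewrite -!(pi_L2_scale _ f) scalerDl raddfD.
Qed.

HB.instance Definition _ (R : realType) :=
  GRing.Zmodule_isLmodule.Build R[i] (L2 R) (@L2_scaleA R) (@L2_scale1 R)
    (@L2_scaleDr R) (@L2_scaleDl R).

Definition L2_fun (R : realType) (f : L2 R) : R -> R[i] := L2fun_val (repr f).
Coercion L2_fun : L2 >-> Funclass.

Definition Cintegral01 (R : realType) (f : R -> R[i]) : R[i] :=
  (\int[leb]_(x in @I01 R) Re (f x))%R +i* (\int[leb]_(x in @I01 R) Im (f x))%R.

(* Linear in the second argument. *)
Definition inner (R : realType) (f g : L2 R) : R[i] :=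
  Cintegral01 (fun x => (f x)^* * g x).

Definition L2norm (R : realType) (f : L2 R) : R := Num.sqrt (Re (inner f f)).

(* C^1 functions with compact support in ]0, 1[, extended by 0 to the line.
   These real test functions define the usual weak derivative: complex ones
   follow by linearity, and C^oo or C^1 makes no difference. *)
Definition test_fun (R : realType) (phi : R -> R) : Prop :=
  [/\ forall x, derivable phi x 1, continuous (derive1 phi) &
      exists a b : R, [/\ 0 < a, b < 1 &
        forall x, x \notin `[a, b] -> phi x = 0]].

Definition weak_deriv (R : realType) (f g : L2 R) : Prop :=
  forall phi : R -> R, test_fun phi ->
    Cintegral01 (fun x => f x * (derive1 phi x)%:C) =
    - Cintegral01 (fun x => g x * (phi x)%:C).

(* The weak derivative (unique when it exists; 0 is a junk value). *)
Definition wD (R : realType) (f : L2 R) : L2 R :=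
  xget 0 [set g | weak_deriv f g].

Definition H2 (R : realType) : set (L2 R) :=
  [set f | exists g h, weak_deriv f g /\ weak_deriv g h].

(* The representative of the class [f] that is continuous on [0, 1]; it is
   unique there when it exists, which is the case for [f] and [wD f] as soon
   as [f] is in [H2]. Boundary values are those of this representative. *)
Definition continuous_repr (R : realType) (f : L2 R) : R -> R[i] :=
  xget (fun=> 0) [set g : R -> R[i] |
    [/\ {within `[0, 1], continuous (fun x => Re (g x) : R)},
        {within `[0, 1], continuous (fun x => Im (g x) : R)} & ae_eq01 f g]].

Definition val0 (R : realType) (f : L2 R) : R[i] := continuous_repr f 0.
Definition val1 (R : realType) (f : L2 R) : R[i] := continuous_repr f 1.

Definition subspace (R : realType) (D : set (L2 R)) : Prop :=
  D 0 /\ forall (a : R[i]) f g, D f -> D g -> D (a *: f + g).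

Definition linear_on (R : realType) (D : set (L2 R)) (T : L2 R -> L2 R) : Prop :=
  forall (a : R[i]) f g, D f -> D g -> T (a *: f + g) = a *: T f + T g.

Definition bounded_op (R : realType) (V : L2 R -> L2 R) : Prop :=
  linear_on setT V /\ exists M : R, forall f, L2norm (V f) <= M * L2norm f.

(* The order of R[i] makes this include that [inner f (V f)] is real. *)
Definition nonneg_op (R : realType) (V : L2 R -> L2 R) : Prop :=
  forall f, 0 <= inner f (V f).

(* [xget] picks the square root of a bounded nonnegative operator, which
   exists and is unique; likewise for the other uses of [xget] below. *)
Definition sqrt_op (R : realType) (V : L2 R -> L2 R) : L2 R -> L2 R :=
  xget (fun=> 0) [set T | [/\ bounded_op T, nonneg_op T & T \o T = V]].

Definition ker_perp (R : realType) (V : L2 R -> L2 R) : set (L2 R) :=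
  [set h | forall k, V k = 0 -> inner k h = 0].

(* V^{-1/2} : rg(V^{1/2}) -> (ker V)^perp; junk value 0 outside rg(V^{1/2}). *)
Definition inv_sqrt_op (R : realType) (V : L2 R -> L2 R) (g : L2 R) : L2 R :=
  xget 0 [set h | ker_perp V h /\ sqrt_op V h = g].

(* Only the values of [app] on [dom] are meaningful: operators are compared
   with [op_eq], not with Leibniz equality. *)
Record operator (R : realType) := Operator {
  dom : set (L2 R) ;
  app :> L2 R -> L2 R }.

Definition linear_op (R : realType) (T : operator R) : Prop :=
  subspace (dom T) /\ linear_on (dom T) T.

Definition densely_defined (R : realType) (T : operator R) : Prop :=
  forall f (e : R), 0 < e -> exists2 g, dom T g & L2norm (f - g) < e.

(* [op_ext T' T]: the operator T' is an extension of T. *)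
Definition op_ext (R : realType) (T' T : operator R) : Prop :=
  dom T `<=` dom T' /\ forall f, dom T f -> T' f = T f.

Definition op_eq (R : realType) (T T' : operator R) : Prop :=
  dom T = dom T' /\ forall f, dom T f -> T f = T' f.

Definition dissipative (R : realType) (T : operator R) : Prop :=
  [/\ linear_op T, densely_defined T & forall f, dom T f -> 0 <= Im (inner f (T f))].

Definition max_dissipative (R : realType) (T : operator R) : Prop :=
  dissipative T /\
  forall T', dissipative T' -> op_ext T' T -> op_eq T' T.

Definition opS (R : realType) : operator R :=
  Operator [set f | [/\ H2 f, val0 f = 0, val1 f = 0,
                        val0 (wD f) = 0 & val1 (wD f) = 0]]
           (fun f => - wD (wD f)).

(* The adjoint of [opS], given by its explicit description. *)
Definition opSstar (R : realType) : operator R :=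
  Operator (@H2 R) (fun f => - wD (wD f)).

Definition opA (R : realType) (V : L2 R -> L2 R) : operator R :=
  Operator (dom (opS R)) (fun f => opS R f + 'i%C *: V f).

(* The component in [W] of an element of the direct sum of [D] and [W]. *)
Definition component (R : realType) (D W : set (L2 R)) (f : L2 R) : L2 R :=
  xget 0 [set w | W w /\ D (f - w)].

Definition opAWL (R : realType) (V : L2 R -> L2 R) (W : set (L2 R))
    (L : L2 R -> L2 R) : operator R :=
  Operator [set f0 + w | f0 in dom (opS R) & w in W]
    (fun f => opSstar R f + 'i%C *: V f + L (component (dom (opS R)) W f)).

Definition is_basis2 (R : realType) (W : set (L2 R)) (u v : L2 R) : Prop :=
  (forall a b : R[i], a *: u + b *: v = 0 -> a = 0 /\ b = 0) /\
  W = [set f | exists a b : R[i], f = a *: u + b *: v].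

Definition admissible (R : realType) (V : L2 R -> L2 R) (W : set (L2 R))
    (L : L2 R -> L2 R) : Prop :=
  [/\ subspace W, W `<=` dom (opSstar R), W `&` dom (opS R) = [set 0],
      exists u v, is_basis2 W u v
    & linear_on W L /\ forall w, W w -> range (sqrt_op V) (L w)].

Definition mx2 (K : Type) (a b c d : K) : 'M[K]_2 :=
  \matrix_(i < 2, j < 2)
    if i == ord0 then (if j == ord0 then a else b)
    else (if j == ord0 then c else d).

Definition ctr (R : realType) m n (M : 'M[R[i]]_(m, n)) : 'M[R[i]]_(n, m) :=
  (map_mx conjc M)^T.

Definition Im_mx (R : realType) n (M : 'M[R[i]]_n) : 'M[R[i]]_n :=
  (2 * 'i%C)^-1 *: (M - ctr M).

(* In the order of R[i], hence both quadratic forms differ by a real number;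
   this is automatic for Hermitian matrices. *)
Definition qform_le (R : realType) n (N M : 'M[R[i]]_n) : Prop :=
  forall x : 'cV[R[i]]_n,
    (ctr x *m N *m x) ord0 ord0 <= (ctr x *m M *m x) ord0 ord0.

Definition boundary_ineq (R : realType) (V L : L2 R -> L2 R) (u v : L2 R) : Prop :=
  let K := fun w => inv_sqrt_op V (L w) in
  qform_le
    (4^-1 *: mx2 (L2norm (K u) ^+ 2)%:C (inner (K u) (K v))
                 (inner (K v) (K u)) (L2norm (K v) ^+ 2)%:C)
    (Im_mx (ctr (mx2 (val0 u) (val0 v)
                     (val1 u) (val1 v)) *m
            mx2 (val0 (wD u)) (val0 (wD v))
                (- val1 (wD u)) (- val1 (wD v)))).

(* Main.v *)
Require Import Defs.
From mathcomp Require Import all_boot all_order all_algebra.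
From mathcomp Require Import all_classical all_reals all_analysis.
From mathcomp Require Import complex.
From mathcomp Require Import generic_quotient measurable_realfun ring lra.

(* Let q(f) = Im (conj f(0) f'(0) - conj f(1) f'(1)), and let B be a dissipative
   extension of A. The Cauchy-Schwarz inequality for the form Im <x, Bx>, used
   with one argument g in D(S), bounds |<g, Bf> - <Ag, f>| by a multiple of
   ||V^(1/2) g||. Hence <Sg, f> is bounded by a multiple of ||g||, so that f is
   in H^2, and a Riesz argument gives Bf = S* f + i V f + V^(1/2) k for some k
   orthogonal to ker V. Completing the square,
     Im <f, Bf> = q(f) + ||V^(1/2) f - (i/2) k||^2 - ||k||^2 / 4,
   and since V^(1/2) D(S) is dense in the orthogonal of ker V while q does not
   change under f |-> f + g with g in D(S), dissipativity of B is equivalent to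
   ||k||^2 / 4 <= q(f) for all f in D(B).
   In terms of delta = (f(0) - i f'(0), f(1) + i f'(1)) and
   eta = (f(0) + i f'(0), f(1) - i f'(1)) one has 4 q = |delta|^2 - |eta|^2.
   Where q >= 0, delta determines f modulo D(S), so D(B) / D(S) has dimension at
   most 2, and an extension with dimension 2 is maximal. If the dimension is
   smaller, some e <> 0 is orthogonal to all values of delta, and adjoining w
   with delta w = e, eta w = 0 and Lw = 0 yields a larger dissipative
   extension. *)

Set Implicit Arguments.
Unset Strict Implicit.
Unset Printing Implicit Defensive.
Import Order.TTheory GRing.Theory Num.Theory.
Import numFieldNormedType.Exports.
Local Open Scope classical_set_scope.
Local Open Scope ring_scope.

(** * Primitives of integrable functions on the line *)

Section primitive.
Variable R : realType.
Implicit Types f g : measurableTypeR R -> R.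
Local Notation mu := (@lebesgue_measure R).

(** The Cauchy-Schwarz bound involves only V^(1/2) g because q vanishes on D(S), so that Im <g, Bg>
    = ||V^(1/2) g||^2 there. Membership in H^2 rests on one fact: the orthogonal complement of the
    range of S is spanned by 1 and x. All computations in H^2 use a normal form: f is the primitive
    with value c at 0 of the primitive with value d at 0 of some h in L2. The du Bois-Reymond lemma
    supplies it. Membership in D(S) then means c = d = 0 and h orthogonal to 1 and x. The constant
    1/4 is sharp because adding elements of D(S) moves V^(1/2) f arbitrarily close to (i/2) k while
    q and k stay fixed, so the square can be made as small as desired. The condition ||k||^2 / 4 <=
    q concerns the vectors of W and not a basis; hence the matrix inequality for one basis implies
    it for all. Adjoining w preserves dissipativity by Pythagoras in C^2: |delta|^2 can only grow,
    and eta does not change. *)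

Definition primNy f (x : R) : R := \int[mu]_(t in `]-oo, x]) f t.

Lemma integrable_fin (D : set (measurableTypeR R)) f : measurable D ->
  mu.-integrable D (EFin \o f) ->
  (\int[mu]_(x in D) (f x)%:E)%E = (\int[mu]_(x in D) f x)%:E.
Proof. by move=> mD fi; rewrite /Rintegral fineK//; exact: integrable_fin_num. Qed.

Lemma integrableMl_cst (D : set (measurableTypeR R)) f (c : R) : measurable D ->
  mu.-integrable D (EFin \o f) -> mu.-integrable D (EFin \o (fun x => c * f x)).
Proof. by move=> mD fi; exact: (integrableZl mD c fi). Qed.

Lemma integrable_addr (D : set (measurableTypeR R)) f g : measurable D ->
  mu.-integrable D (EFin \o f) -> mu.-integrable D (EFin \o g) ->
  mu.-integrable D (EFin \o (fun x => f x + g x)).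
Proof. by move=> mD fi gi; exact: (integrableD mD fi gi). Qed.

Lemma integrable_subr (D : set (measurableTypeR R)) f g : measurable D ->
  mu.-integrable D (EFin \o f) -> mu.-integrable D (EFin \o g) ->
  mu.-integrable D (EFin \o (fun x => f x - g x)).
Proof. by move=> mD fi gi; exact: (integrableB mD fi gi). Qed.

Lemma primNyC f x : mu.-integrable setT (EFin \o f) ->
  \int[mu]_(t in `[x, +oo[) f t = \int[mu]_t f t - primNy f x.
Proof.
move=> fi.
have iS (A : set (measurableTypeR R)) : measurable A -> mu.-integrable A (EFin \o f).
  by move=> mA; apply: integrableS fi.
have iS' (i : interval R) : mu.-integrable [set` i] (EFin \o f).
  by apply: iS; exact: measurable_itv.
have -> : \int[mu]_t f t = \int[mu]_(t in `]-oo, x[ `|` `[x, +oo[) f t.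
  congr (Rintegral mu _ f); apply/seteqP; split => // t _ /=; rewrite !in_itv /= andbT.
  by case: ltP => h; [left|right].
rewrite Rintegral_setU//; last 2 first.
- by apply: iS; apply: measurableU; exact: measurable_itv.
- apply/disj_setPS => t [] /=; rewrite !in_itv/= andbT => a b.
  by have := lt_le_trans a b; rewrite ltxx.
by rewrite [X in X - _]addrC /primNy -Rintegral_itv_bndo_bndc// addrK.
Qed.

(** Fubini for the kernel f(x) g(y) on the half-plane y <= x: integrating in y first produces
    [primNy g], integrating in x first produces the tail of [f]. This is integration by parts for
    functions that are merely integrable. *)
Lemma primNy_Fubini f g : mu.-integrable setT (EFin \o f) ->
  mu.-integrable setT (EFin \o g) ->
  mu.-integrable setT (EFin \o (fun x => f x * primNy g x)) /\
  (\int[mu]_x (f x * primNy g x)%:E =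
   \int[mu]_x (g x * (\int[mu]_x f x - primNy f x))%:E)%E.
Proof.
move=> fi gi.
have iS (h : measurableTypeR R -> R) (A : set (measurableTypeR R)) : mu.-integrable setT (EFin \o h) ->
    measurable A -> mu.-integrable A (EFin \o h).
  by move=> hi mA; apply: integrableS hi.
pose A := [set z : measurableTypeR R * measurableTypeR R | z.2 <= z.1].
have mA : measurable A.
  rewrite (_ : A = (fun z : measurableTypeR R * measurableTypeR R => z.2 <= z.1) @^-1` [set true]).
    rewrite -[X in measurable X]setTI.
    apply: (@measurable_fun_ler _ _ R setT (fun z : measurableTypeR R * measurableTypeR R => z.2) fst) => //; exact: measurable_snd.
  by apply/seteqP; split => z /=.
pose K z := (f z.1 * g z.2 * \1_A z)%:E.
have mf := measurable_int _ fi; have mg := measurable_int _ gi.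
have maf : measurable_fun setT (fun x => `|f x|%:E).
  by apply/measurable_EFinP/measurableT_comp => //; exact/measurable_EFinP.
have mag : measurable_fun setT (fun x => `|g x|%:E).
  by apply/measurable_EFinP/measurableT_comp => //; exact/measurable_EFinP.
have mK : measurable_fun setT K.
  apply/measurable_EFinP; apply: measurable_funM; last exact: measurable_indic.
  apply: measurable_funM.
    by apply: (measurableT_comp (f := f)) => //; exact/measurable_EFinP.
  by apply: (measurableT_comp (f := g)) => //; exact/measurable_EFinP.
have iK : (mu \x mu)%E.-integrable setT K.
  apply/integrable12ltyP => //.
  have fin h : mu.-integrable setT (EFin \o h) ->
      (\int[mu]_x `|(h x)%:E| = (\int[mu]_x `|h x|)%:E)%E.
    by move=> hi; rewrite -integrable_fin//; exact: integrable_norm.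
  apply: (@le_lt_trans _ _ (\int[mu]_x (`|(f x)%:E| * \int[mu]_y `|(g y)%:E|))%E).
    apply: ge0_le_integral => //=.
    - by move=> x _; apply: integral_ge0.
    - exact: (measurable_fun_fubini_tonelli_F (m2 := mu) (fun z => `|K z|%E)) (measurableT_comp _ mK) (fun=> abse_ge0 _).
    - apply: emeasurable_funM => //.
    - move=> x _; rewrite -ge0_integralZl//.
      apply: ge0_le_integral => //=.
      + have mKx : measurable_fun setT (fun y => K (x, y)).
          exact: measurableT_comp mK (pair1_measurable x).
        by apply: (measurableT_comp (f := abse) _ mKx).
      + by apply: emeasurable_funM.
      + move=> y _; rewrite -EFinM lee_fin !normrM ler_piMr ?mulr_ge0//.
        by rewrite indicE; case: (_ \in _); rewrite ?normr1 ?normr0.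
  rewrite fin//; under eq_integral do rewrite muleC.
  rewrite ge0_integralZl//.
    by rewrite fin// -EFinM ltry.
  by rewrite lee_fin Rintegral_ge0.
have mulz (h : measurableTypeR R -> R) (c : R) (B : set (measurableTypeR R)) : measurable B ->
   mu.-integrable setT (EFin \o h) ->
   (\int[mu]_x (c * h x * \1_B x)%:E = (c * \int[mu]_(x in B) h x)%:E)%E.
  move=> mB hi.
  rewrite -RintegralZl//; last exact: iS.
  rewrite -integrable_fin//; last first.
    by apply: integrableMl_cst => //; exact: iS.
  rewrite [RHS]integral_mkcond; apply: eq_integral => x _.
  by rewrite patchE indicE; case: (_ \in _); rewrite /= ?(mulr1, mulr0).
have H1 x : (\int[mu]_y K (x, y) = (f x * primNy g x)%:E)%E.
  rewrite -mulz//; apply: eq_integral => y _; congr (_ * _)%:E.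
have H2 y : (\int[mu]_x K (x, y) = (g y * (\int[mu]_x f x - primNy f y))%:E)%E.
  rewrite -primNyC// -mulz//; apply: eq_integral => x _; rewrite /K /= (mulrC (f x)).
  congr (_ * _)%:E.
  by rewrite !indicE; congr ((nat_of_bool _)%:R); apply/idP/idP; rewrite !inE /A /= in_itv/= andbT.
have I1 := integrable_fubini_F iK.
have E1 : fubini_F mu K = EFin \o (fun x => f x * primNy g x) by apply/funext => x; exact: H1.
rewrite E1 in I1; split => //.
under eq_integral do rewrite -H1.
under [RHS]eq_integral do rewrite -H2.
exact: Fubini.
Qed.

Lemma primNy_mulr f g : mu.-integrable setT (EFin \o f) ->
  mu.-integrable setT (EFin \o g) ->
  \int[mu]_x (f x * primNy g x) =
    \int[mu]_x f x * \int[mu]_x g x - \int[mu]_x (g x * primNy f x).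
Proof.
move=> fi gi; have [_] := primNy_Fubini fi gi.
have [gf _] := primNy_Fubini gi fi.
move=> /(congr1 fine) ; rewrite -!/(Rintegral _ _ _) => ->.
rewrite -RintegralZl// -RintegralB//.
  by apply: eq_Rintegral => x _; ring.
exact: integrableMl_cst.
Qed.

End primitive.

Section primitive2.
Variable R : realType.
Implicit Types f g : measurableTypeR R -> R.
Local Notation mu := (@lebesgue_measure R).

Lemma ae_imp (P Q : R -> Prop) : (forall x, P x -> Q x) ->
  {ae mu, forall x, P x} -> {ae mu, forall x, Q x}.
Proof.
move=> PQ; apply: filterS; first exact: (ae_filter_ringOfSetsType mu).
exact: PQ.
Qed.

Lemma ae_imp2 (P Q S : R -> Prop) : (forall x, P x -> Q x -> S x) ->
  {ae mu, forall x, P x} -> {ae mu, forall x, Q x} -> {ae mu, forall x, S x}.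
Proof.
move=> PQ; apply: filterS2; first exact: (ae_filter_ringOfSetsType mu).
exact: PQ.
Qed.

Lemma primNyB f x y : mu.-integrable setT (EFin \o f) -> x <= y ->
  primNy f y - primNy f x = \int[mu]_(t in `]x, y]) f t.
Proof.
move=> fi xy; rewrite Rintegral_itvB//.
by apply: integrableS fi => //; exact: measurable_itv.
Qed.

Lemma primNy_continuous f : mu.-integrable setT (EFin \o f) ->
  continuous (primNy f).
Proof.
move=> fi x; apply/cvgrPdist_lt => /= e e0.
have [d [d0 H]] := integral_normr_continuous fi e0.
have dist (a b : R) : a <= b -> b - a < d -> `|primNy f b - primNy f a| < e.
  move=> ab bad; rewrite primNyB//.
  have mab : (mu `]a, b] < d%:E)%E.
    by rewrite lebesgue_measure_itv/=; case: ifP => _; rewrite ?lte_fin// -EFinB lte_fin.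
  apply: le_lt_trans (H `]a, b]%classic _ _).
  - apply: le_normr_Rintegral => //.
    by apply: integrableS fi => //; exact: measurable_itv.
  - exact: measurable_itv.
  - exact: mab.
near=> y.
have xyd : `|x - y| < d by near: y; exact: cvgr_dist_lt.
have [xy|/ltW yx] := leP x y.
  by rewrite distrC dist// (le_lt_trans _ xyd)// distrC ler_norm.
by rewrite dist// (le_lt_trans _ xyd)// ler_norm.
Unshelve. all: by end_near. Qed.

Lemma primNy_setT f x : mu.-integrable setT (EFin \o f) ->
  (forall y, x <= y -> f y = 0) -> \int[mu]_t f t = primNy f x.
Proof.
move=> fi f0; apply/eqP; rewrite -subr_eq0 -primNyC//; apply/eqP.
rewrite (@eq_Rintegral _ _ _ _ _ (cst 0)) ?Rintegral_cst ?mul0r//.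
by move=> y; rewrite inE/= in_itv/= andbT; exact: f0.
Qed.

Lemma primNy_eq0 f x : (forall y, y <= x -> f y = 0) -> primNy f x = 0.
Proof.
move=> f0; rewrite /primNy (@eq_Rintegral _ _ _ _ _ (cst 0)) ?Rintegral_cst ?mul0r//.
by move=> y; rewrite inE/= in_itv/=; exact: f0.
Qed.

Lemma integrable_locallyT f : mu.-integrable setT (EFin \o f) ->
  locally_integrable setT f.
Proof. move=> fi; have := integrable_locally measurableT fi.
by congr locally_integrable; apply/funext => x; rewrite patchE in_setT. Qed.

Lemma primNy_ae_derivative f : mu.-integrable setT (EFin \o f) ->
  {ae mu, forall x, derive1 (primNy f) x = f x}.
Proof.
move=> fi.
have fiy y : mu.-integrable `]-oo, y] (EFin \o f).
  by apply: integrableS fi => //; exact: measurable_itv.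
have := FTC1Ny fiy (integrable_locallyT fi).
by apply: ae_imp => x [].
Qed.

(** By Lebesgue differentiation [f] is almost everywhere the derivative of [primNy f], which is
    locally constant on [A]. *)
Lemma primNy_cst_ae0 f (A : set R) c : mu.-integrable setT (EFin \o f) ->
  open A -> (forall x, A x -> primNy f x = c) ->
  {ae mu, forall x, A x -> f x = 0}.
Proof.
move=> fi oA fc; have := primNy_ae_derivative fi.
apply: ae_imp => x <- Ax; rewrite derive1E.
have -> : 'D_1 (primNy f) x = 'D_1 (cst c) x.
  apply: near_eq_derive => //=.
  by have := open_nbhs_nbhs (conj oA Ax); apply: filterS => y /fc.
by rewrite derive_cst.
Qed.

Lemma test_fun_derive0 (phi : R -> R) a b : (forall x, x \notin `[a, b] -> phi x = 0) ->
  forall x, x \notin `[a, b] -> derive1 phi x = 0.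
Proof.
move=> h x xab; rewrite derive1E.
have -> : 'D_1 phi x = 'D_1 (cst 0 : R -> R) x.
  apply: near_eq_derive => //=.
  have oC : open (~` `[a, b]%classic : set R) by apply: closed_openC; exact: interval_closed.
  have := @open_nbhs_nbhs _ x _ (conj oC _); rewrite /= => /(_ (elimN idP xab)).
  by apply: filterS => y /negP/h.
by rewrite derive_cst.
Qed.

Lemma cts_cpt_integrable (psi : R -> R) a b : continuous psi ->
  (forall x, x \notin `[a, b] -> psi x = 0) -> mu.-integrable setT (EFin \o psi).
Proof.
move=> cpsi h.
have -> : psi = psi \_ `[a, b].
  apply/funext => x; rewrite patchE; case: ifPn => //.
  by rewrite notin_setE /= => /negP/h.
rewrite -restrict_EFin; apply/(integrable_mkcond _ _).1 => //.
apply: continuous_compact_integrable; first exact: segment_compact.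
exact: continuous_subspaceT.
Qed.

Lemma test_fun_integrable (phi : R -> R) : test_fun phi ->
  [/\ mu.-integrable setT (EFin \o derive1 phi), mu.-integrable setT (EFin \o phi) &
  primNy (derive1 phi) = phi].
Proof.
case=> dphi cdphi [a [b [a0 b1 h]]].
have phii := cts_cpt_integrable cdphi (test_fun_derive0 h).
split => //.
  apply: (cts_cpt_integrable _ h) => x.
  by apply: differentiable_continuous; apply/derivable1_diffP.
apply/funext => x.
have dP y : derivable (primNy (derive1 phi)) y 1 /\ derive1 (primNy (derive1 phi)) y = derive1 phi y.
  apply: (@continuous_FTC1 _ _ _ _ (y + 1)) => //; first by rewrite ltrDl.
  - by apply: integrableS phii => //; exact: measurable_itv.
  - by rewrite ltNyr.
  - exact: cdphi.
(* The difference has derivative 0, hence is constant; it is evaluated at a point to the left of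
   [a], where both terms vanish. *)
have : (primNy (derive1 phi) \- phi) x = (primNy (derive1 phi) \- phi) (Num.min x a - 1).
  apply: is_derive_0_is_cst => y.
  apply: DeriveDef; first by apply: derivableB => //; case: (dP y).
  rewrite (deriveB (dP y).1 (dphi y)) -(derive1E (primNy _)) (dP y).2.
  by rewrite derive1E subrr.
set m := Num.min x a - 1.
have out y : y <= m -> y \notin `[a, b].
  move=> ym; rewrite in_itv/= negb_and -ltNge (le_lt_trans ym)// /m.
  by rewrite ltrBlDr (@le_lt_trans _ _ a)// ?ge_min ?lexx ?orbT// ltrDl.
have P0 : primNy (derive1 phi) m = 0.
  by apply: primNy_eq0 => y /out; exact: test_fun_derive0.
by rewrite /= P0 (h m) ?out// subrr => /eqP; rewrite subr_eq0 => /eqP.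
Qed.

End primitive2.

(** * Hat functions and the du Bois-Reymond lemma *)

Section hats.
Variable R : realType.
Implicit Types f g : measurableTypeR R -> R.
Local Notation mu := (@lebesgue_measure R).

Lemma measurable_ballR (s e : R) : measurable (ball s e : set (measurableTypeR R)).
Proof. exact: measurable_ball. Qed.

Lemma integrable_cst_lty (A : set (measurableTypeR R)) (c : R) : measurable A ->
  (mu A < +oo)%E -> mu.-integrable A (EFin \o cst c).
Proof.
move=> mA Aoo; apply/integrableP; split; first exact/measurable_EFinP.
rewrite (eq_integral (cst `|c|%:E))//.
by rewrite integral_cst//= lte_mul_pinfty.
Qed.

Lemma ball_lty (s e : R) : (mu (ball s e : set (measurableTypeR R)) < +oo)%E.
Proof.
have [e0|e0] := ltP 0 e; last by rewrite (ball0 _ _).2// measure0.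
by have := lebesgue_measure_ball s (ltW e0); move=> /= ->; rewrite ltry.
Qed.

Lemma osc_integrable f s e : mu.-integrable setT (EFin \o f) ->
  mu.-integrable (ball s e) (EFin \o (fun y => `|f y - f s|)).
Proof.
move=> fi; have mb := measurable_ballR s e.
apply: (@integrable_norm _ _ _ mu _ (fun y => f y - f s)); apply: integrable_subr => //.
  by apply: integrableS fi.
by apply: integrable_cst_lty => //; exact: ball_lty.
Qed.

Lemma lebesgue_pt_osc f s d : mu.-integrable setT (EFin \o f) -> lebesgue_pt f s -> 0 < d ->
  \forall e \near (0:R)^'+, \int[mu]_(y in ball s e) `|f y - f s| < d * e.
Proof.
move=> fi /fine_cvgP[_ fs] d0.
(* Half of [d], because the mean oscillation divides by the length [2 e] of the ball. *)
have d20 : 0 < d / 2 by rewrite divr_gt0.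
near=> e.
have e0 : 0 < e by near: e; exact: nbhs_right_gt.
have : fine (davg f s e) < d / 2.
  near: e.
  exact: cvgr_lt fs _ d20.
have e2 : e *+ 2 != 0 by rewrite mulrn_eq0/= gt_eqF.
rewrite /davg /iavg (lebesgue_measure_ball _ (ltW e0)) inver (negbTE e2).
rewrite integrable_fin; [|exact: measurable_ballR|exact: osc_integrable].
rewrite -EFinM/= mulrC ltr_pdivrMr ?mulrn_wgt0//.
rewrite (_ : d / 2 * (e *+ 2) = d * e)//; by field.
Unshelve. all: by end_near. Qed.

(** A tent of height 1 on the ball of radius [e]. It is continuous, unlike an indicator function, so
    that primitives of combinations of hats are C^1 as [test_fun] demands. *)
Definition hat (s e x : R) : R := Num.max 0 (1 - `|x - s| / e).

Lemma hat_continuous s e : continuous (hat s e).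
Proof.
move=> x; apply: (@continuous_max _ _ (cst 0) (fun x => 1 - `|x - s| / e)); first exact: cst_continuous.
apply: cvgB; first exact: cvg_cst.
apply: cvgM; last exact: cvg_cst.
by apply: cvg_norm; apply: cvgB; [exact: cvg_id|exact: cvg_cst].
Qed.

Lemma hat_ge0 s e x : 0 <= hat s e x.
Proof. by rewrite le_max lexx. Qed.

Lemma hat_le1 s e x : 0 < e -> hat s e x <= 1.
Proof. by move=> e0; rewrite ge_max ler01 lerBlDr lerDl divr_ge0// ltW. Qed.

Lemma hat_out s e x : 0 < e -> e <= `|x - s| -> hat s e x = 0.
Proof.
move=> e0 ex; apply/max_idPl; rewrite subr_le0 ler_pdivlMr// mul1r//.
Qed.

Lemma hat_out_itv s e a b x : 0 < e -> a <= s - e -> s + e <= b -> x \notin `[a, b] -> hat s e x = 0.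
Proof.
move=> e0 ase seb; rewrite in_itv/= negb_and -!ltNge => /orP[] h; apply: hat_out => //.
  by rewrite distrC (le_trans _ (ler_norm _))//; lra.
by rewrite (le_trans _ (ler_norm _))//; lra.
Qed.

Lemma hat_integrable s e : 0 < e -> mu.-integrable setT (EFin \o hat s e).
Proof.
move=> e0; apply: (@cts_cpt_integrable _ _ (s - e) (s + e)); first exact: hat_continuous.
by move=> x; apply: hat_out_itv.
Qed.

(** The hat is at least 1/2 on the ball of radius [e / 2], whose length is [e]. *)
Lemma hat_mass s e : 0 < e -> e / 2 <= \int[mu]_x hat s e x.
Proof.
move=> e0; have e20 : 0 < e / 2 by rewrite divr_gt0.
have mb := measurable_ballR s (e / 2).
have -> : e / 2 = \int[mu]_(x in ball s (e / 2)) (1/2).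
  rewrite (Rintegral_cst mu mb).
  transitivity (1 / 2 * fine (e / 2 *+ 2)%:E); first by rewrite /=; field.
  by congr (_ * fine _); exact: (esym (lebesgue_measure_ball s (ltW e20))).
rewrite Rintegral_mkcond; apply: le_Rintegral => //.
- rewrite -restrict_EFin; apply/(integrable_mkcond _ mb).1.
  by apply: integrable_cst_lty => //; exact: ball_lty.
- exact: hat_integrable.
- move=> x _; rewrite patchE; case: ifPn => [|_]; last exact: hat_ge0.
  rewrite inE /ball/= distrC => xs; rewrite le_max; apply/orP; right.
  have : `|x - s| / e <= 1 / 2 by rewrite ler_pdivrMr//; lra.
  lra.
Qed.

Lemma mulhat_integrable f s e : 0 < e -> mu.-integrable setT (EFin \o f) ->
  mu.-integrable setT (EFin \o (fun x => f x * hat s e x)).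
Proof.
move=> e0 fi.
have /measurable_EFinP mf := measurable_int _ fi.
have /measurable_EFinP mh := measurable_int _ (hat_integrable s e0).
apply: (@le_integrable _ _ _ mu setT _ _ (EFin \o f)) => //.
  by apply/measurable_EFinP; apply: measurable_funM.
move=> x _ /=; rewrite lee_fin normrM ler_piMr// ger0_norm ?hat_ge0//.
exact: hat_le1.
Qed.

Lemma hat_osc f s e : 0 < e -> mu.-integrable setT (EFin \o f) ->
  `|\int[mu]_x (f x * hat s e x) - f s * \int[mu]_x hat s e x| <=
  \int[mu]_(y in ball s e) `|f y - f s|.
Proof.
move=> e0 fi; have hi := hat_integrable s e0; have fhi := mulhat_integrable s e0 fi.
have mb := measurable_ballR s e.
rewrite -RintegralZl// -RintegralB//; last exact: integrableMl_cst.
have di : mu.-integrable setT (EFin \o (fun x => f x * hat s e x - f s * hat s e x)).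
  by apply: integrable_subr => //; exact: integrableMl_cst.
apply: le_trans (le_normr_Rintegral _ di) _ => //.
rewrite [leRHS]Rintegral_mkcond; apply: le_Rintegral => //.
- exact: integrable_norm.
- by rewrite -restrict_EFin; apply/(integrable_mkcond _ mb).1; exact: osc_integrable.
- move=> x _; rewrite patchE -mulrBl normrM (ger0_norm (hat_ge0 _ _ _)).
  case: ifPn => [_|].
    by rewrite ler_piMr//; exact: hat_le1.
  by rewrite notin_setE /ball/= distrC => /negP; rewrite -leNgt => /hat_out ->//; rewrite mulr0.
Qed.

(** The zero mean makes the primitive vanish again to the right of [b]. *)
Lemma test_fun_prim (psi : R -> R) a b : continuous psi -> 0 < a -> b < 1 ->
  (forall x, x \notin `[a, b] -> psi x = 0) -> \int[mu]_x psi x = 0 ->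
  test_fun (primNy psi) /\ derive1 (primNy psi) = psi.
Proof.
move=> cpsi a0 b1 h psi0.
have psii := cts_cpt_integrable cpsi h.
have dP y : derivable (primNy psi) y 1 /\ derive1 (primNy psi) y = psi y.
  apply: (@continuous_FTC1 _ _ _ _ (y + 1)) => //; first by rewrite ltrDl.
  - by apply: integrableS psii => //; exact: measurable_itv.
  - by rewrite ltNyr.
  - exact: cpsi.
have dE : derive1 (primNy psi) = psi by apply/funext => y; case: (dP y).
split => //; split.
- by move=> x; case: (dP x).
- by rewrite dE.
- exists a, b; split => // x; rewrite in_itv/= negb_and -!ltNge => /orP[xa|bx].
    apply: primNy_eq0 => y yx; apply: h; rewrite in_itv/= negb_and -!ltNge.
    by rewrite (le_lt_trans yx xa).
  rewrite -psi0; apply/esym; apply: primNy_setT => // y xy; apply: h.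
  by rewrite in_itv/= negb_and -!ltNge (lt_le_trans bx xy) orbT.
Qed.

(** Testing with the primitive of a mean-zero combination of two hats shows that the hat-weighted
    means of [f] around [s] and [t] agree. At Lebesgue points these means tend to [f s] and [f t] as
    the hats shrink. *)
Lemma du_bois_reymond f : mu.-integrable setT (EFin \o f) ->
  (forall phi, test_fun phi -> \int[mu]_x (f x * derive1 phi x) = 0) ->
  exists c, {ae mu, forall x, @I01 R x -> f x = c}.
Proof.
move=> fi H.
have aeL := lebesgue_differentiation (integrable_locallyT fi).
have const s t : @I01 R s -> @I01 R t -> lebesgue_pt f s -> lebesgue_pt f t -> f s = f t.
  rewrite /I01 /= !in_itv/= => /andP[s0 s1] /andP[t0 t1] ls lt.
  apply/eqP; rewrite -subr_eq0 -normr_le0 -(@pmulr_rle0 _ (4^-1)) ?invr_gt0//.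
  (* [d] is a quarter of |f s - f t|. Each weighted mean will lie within [2 * d] of the value at its
     centre, strictly, which contradicts the equality of the means. *)
  rewrite leNgt; apply/negP => d0; set d := _ * _ in d0.
  near (0:R)^'+ => e.
  have e0 : 0 < e by near: e; exact: nbhs_right_gt.
  have es : e < s by near: e; exact: nbhs_right_lt.
  have et : e < t by near: e; exact: nbhs_right_lt.
  have es1 : e < 1 - s by near: e; apply: nbhs_right_lt; rewrite subr_gt0.
  have et1 : e < 1 - t by near: e; apply: nbhs_right_lt; rewrite subr_gt0.
  have Os : \int[mu]_(y in ball s e) `|f y - f s| < d * e by near: e; exact: lebesgue_pt_osc.
  have Ot : \int[mu]_(y in ball t e) `|f y - f t| < d * e by near: e; exact: lebesgue_pt_osc.
  pose a := Num.min s t - e; pose b := Num.max s t + e.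
  set Is := \int[mu]_x hat s e x; set It := \int[mu]_x hat t e x.
  (* Each hat is weighted by the mass of the other, so the integral is 0. *)
  pose psi x := It * hat s e x - Is * hat t e x.
  have his := hat_integrable s e0. have hit := hat_integrable t e0.
  have psi0 x : x \notin `[a, b] -> psi x = 0.
    move=> xab; rewrite /psi !(hat_out_itv _ _ _ xab) ?mulr0 ?subr0//.
    + by rewrite /a lerD2r ge_min lexx orbT.
    + by rewrite /b lerD2r le_max lexx orbT.
    + by rewrite /a lerD2r ge_min lexx.
    + by rewrite /b lerD2r le_max lexx.
  have cpsi : continuous psi.
    by move=> x; apply: cvgB; (apply: cvgM; [exact: cvg_cst|exact: hat_continuous]).
  have [tpsi dpsi] : test_fun (primNy psi) /\ derive1 (primNy psi) = psi.
    apply: (@test_fun_prim _ a b) => //.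
    + by rewrite /a subr_gt0 lt_min es et.
    + by rewrite /b -ltrBrDr gt_max; apply/andP; split; lra.
    + rewrite /psi RintegralB//; [|exact: integrableMl_cst|exact: integrableMl_cst].
      by rewrite !RintegralZl// -/Is -/It mulrC subrr.
  have := H _ tpsi; rewrite dpsi.
  have -> : (fun x => f x * psi x) = (fun x => It * (f x * hat s e x) - Is * (f x * hat t e x)).
    by apply/funext => x; rewrite /psi; ring.
  have fhs := mulhat_integrable s e0 fi; have fht := mulhat_integrable t e0 fi.
  rewrite RintegralB//; [|exact: integrableMl_cst|exact: integrableMl_cst].
  rewrite !RintegralZl//.
  have := hat_osc s e0 fi; have := hat_osc t e0 fi; rewrite -/Is -/It.
  set Fs := \int[mu]_x (f x * hat s e x); set Ft := \int[mu]_x (f x * hat t e x).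
  move=> ht hs /eqP; rewrite subr_eq0 => /eqP FI.
  have Ms : e / 2 <= Is by exact: hat_mass.
  have Mt : e / 2 <= It by exact: hat_mass.
  have e20 : 0 < e / 2 by rewrite divr_gt0.
  have Is0 := lt_le_trans e20 Ms; have It0 := lt_le_trans e20 Mt.
  have bnd (F I c O : R) : 0 < I -> e / 2 <= I -> `|F - c * I| <= O -> O < d * e ->
      `|F / I - c| < 2 * d.
    move=> I0 eI h1 h2.
    have -> : F / I - c = (F - c * I) / I by field; rewrite gt_eqF.
    rewrite normrM [X in _ * X]gtr0_norm ?invr_gt0// ltr_pdivrMr//.
    apply: (le_lt_trans h1); apply: (lt_le_trans h2).
    rewrite (_ : d * e = 2 * d * (e / 2)); last by field.
    by rewrite ler_pM2l// mulr_gt0.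
  have b1 := bnd _ _ _ _ Is0 Ms hs Os; have b2 := bnd _ _ _ _ It0 Mt ht Ot.
  have E : Fs / Is = Ft / It.
    by apply/eqP; rewrite (eqr_div _ _ (lt0r_neq0 Is0) (lt0r_neq0 It0)) (mulrC Fs) FI mulrC.
  have : `|f s - f t| < 4 * d.
    have -> : f s - f t = (Ft / It - f t) - (Fs / Is - f s) by rewrite E; ring.
    by apply: le_lt_trans (ler_normB _ _) _; lra.
  by rewrite /d mulrA divff// mul1r ltxx.
have [s Is ls] : exists2 s, @I01 R s & lebesgue_pt f s.
  apply: contrapT => h.
  case: aeL => N [mN N0 sub].
  have : (mu (@I01 R) <= 0)%E.
    rewrite -N0; apply: le_measure; rewrite ?inE//; first exact: measurable_itv.
    by move=> x Ix; apply: sub => lx; apply: h; exists x.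
  by rewrite leNgt lebesgue_measure_itv/= lte_fin ltr01 oppr0 adde0 lte_fin ltr01.
exists (f s).
by move: aeL; apply: ae_imp => x lx Ix; exact: const.
Unshelve. all: by end_near. Qed.

End hats.

(* These names are shadowed by the libraries. *)
Local Notation Re := complex.Re.
Local Notation Im := complex.Im.
Local Notation val0 := Defs.val0.
Local Notation val1 := Defs.val1.
Local Notation component := Defs.component.
Local Open Scope complex_scope.

(** * The Hilbert space L2(0,1) *)

Section complex_parts.
Variable R : rcfType.
Implicit Types x y : R[i].

Lemma cReD x y : Re (x + y) = Re x + Re y. Proof. by case: x y => [? ?] [? ?]. Qed.
Lemma cImD x y : Im (x + y) = Im x + Im y. Proof. by case: x y => [? ?] [? ?]. Qed.
Lemma cReN x : Re (- x) = - Re x. Proof. by case: x. Qed.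
Lemma cImN x : Im (- x) = - Im x. Proof. by case: x. Qed.
Lemma cReM x y : Re (x * y) = Re x * Re y - Im x * Im y.
Proof. by case: x y => [? ?] [? ?]. Qed.
Lemma cImM x y : Im (x * y) = Re x * Im y + Im x * Re y.
Proof. by case: x y => [? ?] [? ?]. Qed.
Lemma cReJ x : Re (x^*) = Re x. Proof. by case: x. Qed.
Lemma cImJ x : Im (x^*) = - Im x. Proof. by case: x. Qed.
Lemma complex_eqP x y : Re x = Re y -> Im x = Im y -> x = y.
Proof. by case: x y => [? ?] [? ?] /= -> ->. Qed.
Definition ReImE := (cReD, cImD, cReN, cImN, cReM, cImM, cReJ, cImJ).
End complex_parts.

Section complex_integral.
Variable R : realType.
Implicit Types f g : measurableTypeR R -> R[i].
Local Notation mu := (@lebesgue_measure R).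
Local Notation I01 := (@I01 R).

Lemma measurable_I01 : measurable I01.
Proof. exact: measurable_itv. Qed.
Hint Resolve measurable_I01 : core.

Definition cintegrable f :=
  mu.-integrable I01 (EFin \o (fun x => Re (f x))) /\
  mu.-integrable I01 (EFin \o (fun x => Im (f x))).

Lemma cintegrableD f g : cintegrable f -> cintegrable g ->
  cintegrable (fun x => f x + g x).
Proof.
move=> [f1 f2] [g1 g2]; split; under eq_fun do rewrite ReImE; exact: integrable_addr.
Qed.

Lemma cintegrableZ (a : R[i]) f : cintegrable f -> cintegrable (fun x => a * f x).
Proof.
move=> [f1 f2]; split; under eq_fun do rewrite ReImE.
  by apply: integrable_subr => //; exact: integrableMl_cst.
by apply: integrable_addr => //; exact: integrableMl_cst.
Qed.

Lemma cintegrableJ f : cintegrable f -> cintegrable (fun x => (f x)^*).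
Proof.
move=> [f1 f2]; split; under eq_fun do rewrite ReImE; first by [].
by under eq_fun do rewrite -mulN1r; exact: integrableMl_cst.
Qed.

Lemma CintegralD f g : cintegrable f -> cintegrable g ->
  Cintegral01 (fun x => f x + g x) = Cintegral01 f + Cintegral01 g.
Proof.
move=> [f1 f2] [g1 g2]; apply: complex_eqP; rewrite ReImE /=.
  by under eq_Rintegral do rewrite cReD; rewrite RintegralD.
by under eq_Rintegral do rewrite cImD; rewrite RintegralD.
Qed.

Lemma CintegralZ (a : R[i]) f : cintegrable f ->
  Cintegral01 (fun x => a * f x) = a * Cintegral01 f.
Proof.
move=> [f1 f2]; apply: complex_eqP; rewrite ReImE /=.
  under eq_Rintegral do rewrite cReM.
  by rewrite RintegralB// ?RintegralZl//; exact: integrableMl_cst.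
under eq_Rintegral do rewrite cImM.
by rewrite RintegralD// ?RintegralZl//; exact: integrableMl_cst.
Qed.

Lemma CintegralJ f : cintegrable f ->
  Cintegral01 (fun x => (f x)^*) = (Cintegral01 f)^*.
Proof.
move=> [f1 f2]; apply: complex_eqP; rewrite ReImE /=.
  by under eq_Rintegral do rewrite cReJ.
under eq_Rintegral do rewrite cImJ -mulN1r.
by rewrite RintegralZl// mulN1r.
Qed.

Lemma Rintegral_ae (D : set (measurableTypeR R)) (f g : measurableTypeR R -> R) : measurable D ->
  mu.-integrable D (EFin \o f) -> mu.-integrable D (EFin \o g) ->
  {ae mu, forall x, D x -> f x = g x} ->
  \int[mu]_(x in D) f x = \int[mu]_(x in D) g x.
Proof.
move=> mD fi gi fg; congr fine; apply: ae_eq_integral => //.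
- exact: measurable_int fi.
- exact: measurable_int gi.
- by move: fg; apply: ae_imp => x h /h /= ->.
Qed.

Lemma Cintegral_ae f g : cintegrable f -> cintegrable g -> ae_eq01 f g ->
  Cintegral01 f = Cintegral01 g.
Proof.
move=> [f1 f2] [g1 g2] fg; apply: complex_eqP => /=; apply: Rintegral_ae => //.
  by move: fg; apply: ae_imp => x h /h ->.
by move: fg; apply: ae_imp => x h /h ->.
Qed.

Lemma ae_eq01_sym f g : ae_eq01 f g -> ae_eq01 g f.
Proof. by apply: ae_imp => x h /h. Qed.

Lemma ae_eq01_trans f g h : ae_eq01 f g -> ae_eq01 g h -> ae_eq01 f h.
Proof. by apply: ae_imp2 => x fg gh xI; rewrite fg// gh. Qed.

Lemma ae_eq01_refl f : ae_eq01 f f.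
Proof. exact: aeW. Qed.

Lemma I01_lty : (mu I01 < +oo)%E.
Proof. by rewrite lebesgue_measure_itv/= lte_fin ltr01 oppr0 adde0 ltry. Qed.

Lemma sqintP f : reflect [/\ measurable_fun I01 (fun x => Re (f x)),
  measurable_fun I01 (fun x => Im (f x)) &
  mu.-integrable I01 (EFin \o (fun x => Re (f x) ^+ 2 + Im (f x) ^+ 2))] (f \in @sqint R).
Proof.
rewrite inE /=; apply: (iffP (asboolP _)) => -[m1 m2 h]; split => //.
  apply/integrableP; split.
    by apply/measurable_EFinP; apply: measurable_funD; exact: measurable_funX.
  apply: le_lt_trans h.
  rewrite le_eqVlt; apply/orP; left; apply/eqP; apply: eq_integral => x _ /=.
  by rewrite ger0_norm// addr_ge0 ?sqr_ge0.
move/integrableP : h => [_]; apply: le_lt_trans.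
rewrite le_eqVlt; apply/orP; left; apply/eqP; apply: eq_integral => x _ /=.
by rewrite ger0_norm// addr_ge0 ?sqr_ge0.
Qed.

Lemma sqint_mul (f g : measurableTypeR R -> R[i]) :
  f \in @sqint R -> g \in @sqint R -> cintegrable (fun x => f x * g x).
Proof.
move=> /sqintP[f1 f2 fi] /sqintP[g1 g2 gi].
have dom (h : measurableTypeR R -> R) : measurable_fun I01 h ->
   (forall x, `|h x| <= (Re (f x) ^+ 2 + Im (f x) ^+ 2) + (Re (g x) ^+ 2 + Im (g x) ^+ 2)) ->
   mu.-integrable I01 (EFin \o h).
  move=> mh hle; apply: le_integrable (integrable_addr _ fi gi) => //; first exact/measurable_EFinP.
  by move=> x _ /=; rewrite lee_fin (le_trans (hle _))// ler_norm.
have sq (a b c d : R) : `|a * b - c * d| <= a ^+ 2 + c ^+ 2 + (b ^+ 2 + d ^+ 2).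
  have h1 := sqr_ge0 (a - b); have h2 := sqr_ge0 (a + b).
  have h3 := sqr_ge0 (c - d); have h4 := sqr_ge0 (c + d).
  have h5 := sqr_ge0 a; have h6 := sqr_ge0 b; have h7 := sqr_ge0 c; have h8 := sqr_ge0 d.
  by rewrite ler_norml; apply/andP; split; nra.
split; under eq_fun do rewrite ReImE; apply: dom.
- by apply: measurable_funB; exact: measurable_funM.
- by move=> x; exact: sq.
- by apply: measurable_funD; exact: measurable_funM.
- move=> x; have := sq (Re (f x)) (Im (g x)) (- Im (f x)) (Re (g x)).
  by rewrite mulNr opprK sqrrN [Im (g x) ^+ 2 + _]addrC.
Qed.

Lemma sqintJ f : f \in @sqint R -> (fun x => (f x)^*) \in @sqint R.
Proof.
move=> /sqintP[f1 f2 fi]; apply/sqintP; split.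
- by under eq_fun do rewrite cReJ.
- by under eq_fun do rewrite cImJ; exact: measurableT_comp.
- by under eq_fun do rewrite cReJ cImJ sqrrN.
Qed.

Lemma sqint_bounded f (M : R) : measurable_fun I01 (fun x => Re (f x)) ->
  measurable_fun I01 (fun x => Im (f x)) ->
  (forall x, I01 x -> Re (f x) ^+ 2 + Im (f x) ^+ 2 <= M) -> f \in @sqint R.
Proof.
move=> m1 m2 h; apply/sqintP; split => //.
apply: le_integrable (integrable_cst_lty M measurable_I01 I01_lty) => //.
  by apply/measurable_EFinP; apply: measurable_funD; exact: measurable_funX.
move=> x Ix /=; rewrite lee_fin ger0_norm ?addr_ge0 ?sqr_ge0//.
by rewrite (le_trans (h _ Ix))// ler_norm.
Qed.

Lemma sqint_cst (a : R[i]) : (fun=> a) \in @sqint R.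
Proof. by apply: (@sqint_bounded _ (Re a ^+ 2 + Im a ^+ 2)). Qed.

Lemma sqint_cintegrable f : f \in @sqint R -> cintegrable f.
Proof.
move=> sf; have := sqint_mul (sqint_cst 1) sf.
by under eq_fun do rewrite mul1r.
Qed.

End complex_integral.
Arguments measurable_I01 {R}.
#[export] Hint Resolve measurable_I01 : core.

Section L2_elements.
Local Open Scope quotient_scope.
Variable R : realType.
Implicit Types (f g u v: L2 R) (h : measurableTypeR R -> R[i]).
Local Notation mu := (@lebesgue_measure R).

Lemma L2_sqint f : (f : _ -> _) \in @sqint R.
Proof. by rewrite /L2_fun; case: (repr f). Qed.

Lemma pi_L2E (u : L2fun R) : ae_eq01 (\pi_(L2 R) u : L2 R) u.
Proof.
have : u - repr (\pi_(L2 R) u) \in @ae_null R by rewrite Quotient.idealrBE reprK.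
move=> /asboolP; apply: ae_imp => x /[apply] h; apply/esym/eqP.
by rewrite -subr_eq0; apply/eqP.
Qed.

Lemma L2_of_exists : exists F : (measurableTypeR R -> R[i]) -> L2 R,
  forall h, h \in @sqint R -> ae_eq01 (F h) h.
Proof.
exists (fun h => \pi_(L2 R) (insubd (0 : L2fun R) h)) => h sh.
apply: ae_eq01_trans (pi_L2E _) _.
by have /= -> := insubdK (0 : L2fun R) sh; exact: ae_eq01_refl.
Qed.

(* Defined through [cid], so that unification never unfolds the quotient. *)
Definition L2_of : (measurableTypeR R -> R[i]) -> L2 R := projT1 (cid L2_of_exists).

Lemma L2_ofE h : h \in @sqint R -> ae_eq01 (L2_of h) h.
Proof. exact: (projT2 (cid L2_of_exists)). Qed.

Lemma L2_ext f g : ae_eq01 f g -> f = g.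
Proof.
move=> fg; rewrite -[f]reprK -[g]reprK; apply/eqP; rewrite -Quotient.idealrBE.
apply/asboolP; move: fg; apply: ae_imp => x /[apply] e.
by change (L2_fun f x - L2_fun g x = 0); apply/eqP; rewrite subr_eq0 e.
Qed.

Lemma L2_aeZD (a : R[i]) f g : ae_eq01 (a *: f + g : L2 R) (fun x => a * f x + g x).
Proof.
have -> : a *: f + g = \pi_(L2 R) (a *: repr f + repr g).
  by rewrite raddfD /= pi_L2_scale !reprK.
exact: pi_L2E.
Qed.

Lemma L2_ae0 : ae_eq01 (0 : L2 R) (fun=> 0).
Proof.
have -> : (0 : L2 R) = \pi_(L2 R) 0 by rewrite raddf0.
exact: pi_L2E.
Qed.

Lemma inner_cintegrable f g : cintegrable (fun x => (f x)^* * g x).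
Proof. by apply: sqint_mul; [apply: sqintJ|]; exact: L2_sqint. Qed.

Lemma innerZDr (a : R[i]) f u v : inner f (a *: u + v) = a * inner f u + inner f v.
Proof.
rewrite /inner -CintegralZ; last exact: inner_cintegrable.
rewrite -CintegralD; [|by apply: cintegrableZ; exact: inner_cintegrable|exact: inner_cintegrable].
apply: Cintegral_ae; first exact: inner_cintegrable.
  by apply: cintegrableD; [apply: cintegrableZ|]; exact: inner_cintegrable.
by have := L2_aeZD a u v; apply: ae_imp => x /[apply] ->; ring.
Qed.

Lemma innerJ f g : inner g f = (inner f g)^*.
Proof.
rewrite /inner -CintegralJ; last exact: inner_cintegrable.
by congr Cintegral01; apply/funext => x; apply: complex_eqP; rewrite !ReImE; ring.
Qed.

Lemma inner_self f : inner f f = (\int[mu]_(x in @I01 R) (Re (f x) ^+ 2 + Im (f x) ^+ 2))%:C.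
Proof.
apply: complex_eqP => /=.
  by apply: eq_Rintegral => x _; rewrite !ReImE; ring.
transitivity (\int[mu]_(x in @I01 R) (0 : R)).
  by apply: eq_Rintegral => x _; rewrite !ReImE /=; ring.
by rewrite (Rintegral_cst mu measurable_I01) mul0r.
Qed.

Lemma inner_ge0 f : 0 <= inner f f.
Proof.
rewrite inner_self lecR; apply: Rintegral_ge0 => x _.
by rewrite addr_ge0 ?sqr_ge0.
Qed.

Lemma inner_def f : inner f f = 0 -> f = 0.
Proof.
rewrite inner_self => /(congr1 (@complex.Re R)) /= h.
have /sqintP[m1 m2 fi] := L2_sqint f.
apply: L2_ext; apply: ae_eq01_trans (ae_eq01_sym L2_ae0).
have : (\int[mu]_(x in @I01 R) `|(Re (f x) ^+ 2 + Im (f x) ^+ 2)%:E| = 0)%E.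
  transitivity (\int[mu]_(x in @I01 R) (Re (f x) ^+ 2 + Im (f x) ^+ 2)%:E)%E.
    by apply: eq_integral => x _; rewrite gee0_abs// lee_fin addr_ge0 ?sqr_ge0.
  by rewrite integrable_fin// h.
move/ae_eq_integral_abs => /(_ measurable_I01 (measurable_int _ fi)).
apply: ae_imp => x /[apply] /= -[] /eqP.
rewrite paddr_eq0 ?sqr_ge0// !sqrf_eq0 => /andP[/eqP r0 /eqP i0].
exact: complex_eqP.
Qed.

End L2_elements.

(** * Hilbert spaces *)

Definition csq (R : rcfType) (z : R[i]) : R := Re z ^+ 2 + Im z ^+ 2.

Lemma csq_ge0 (R : rcfType) (z : R[i]) : 0 <= csq z.
Proof. by rewrite addr_ge0 ?sqr_ge0. Qed.

Lemma csq_eq0 (R : rcfType) (z : R[i]) : csq z = 0 -> z = 0.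
Proof.
move/eqP; rewrite paddr_eq0 ?sqr_ge0// !sqrf_eq0 => /andP[/eqP a /eqP b].
exact: complex_eqP.
Qed.

Lemma csqM (R : rcfType) (z w : R[i]) : csq (z * w) = csq z * csq w.
Proof. by rewrite /csq !ReImE; ring. Qed.

Lemma csqJ (R : rcfType) (z : R[i]) : csq z^* = csq z.
Proof. by rewrite /csq !ReImE; ring. Qed.

Lemma sqr_Re_le (R : rcfType) (z : R[i]) : Re z ^+ 2 <= csq z.
Proof. by rewrite lerDl sqr_ge0. Qed.

Definition subspace_of (R : rcfType) (X : lmodType R[i]) (D : set X) : Prop :=
  D 0 /\ forall (a : R[i]) f g, D f -> D g -> D (a *: f + g).

Section form.
Variables (R : rcfType) (X : lmodType R[i]) (D : set X) (b : X -> X -> R[i]).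
Hypothesis D_sub : subspace_of D.
Hypothesis bZD : forall a f g h, D f -> D g -> D h ->
  b f (a *: g + h) = a * b f g + b f h.
Hypothesis bJ : forall f g, D f -> D g -> b g f = (b f g)^*.
Hypothesis b_ge0 : forall f, D f -> 0 <= Re (b f f).

(** The form may be degenerate and lives on the subspace [D] only. Besides the inner product itself
    it is applied to <f, V g> and to the form with diagonal Im <x, B x> on the domain of a
    dissipative operator. *)
Lemma form_CauchySchwarz f g : D f -> D g ->
  csq (b f g) <= Re (b f f) * Re (b g g).
Proof.
move=> Df Dg.
have Imb h : D h -> Im (b h h) = 0.
  by move=> Dh; have /(congr1 (@complex.Im R)) := bJ Dh Dh; rewrite cImJ; lra.
have key (t : R) : 0 <= Re (b f f) + 2 * t * csq (b f g) + t ^+ 2 * csq (b f g) * Re (b g g).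
  (* The factor (b f g)^* turns the cross term into the real number 2 t |b f g|^2. *)
  pose a : R[i] := t%:C * (b f g)^*; pose h : X := a *: g + f.
  have Dh : D h by exact: D_sub.2.
  have -> : Re (b f f) + 2 * t * csq (b f g) + t ^+ 2 * csq (b f g) * Re (b g g) = Re (b h h).
    rewrite {2}/h bZD// (bJ Dg Dh) (bJ Df Dh) /h !bZD// (bJ Df Dg) !ReImE (Imb _ Dg).
    rewrite /csq /=.
    ring.
  exact: b_ge0.
have q0 := csq_ge0 (b f g); have F0 := b_ge0 Df.
have := b_ge0 Dg; rewrite le_eqVlt => /predU1P[/esym G0|G0].
  rewrite G0 mulr0 leNgt; apply/negP => q1.
  (* With [b g g] null the polynomial in t is affine; at this t its value would be -1. *)
  have := key (- (Re (b f f) + 1) / (2 * csq (b f g))).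
  rewrite G0 mulr0 addr0.
  have -> : 2 * (- (Re (b f f) + 1) / (2 * csq (b f g))) * csq (b f g) = - (Re (b f f) + 1).
    by field; rewrite gt_eqF.
  lra.
have := key (- (Re (b g g))^-1).
have -> : Re (b f f) + 2 * - (Re (b g g))^-1 * csq (b f g) + (- (Re (b g g))^-1) ^+ 2 * csq (b f g) * Re (b g g) =
   (Re (b f f) * Re (b g g) - csq (b f g)) / Re (b g g).
  by field; rewrite gt_eqF.
by rewrite pmulr_lge0 ?invr_gt0// subr_ge0.
Qed.

End form.

Record hilbert (R : rcfType) (H : lmodType R[i]) (ip : H -> H -> R[i]) : Prop := Hilbert {
  ipZDr : forall a f g h, ip f (a *: g + h) = a * ip f g + ip f h ;
  ipJ : forall f g, ip g f = (ip f g)^* ;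
  ip_ge0 : forall f, 0 <= ip f f ;
  ip_def : forall f, ip f f = 0 -> f = 0 ;
  ip_complete : forall u : nat -> H,
    (forall e, 0 < e -> exists N, forall m n, (N <= m)%N -> (N <= n)%N ->
       Re (ip (u m - u n) (u m - u n)) < e) ->
    exists l, forall e, 0 < e -> exists N, forall n, (N <= n)%N ->
       Re (ip (u n - l) (u n - l)) < e }.

Section hilbert_theory.
Variables (R : realType) (H : lmodType R[i]) (ip : H -> H -> R[i]).
Hypothesis hH : hilbert ip.
Implicit Types (f g h : H) (a : R[i]).

Definition sqn f : R := Re (ip f f).
Definition nrm f : R := Num.sqrt (sqn f).

Lemma ip0r f : ip f 0 = 0.
Proof. by have := ipZDr hH (-1) f 0 0; rewrite scaler0 addr0 mulN1r addNr. Qed.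
Lemma ipDr f g h : ip f (g + h) = ip f g + ip f h.
Proof. by rewrite -[g in LHS]scale1r (ipZDr hH) mul1r. Qed.
Lemma ipZr a f g : ip f (a *: g) = a * ip f g.
Proof. by rewrite -[a *: g]addr0 (ipZDr hH) ip0r addr0. Qed.
Lemma ipNr f g : ip f (- g) = - ip f g.
Proof. by rewrite -scaleN1r ipZr mulN1r. Qed.
Lemma ipBr f g h : ip f (g - h) = ip f g - ip f h.
Proof. by rewrite ipDr ipNr. Qed.
Lemma ip0l f : ip 0 f = 0.
Proof. by rewrite (ipJ hH) ip0r conjc0. Qed.
Lemma ipDl f g h : ip (f + g) h = ip f h + ip g h.
Proof. by rewrite (ipJ hH) ipDr rmorphD /= -!(ipJ hH). Qed.
Lemma ipZl a f g : ip (a *: f) g = a^*%C * ip f g.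
Proof. by rewrite (ipJ hH) ipZr rmorphM /= -!(ipJ hH). Qed.
Lemma ipNl f g : ip (- f) g = - ip f g.
Proof. by rewrite (ipJ hH) ipNr rmorphN /= -(ipJ hH). Qed.
Lemma ipBl f g h : ip (f - g) h = ip f h - ip g h.
Proof. by rewrite ipDl ipNl. Qed.
Definition ipE := (ipDr, ipDl, ipZr, ipZl, ipNr, ipNl, ip0r, ip0l).

Lemma ip_self f : ip f f = (sqn f)%:C.
Proof.
by have := ip_ge0 hH f; rewrite lecE => /andP[/eqP /= i0 _]; apply: complex_eqP.
Qed.

Lemma sqn_ge0 f : 0 <= sqn f.
Proof. by have := ip_ge0 hH f; rewrite ip_self lecR. Qed.

Lemma sqn_eq0 f : sqn f = 0 -> f = 0.
Proof. by move=> f0; apply: (ip_def hH); rewrite ip_self f0. Qed.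

Lemma sqn0 : sqn 0 = 0. Proof. by rewrite /sqn ip0r. Qed.

Lemma sqnD f g : sqn (f + g) = sqn f + sqn g + 2 * Re (ip f g).
Proof. by rewrite /sqn !ipE (ipJ hH f g) !ReImE; ring. Qed.

Lemma sqnZ a f : sqn (a *: f) = csq a * sqn f.
Proof. by rewrite /sqn !ipE ip_self !ReImE /csq /=; ring. Qed.

Lemma sqnN f : sqn (- f) = sqn f.
Proof. by rewrite /sqn !ipE opprK. Qed.

Lemma sqnB f g : sqn (f - g) = sqn f + sqn g - 2 * Re (ip f g).
Proof. by rewrite sqnD sqnN ipNr cReN; ring. Qed.

Lemma ip_CauchySchwarz f g : csq (ip f g) <= sqn f * sqn g.
Proof.
apply: (@form_CauchySchwarz R H setT) => //.
- by move=> a f' g' h' _ _ _; exact: ipZDr.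
- by move=> f' g' _ _; exact: ipJ.
- by move=> f' _; exact: sqn_ge0.
Qed.

Lemma nrm_ge0 f : 0 <= nrm f. Proof. exact: sqrtr_ge0. Qed.
Lemma sqr_nrm f : nrm f ^+ 2 = sqn f. Proof. by rewrite sqr_sqrtr// sqn_ge0. Qed.

Lemma Re_ip_le f g : Re (ip f g) <= nrm f * nrm g.
Proof.
apply: le_trans (ler_norm _) _.
rewrite -ler_sqr ?nnegrE ?mulr_ge0 ?nrm_ge0//.
rewrite real_normK ?num_real// exprMn !sqr_nrm.
exact: le_trans (sqr_Re_le _) (ip_CauchySchwarz f g).
Qed.

Lemma abs_Im_ip_le f g : `|Im (ip f g)| <= nrm f * nrm g.
Proof.
rewrite -ler_sqr ?nnegrE ?mulr_ge0 ?nrm_ge0//.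
rewrite real_normK ?num_real// exprMn !sqr_nrm.
by apply: le_trans (ip_CauchySchwarz f g); rewrite lerDr sqr_ge0.
Qed.

Lemma nrmD f g : nrm (f + g) <= nrm f + nrm g.
Proof.
rewrite -ler_sqr ?nnegrE ?addr_ge0 ?nrm_ge0// sqr_nrm sqnD sqrrD !sqr_nrm.
have := Re_ip_le f g; rewrite -mulr_natl; lra.
Qed.

Lemma nrmN f : nrm (- f) = nrm f. Proof. by rewrite /nrm sqnN. Qed.

Lemma nrmBC f g : nrm (f - g) = nrm (g - f). Proof. by rewrite -nrmN opprB. Qed.

Lemma nrmZ a f : nrm (a *: f) = Num.sqrt (csq a) * nrm f.
Proof. by rewrite /nrm sqnZ sqrtrM ?csq_ge0. Qed.

Lemma nrmZr (c : R) f : 0 <= c -> nrm (c%:C *: f) = c * nrm f.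
Proof.
move=> c0; rewrite /nrm sqnZ /csq /= expr0n addr0 sqrtrM ?sqr_ge0//.
by rewrite sqrtr_sqr ger0_norm.
Qed.

Lemma nrm0 : nrm 0 = 0. Proof. by rewrite /nrm sqn0 sqrtr0. Qed.

Lemma nrm_eq0 f : nrm f <= 0 -> f = 0.
Proof.
move=> f0; apply: sqn_eq0; rewrite -sqr_nrm.
by have -> : nrm f = 0; [apply/eqP; rewrite eq_le f0 nrm_ge0|rewrite expr0n].
Qed.

Lemma nrm_lt f e : 0 < e -> (nrm f < e) = (sqn f < e ^+ 2).
Proof. by move=> e0; rewrite -sqr_nrm ltr_pXn2r ?nnegrE ?nrm_ge0// ltW. Qed.

End hilbert_theory.

Lemma invn_small (R : realType) (e : R) : 0 < e ->
  exists N, forall n, (N <= n)%N -> (n.+1%:R)^-1 < e.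
Proof.
move=> e0; exists (Num.trunc e^-1) => n Nn.
rewrite -(invrK e) ltf_pV2 ?posrE ?invr_gt0//.
apply: lt_le_trans (truncnS_gt _) _.
by rewrite ler_nat ltnS.
Qed.

(** * Riesz representation through an operator *)

Section riesz.
Variables (R : realType) (H : lmodType R[i]) (ip : H -> H -> R[i]).
Hypothesis hH : hilbert ip.
Local Notation sqn := (sqn ip).
Local Notation nrm := (nrm ip).

(** Riesz representation on the closure of J(D), without forming that closure: [k] is the limit of
    J(u_n) for a sequence minimizing the functional [phi]. The functional [l] is antilinear because
    g |-> <J g, k> is. With [J] the identity this yields density and adjoint statements, with [J] =
    V^(1/2) the factorization of vectors through V^(1/2); that [k] lies in the closure of J(D)
    matters in both uses. *)
Lemma riesz_factor (X : lmodType R[i]) (D : set X) (J : X -> H) (l : X -> R[i]) (C : R) :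
  subspace_of D ->
  (forall a f g, D f -> D g -> J (a *: f + g) = a *: J f + J g) ->
  (forall a f g, D f -> D g -> l (a *: f + g) = a^*%C * l f + l g) ->
  0 <= C -> (forall f, D f -> csq (l f) <= C * sqn (J f)) ->
  exists k, (forall g, D g -> l g = ip (J g) k) /\
    forall e, 0 < e -> exists2 g, D g & nrm (J g - k) < e.
Proof.
move=> [D0 Dlin] Jlin llin C0 lC.
have J0 : J 0 = 0.
  by have := Jlin (-1) 0 0 D0 D0; rewrite scaler0 addr0 scaleN1r addNr.
have l0 : l 0 = 0.
  have := llin (-1) 0 0 D0 D0; rewrite scaler0 addr0 => h.
  by rewrite {1}h rmorphN1 mulN1r addNr.
have DZ a f : D f -> D (a *: f) by move=> Df; rewrite -[_ *: _]addr0; exact: Dlin.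
have JZ a f : D f -> J (a *: f) = a *: J f.
  by move=> Df; rewrite -[in LHS](addr0 (a *: f)) Jlin// J0 addr0.
have lZ a f : D f -> l (a *: f) = a^*%C * l f.
  by move=> Df; rewrite -[in LHS](addr0 (a *: f)) llin// l0 addr0.
have DD f g : D f -> D g -> D (f + g).
  by move=> Df Dg; rewrite -[f]scale1r; exact: Dlin.
have JD f g : D f -> D g -> J (f + g) = J f + J g.
  by move=> Df Dg; rewrite -[in LHS](scale1r f) Jlin// scale1r.
have lD f g : D f -> D g -> l (f + g) = l f + l g.
  by move=> Df Dg; rewrite -[in LHS](scale1r f) llin// rmorph1 mul1r.
(* If l g = <J g, k>, this is ||J g - k||^2 - ||k||^2, so minimizing it approximates [k]. *)
pose phi g := sqn (J g) - 2 * Re (l g).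
have phi_ge f : D f -> - C <= phi f.
  move=> Df; have s0 := sqn_ge0 hH (J f).
  have h : Re (l f) ^+ 2 <= C * sqn (J f) by apply: le_trans (sqr_Re_le _) (lC _ Df).
  have : 2 * Re (l f) <= C + sqn (J f).
    apply: le_trans (ler_norm _) _.
    rewrite -ler_sqr ?nnegrE ?addr_ge0// real_normK ?num_real//.
    have := sqr_ge0 (C - sqn (J f)); nra.
  by rewrite /phi; lra.
pose S := [set phi g | g in D].
have Sinf : has_inf S.
  split; first by exists (phi 0), 0.
  by exists (- C) => _ [g Dg <-]; exact: phi_ge.
pose m := inf S.
have phi_m f : D f -> m <= phi f.
  by move=> Df; apply: ge_inf; [exact: Sinf.2|exists f].
have /choice[u hu] : forall n, exists g, D g /\ phi g < m + (n.+1%:R)^-1.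
  move=> n; have n0 : 0 < (n.+1%:R)^-1 :> R by rewrite invr_gt0 ltr0n.
  by have [_ [g Dg <-] h] := inf_adherent n0 Sinf; exists g.
have Du n := (hu n).1; have pu n := (hu n).2.
(* The parallelogram law, with the lower bound [m] used at the midpoint of [f] and [g]; it makes
   J(u_n) a Cauchy sequence. *)
have par f g : D f -> D g -> sqn (J f - J g) <= 2 * (phi f - m) + 2 * (phi g - m).
  move=> Df Dg; have := phi_m _ (DZ (2^-1)%:C _ (DD _ _ Df Dg)).
  rewrite /phi JZ ?lZ ?JD ?lD//; try exact: DD.
  rewrite (sqnZ hH) (sqnD hH) (sqnB hH) /csq !ReImE /= => h.
  have e4 : (2^-1 : R) ^+ 2 = 1 / 4 by field.
  by rewrite oppr0 mul0r subr0 expr0n addr0 e4 in h; lra.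
have [k hk] : exists k, forall e, 0 < e -> exists N, forall n, (N <= n)%N -> sqn (J (u n) - k) < e.
  apply: (ip_complete hH) => e e0.
  have e40 : 0 < e / 4 by rewrite divr_gt0.
  have [N hN] := invn_small e40; exists N => p q Np Nq.
  apply: le_lt_trans (par _ _ (Du p) (Du q)) _.
  move: (pu p) (pu q) (hN _ Np) (hN _ Nq).
  by move: (p.+1%:R^-1) (q.+1%:R^-1) => x y; lra.
exists k; split; last first.
  move=> e e0; have e20 : 0 < e ^+ 2 by rewrite exprn_gt0.
  have [N hN] := hk _ e20; exists (u N) => //.
  by rewrite (nrm_lt hH)//; exact: hN.
move=> g Dg; set b := ip (J g) k - l g.
suff : csq b = 0 by move/csq_eq0/eqP; rewrite subr_eq0 => /eqP.
(* The first variation: the right-hand side is the limit of phi(u_n - t b g) - phi(u_n), which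
   cannot be negative for a minimizing sequence. *)
have key t : 0 <= t ^+ 2 * csq b * sqn (J g) - 2 * t * csq b.
  rewrite leNgt; apply/negP => P0.
  set P := (X in X < 0) in P0.
  pose a : R[i] := - t%:C * b.
  pose A := nrm (a *: J g) + 1.
  have A0 : 0 < A by rewrite ltr_wpDl ?nrm_ge0.
  have eps : 0 < - P / 2 by lra.
  have [N1 h1] := invn_small eps.
  have eps2 : 0 < (- P / (4 * A)) ^+ 2.
    by rewrite exprn_gt0// divr_gt0 ?mulr_gt0//; lra.
  have [N2 h2] := hk _ eps2.
  pose n := maxn N1 N2.
  have {}h1 := h1 n (leq_maxl _ _); have {}h2 := h2 n (leq_maxr _ _).
  have := phi_m _ (DD _ _ (DZ a _ Dg) (Du n)); have := pu n.
  rewrite /phi JD ?lD ?JZ ?lZ//; try exact: DZ.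
  rewrite (sqnD hH) => lt1 le1.
  have E : ip (a *: J g) (J (u n)) - a^*%C * l g = a^*%C * b + ip (a *: J g) (J (u n) - k).
    by rewrite (ipBr hH) !(ipZl hH) /b; ring.
  have /(congr1 (@complex.Re R)) := E; rewrite !cReD cReN => {}E.
  have ab : Re (a^*%C * b) = - t * csq b.
    by rewrite /a; clear; generalize b => z; rewrite !ReImE /csq /=; ring.
  have sa : sqn (a *: J g) = t ^+ 2 * csq b * sqn (J g).
    by rewrite (sqnZ hH) /a; generalize b => z; rewrite csqM /csq /=; ring.
  have small : Re (ip (a *: J g) (J (u n) - k)) <= - P / 4.
    apply: le_trans (Re_ip_le hH _ _) _.
    have : nrm (J (u n) - k) <= - P / (4 * A).
      have d0 : 0 < - P / (4 * A) by rewrite divr_gt0 ?mulr_gt0//; lra.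
      by apply/ltW; rewrite (nrm_lt hH).
    move=> h; apply: (@le_trans _ _ (A * (- P / (4 * A)))).
      by apply: ler_pM; rewrite ?nrm_ge0// /A lerDl.
    by rewrite le_eqVlt; apply/orP; left; apply/eqP; field; rewrite gt_eqF.
  rewrite sa cReD in le1; rewrite ab in E.
  have PE : P = t ^+ 2 * csq b * sqn (J g) - 2 * t * csq b by [].
  by move: lt1 h1; move: (n.+1%:R^-1) => x; lra.
have s0 := sqn_ge0 hH (J g).
(* The polynomial is t |b|^2 (t s - 2) with s = ||J g||^2. This t satisfies 0 < t and t s < 1 even
   when s = 0, so |b|^2 has to vanish. *)
have := key ((1 + sqn (J g))^-1).
have := csq_ge0 b; set q := csq b; set s := sqn (J g) in s0 *.
have -> : (1 + s)^-1 ^+ 2 * q * s - 2 * (1 + s)^-1 * q = - (q * ((s + 2) / (1 + s) ^+ 2)).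
  by field; apply/eqP; lra.
move=> q0; rewrite oppr_ge0 => h; apply/eqP; rewrite eq_le q0 andbT.
move: h; rewrite pmulr_lle0// divr_gt0 ?exprn_gt0//; lra.
Qed.

End riesz.

Section sqrt.
Variables (R : realType) (H : lmodType R[i]) (ip : H -> H -> R[i]).
Hypothesis hH : hilbert ip.
Local Notation sqn := (sqn ip).
Local Notation nrm := (nrm ip).

Definition linear_map (V : H -> H) := forall (a : R[i]) f g, V (a *: f + g) = a *: V f + V g.

Lemma linear_map0 V : linear_map V -> V 0 = 0.
Proof. by move=> Vl; have := Vl (-1) 0 0; rewrite scaler0 addr0 scaleN1r addNr. Qed.

Lemma linear_mapD V f g : linear_map V -> V (f + g) = V f + V g.
Proof. by move=> Vl; rewrite -[in LHS](scale1r f) Vl scale1r. Qed.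

Lemma linear_mapZ V a f : linear_map V -> V (a *: f) = a *: V f.
Proof. by move=> Vl; rewrite -[in LHS](addr0 (a *: f)) Vl linear_map0// addr0. Qed.

Lemma linear_mapB V f g : linear_map V -> V (f - g) = V f - V g.
Proof. by move=> Vl; rewrite linear_mapD// -scaleN1r linear_mapZ// scaleN1r. Qed.

(** Polarization: <h, V h> is real at h = f + g and at h = f + i g, which gives the imaginary and
    the real part of the claim. *)
Lemma nonneg_symmetric V f g : linear_map V -> (forall f, 0 <= ip f (V f)) ->
  ip f (V g) = ip (V f) g.
Proof.
move=> Vl V0.
have Im0 h : Im (ip h (V h)) = 0 by have := V0 h; rewrite lecE => /andP[/eqP /= ->].
have h1 := Im0 (f + g); have h2 := Im0 (f + 'i%C *: g).
have h3 := Im0 f; have h4 := Im0 g.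
rewrite !(linear_mapD _ _ Vl) !(ipE hH) !ReImE in h1.
rewrite !(linear_mapD _ _ Vl) (linear_mapZ _ _ Vl) !(ipE hH) !ReImE /= in h2.
rewrite (ipJ hH g (V f)); apply: complex_eqP; rewrite !ReImE; lra.
Qed.

(** Cauchy-Schwarz for the form <f, V g> at the pair (V f, f) bounds ||V f||^4 by <V f, V V f> <f, V
    f>, and the first factor is at most M ||V f||^2. *)
Lemma nonneg_sqn_le V M f : linear_map V -> (forall f, 0 <= ip f (V f)) ->
  0 <= M -> (forall f, nrm (V f) <= M * nrm f) ->
  sqn (V f) <= M * Re (ip f (V f)).
Proof.
move=> Vl V0 M0 VM.
have V0R h : 0 <= Re (ip h (V h)) by have := V0 h; rewrite lecE => /andP[].
have := @form_CauchySchwarz R H setT (fun f g => ip f (V g)) _ _ _ _ (V f) f.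
have -> : csq (ip (V f) (V f)) = sqn (V f) ^+ 2 by rewrite (ip_self hH) /csq /=; ring.
move=> /(_ (conj I (fun _ _ _ _ _ => I))) h.
have {}h : sqn (V f) ^+ 2 <= Re (ip (V f) (V (V f))) * Re (ip f (V f)).
  apply: h => //.
  - by move=> a u v w _ _ _; rewrite Vl (ipZDr hH).
  - by move=> u v _ _; rewrite (nonneg_symmetric _ _ Vl V0) (ipJ hH).
have : Re (ip (V f) (V (V f))) <= M * sqn (V f).
  apply: le_trans (Re_ip_le hH _ _) _; rewrite -(sqr_nrm hH) expr2 mulrCA.
  by rewrite ler_wpM2l ?nrm_ge0.
have := sqn_ge0 hH (V f); rewrite le_eqVlt => /predU1P[<- _|s0 h2].
  by rewrite mulr_ge0.
rewrite -(ler_pM2l s0) -expr2 (le_trans h)//.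
by rewrite mulrA ler_wpM2r// mulrC.
Qed.

Definition cvgH (u : nat -> H) l := forall e, 0 < e -> exists N, forall n, (N <= n)%N -> nrm (u n - l) < e.

Lemma cvgH_le u l M : cvgH u l -> (forall n, nrm (u n) <= M) -> nrm l <= M.
Proof.
move=> ul uM; rewrite leNgt; apply/negP => Ml.
have e0 : 0 < nrm l - M by rewrite subr_gt0.
have [N /(_ _ (leqnn N)) hN] := ul _ e0.
have := nrmD hH (l - u N) (u N); rewrite subrK (nrmBC hH) => h.
have := uM N; lra.
Qed.

Lemma cvgH_unique u l l' : cvgH u l -> cvgH u l' -> l = l'.
Proof.
move=> ul ul'; apply/eqP; rewrite -subr_eq0; apply/eqP; apply: (nrm_eq0 hH).
rewrite leNgt; apply/negP => e0.
have e20 : 0 < nrm (l - l') / 2 by rewrite divr_gt0.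
have [N hN] := ul _ e20; have [N' hN'] := ul' _ e20.
have := hN _ (leq_maxl N N'); have := hN' _ (leq_maxr N N').
set n := maxn N N'; have := nrmD hH (l - u n) (u n - l').
rewrite addrA subrK (nrmBC hH l (u n)); lra.
Qed.

Lemma cvgHZD u v l k a : cvgH u l -> cvgH v k -> cvgH (fun n => a *: u n + v n) (a *: l + k).
Proof.
move=> ul vk e e0; pose A := Num.sqrt (csq a) + 1.
have A0 : 0 < A by rewrite ltr_wpDl ?sqrtr_ge0.
have e20 : 0 < e / (2 * A) by rewrite divr_gt0 ?mulr_gt0.
have e20' : 0 < e / 2 by rewrite divr_gt0.
have [N hN] := ul _ e20; have [N' hN'] := vk _ e20'.
exists (maxn N N') => n; rewrite geq_max => /andP[/hN h1 /hN' h2].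
have -> : a *: u n + v n - (a *: l + k) = a *: (u n - l) + (v n - k).
  by rewrite scalerBr opprD addrACA.
apply: le_lt_trans (nrmD hH _ _) _.
have : nrm (a *: (u n - l)) <= A * (e / (2 * A)).
  rewrite (nrmZ hH).
  by apply: ler_pM; rewrite ?nrm_ge0 ?sqrtr_ge0 ?ltW// /A ltrDl.
have -> : A * (e / (2 * A)) = e / 2 by field; rewrite gt_eqF.
lra.
Qed.

End sqrt.

(** * Square roots of nonnegative operators *)

Section sqrt_bound.
Variable R : realType.

(** The scalar case X = 1 of the operator iteration [sqrt_iter]. It majorizes the norms of the
    iterates and of their increments, so that its convergence forces theirs. *)
Fixpoint sqrt_bound (n : nat) : R := if n is m.+1 then (1 + sqrt_bound m ^+ 2) / 2 else 0.

Lemma sqrt_bound_ge0 n : 0 <= sqrt_bound n.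
Proof. by case: n => //= n; rewrite divr_ge0// addr_ge0// sqr_ge0. Qed.

Lemma sqrt_bound_le1 n : sqrt_bound n <= 1.
Proof.
elim: n => //= n ih; have := sqrt_bound_ge0 n => h.
by rewrite ler_pdivrMr// mul1r -lerBrDl (_ : 2 - 1 = 1) ?expr_le1//; ring.
Qed.

Lemma sqrt_bound_nondecreasing : nondecreasing_seq sqrt_bound.
Proof.
apply/nondecreasing_seqP => n /=.
by rewrite ler_pdivlMr//; have := sqr_ge0 (1 - sqrt_bound n); nra.
Qed.

Lemma sqrt_bound_cauchy (e : R) : 0 < e -> exists N, forall m n, (N <= m)%N -> (m <= n)%N ->
  sqrt_bound n - sqrt_bound m < e.
Proof.
move=> e0; pose S := range sqrt_bound.
have Ssup : has_sup S.
  split; first by exists (sqrt_bound 0), 0%N.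
  by exists 1 => _ [n _ <-]; exact: sqrt_bound_le1.
have [_ [N _ <-] h] := sup_adherent e0 Ssup.
exists N => m n Nm mn.
have : sqrt_bound n <= sup S by apply: ub_le_sup; [exact: Ssup.2|exists n].
by have := sqrt_bound_nondecreasing Nm; lra.
Qed.

End sqrt_bound.

Section sqrt.
Variables (R : realType) (H : lmodType R[i]) (ip : H -> H -> R[i]).
Hypothesis hH : hilbert ip.
Local Notation sqn := (sqn ip).
Local Notation nrm := (nrm ip).
Local Notation cvgH := (cvgH ip).

Lemma nrmZ_half f : nrm ((2^-1)%:C *: f) = nrm f / 2.
Proof. by rewrite (nrmZr hH) 1?mulrC// invr_ge0. Qed.

Section contraction.
Variable X : H -> H.
Hypothesis X_lin : linear_map X.
Hypothesis X_le1 : forall f, nrm (X f) <= nrm f.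
Hypothesis X_sym : forall f g, ip f (X g) = ip (X f) g.

(** A fixed point Z = (X + Z^2) / 2 satisfies (1 - Z)^2 = 1 - X, so the iteration computes 1 minus
    the square root of 1 - X. *)
Fixpoint sqrt_iter (n : nat) (f : H) : H :=
  if n is m.+1 then (2^-1)%:C *: (X f + sqrt_iter m (sqrt_iter m f)) else 0.
Local Notation Y := sqrt_iter.

Lemma sqrt_iterS n f : Y n.+1 f = (2^-1)%:C *: (X f + Y n (Y n f)).
Proof. by []. Qed.

Lemma sqrt_iter_lin n : linear_map (Y n).
Proof.
elim: n => [|n ih] a f g /=; first by rewrite scaler0 addr0.
rewrite X_lin !ih [in RHS]scalerA mulrC -scalerA -scalerDr; congr (_ *: _).
by rewrite scalerDr addrACA.
Qed.

Lemma sqrt_iter_sym n f g : ip f (Y n g) = ip (Y n f) g.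
Proof.
elim: n f g => [|n ih] f g /=; first by rewrite (ip0r hH) (ip0l hH).
rewrite (ipZr hH) (ipZl hH) (ipDr hH) (ipDl hH) X_sym !ih; congr (_ * _).
by rewrite /= oppr0.
Qed.

Lemma sqrt_iter_bound n f : nrm (Y n f) <= sqrt_bound R n * nrm f.
Proof.
elim: n f => [|n ih] f /=; first by rewrite (nrm0 hH) mul0r.
rewrite nrmZ_half mulrAC ler_pM2r// mulrDl mul1r.
apply: le_trans (nrmD hH _ _) _; apply: lerD => //.
apply: le_trans (ih _) _; rewrite expr2 -mulrA ler_wpM2l ?sqrt_bound_ge0//.
Qed.

Lemma sqrt_iter_step n f :
  nrm (Y n.+1 f - Y n f) <= (sqrt_bound R n.+1 - sqrt_bound R n) * nrm f.
Proof.
elim: n f => [|n ih] f.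
  rewrite /= subr0 addr0 nrmZ_half expr0n addr0 subr0.
  by have := X_le1 f; lra.
(* The noncommutative form of y'^2 - y^2 = y' (y' - y) + (y' - y) y, with y = Y_n and y' = Y_(n+1);
   the scalars are split the same way below. *)
have -> : Y n.+2 f - Y n.+1 f =
    (2^-1)%:C *: (Y n.+1 (Y n.+1 f - Y n f) + (Y n.+1 (Y n f) - Y n (Y n f))).
  rewrite (linear_mapB _ _ (sqrt_iter_lin n.+1)) addrA subrK (sqrt_iterS n.+1).
  by rewrite [X in _ - X = _]sqrt_iterS -scalerBr opprD addrACA subrr add0r.
rewrite nrmZ_half.
have h1 := le_trans (sqrt_iter_bound n.+1 (Y n.+1 f - Y n f)) (ler_wpM2l (sqrt_bound_ge0 _ _) (ih f)).
have d0 : 0 <= sqrt_bound R n.+1 - sqrt_bound R n by rewrite subr_ge0 sqrt_bound_nondecreasing.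
have h2 := le_trans (ih (Y n f)) (ler_wpM2l d0 (sqrt_iter_bound n f)).
have h3 := nrmD hH (Y n.+1 (Y n.+1 f - Y n f)) (Y n.+1 (Y n f) - Y n (Y n f)).
have e2 : sqrt_bound R n.+2 = (1 + sqrt_bound R n.+1 ^+ 2) / 2 by [].
have e1 : sqrt_bound R n.+1 = (1 + sqrt_bound R n ^+ 2) / 2 by [].
have -> : (sqrt_bound R n.+2 - sqrt_bound R n.+1) * nrm f =
  (sqrt_bound R n.+1 * ((sqrt_bound R n.+1 - sqrt_bound R n) * nrm f) +
   (sqrt_bound R n.+1 - sqrt_bound R n) * (sqrt_bound R n * nrm f)) / 2.
  by rewrite e2 {2}e1; field.
by rewrite ler_pM2r//; lra.
Qed.

Lemma sqrt_iter_dist m n f : (m <= n)%N ->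
  nrm (Y n f - Y m f) <= (sqrt_bound R n - sqrt_bound R m) * nrm f.
Proof.
elim: n => [|n ih]; first by rewrite leqn0 => /eqP ->; rewrite !subrr (nrm0 hH) mul0r.
rewrite leq_eqVlt => /predU1P[->|]; first by rewrite !subrr (nrm0 hH) mul0r.
rewrite ltnS => /ih {}ih.
have := nrmD hH (Y n.+1 f - Y n f) (Y n f - Y m f); rewrite addrA subrK.
have := sqrt_iter_step n f; move: ih; lra.
Qed.

Lemma sqrt_iter_cvg f : exists l, cvgH (Y ^~ f) l.
Proof.
have [|l hl] := @ip_complete _ _ _ hH (Y ^~ f); last first.
  exists l => e e0; have e20 : 0 < e ^+ 2 by rewrite exprn_gt0.
  have [N hN] := hl _ e20; exists N => n /hN.
  by rewrite (nrm_lt hH).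
move=> e e0.
have A0 : 0 < nrm f + 1 by rewrite ltr_wpDl ?nrm_ge0.
have d0 : 0 < Num.sqrt e / (nrm f + 1) by rewrite divr_gt0 ?sqrtr_gt0.
have [N hN] := @sqrt_bound_cauchy R _ d0.
have key m n : (N <= m)%N -> (m <= n)%N -> sqn (Y n f - Y m f) < e.
  move=> Nm mn; rewrite -(@sqr_sqrtr _ e) ?ltW// -(nrm_lt hH) ?sqrtr_gt0//.
  apply: le_lt_trans (sqrt_iter_dist f mn) _.
  have := hN _ _ Nm mn; rewrite ltr_pdivlMr// => h.
  apply: le_lt_trans h; rewrite ler_wpM2l ?lerDl//.
  by rewrite subr_ge0 sqrt_bound_nondecreasing.
exists N => m n Nm Nn; have [mn|/ltnW nm] := leqP m n; last exact: key.
by rewrite -/(sqn _) -(sqnN hH) opprB; exact: key.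
Qed.

(** The norm bound on [Z] and the reality of <f, Z f> are what will make 1 - Z nonnegative. *)
Lemma contraction_half_fixpoint : exists Z : H -> H,
  [/\ linear_map Z, forall f, nrm (Z f) <= nrm f, forall f, Im (ip f (Z f)) = 0 &
  forall f, Z f = (2^-1)%:C *: (X f + Z (Z f))].
Proof.
have [Z hZ] := choice sqrt_iter_cvg.
have Zlin : linear_map Z.
  move=> a f g; apply: (cvgH_unique hH (hZ _)).
  have := cvgHZD hH a (hZ f) (hZ g); congr cvgH; apply/funext => n.
  by rewrite sqrt_iter_lin.
have Yle n f : nrm (Y n f) <= nrm f.
  apply: le_trans (sqrt_iter_bound _ _) _.
  by rewrite ler_piMl ?nrm_ge0// sqrt_bound_le1.
have Zle f : nrm (Z f) <= nrm f by apply: (cvgH_le hH (hZ f)) => n.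
have fix_ f : Z f = (2^-1)%:C *: (X f + Z (Z f)).
  (* Both the operator and its argument vary with n; the uniform bound ||Y_n|| <= 1 takes care of
     the argument. *)
  have ZZ : cvgH (fun n => Y n (Y n f)) (Z (Z f)).
    move=> e e0; have e20 : 0 < e / 2 by rewrite divr_gt0.
    have [N hN] := hZ f _ e20; have [N' hN'] := hZ (Z f) _ e20.
    exists (maxn N N') => n; rewrite geq_max => /andP[/hN h1 /hN' h2].
    have := nrmD hH (Y n (Y n f - Z f)) (Y n (Z f) - Z (Z f)).
    rewrite (linear_mapB _ _ (sqrt_iter_lin n)) addrA subrK -(linear_mapB _ _ (sqrt_iter_lin n)).
    by have := Yle n (Y n f - Z f); lra.
  have cc g : cvgH (fun=> g) g by move=> e e0; exists 0%N => n _; rewrite subrr (nrm0 hH).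
  have := cvgHZD hH (2^-1)%:C (cvgHZD hH 1 (cc (X f)) ZZ) (cc 0).
  rewrite addr0 scale1r => h2.
  apply: (cvgH_unique hH _ h2) => e /(hZ f)[N hN]; exists N => n Nn.
  by rewrite addr0 -sqrt_iterS; apply/hN/leqW.
exists Z; split => // f.
apply/eqP; rewrite -normr_le0 leNgt; apply/negP => I0.
have A0 : 0 < nrm f + 1 by rewrite ltr_wpDl ?nrm_ge0.
have [N /(_ N (leqnn N)) hN] := hZ f _ (divr_gt0 I0 A0).
have ImY : Im (ip f (Y N f)) = 0.
  have /(congr1 (@complex.Im R)) := ipJ hH f (Y N f).
  by rewrite -sqrt_iter_sym cImJ; lra.
have := abs_Im_ip_le hH f (Y N f - Z f).
rewrite (ipBr hH) cImD cImN ImY add0r normrN.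
move: hN; rewrite ltr_pdivlMr// => hN; have := nrm_ge0 ip f; have := nrm_ge0 ip (Y N f - Z f); nra.
Qed.

End contraction.

Lemma hilbert_sqrt (V : H -> H) (M : R) : linear_map V ->
  (forall f, nrm (V f) <= M * nrm f) -> (forall f, 0 <= ip f (V f)) ->
  exists T : H -> H, [/\ linear_map T, exists N, forall f, nrm (T f) <= N * nrm f,
    forall f, 0 <= ip f (T f) & T \o T = V].
Proof.
move=> Vlin VM V0; pose K := `|M| + 1.
have K0 : 0 < K by rewrite ltr_wpDl.
have VK f : nrm (V f) <= K * nrm f.
  apply: le_trans (VM f) _; rewrite ler_wpM2r ?nrm_ge0// /K.
  by rewrite (le_trans (ler_norm M))// lerDl.
have V0R h : 0 <= Re (ip h (V h)) by have := V0 h; rewrite lecE => /andP[].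
(* X = 1 - V / K, so (1 - Z)^2 = V / K and the square of T = sqrt(K) (1 - Z) is V. *)
pose X f := f - K^-1%:C *: V f.
have Xlin : linear_map X.
  move=> a f g; rewrite /X Vlin !scalerDr scalerN !scalerA mulrC opprD addrACA.
  by [].
have Xle f : nrm (X f) <= nrm f.
  rewrite -ler_sqr ?nnegrE ?nrm_ge0// !(sqr_nrm hH) (sqnB hH) (sqnZ hH) (ipZr hH) !ReImE /csq /=.
  have h := nonneg_sqn_le hH f Vlin V0 (ltW K0) VK.
  have h2 := V0R f.
  (* The quadratic term of ||f - V f / K||^2 is at most half of the linear term that is subtracted,
     so [X] is a contraction. *)
  have : K^-1 ^+ 2 * sqn (V f) <= K^-1 * Re (ip f (V f)).
    by rewrite expr2 -mulrA ler_pM2l ?invr_gt0// ler_pdivrMl.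
  have : 0 <= K^-1 * Re (ip f (V f)) by rewrite mulr_ge0// invr_ge0 ltW.
  rewrite expr0n addr0 mul0r subr0; lra.
have Xsym f g : ip f (X g) = ip (X f) g.
  rewrite /X !(ipBr hH) (ipBl hH) (ipZr hH) (ipZl hH) conjc_real.
  by rewrite (nonneg_symmetric hH _ _ Vlin V0).
have [Z [Zlin Zle ZIm Zfix]] := contraction_half_fixpoint Xlin Xle Xsym.
have sK0 : 0 <= Num.sqrt K by exact: sqrtr_ge0.
pose T f := (Num.sqrt K)%:C *: (f - Z f).
exists T; split.
- move=> a f g; rewrite /T Zlin [in RHS]scalerA mulrC -scalerA -scalerDr; congr (_ *: _).
  by rewrite scalerBr opprD addrACA.
- exists (Num.sqrt K * 2) => f; rewrite /T (nrmZr hH)// -mulrA ler_wpM2l//.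
  have := nrmD hH f (- Z f); rewrite (nrmN hH); have := Zle f; lra.
- move=> f; rewrite /T (ipZr hH) (ipBr hH) (ip_self hH) lecE !ReImE /= ZIm.
  apply/andP; split; first by apply/eqP; ring.
  rewrite mul0r subr0 mulr_ge0// subr_ge0.
  apply: le_trans (Re_ip_le hH _ _) _.
  by rewrite -(sqr_nrm hH) expr2 ler_wpM2l ?nrm_ge0.
- apply/funext => f /=; rewrite /T (linear_mapZ _ _ Zlin) (linear_mapB _ _ Zlin).
  rewrite -scalerBr scalerA -rmorphM /= -expr2 sqr_sqrtr ?ltW//.
  have ZZ : Z (Z f) = 2%:C *: Z f - X f.
    by rewrite [in RHS]Zfix scalerA -rmorphM /= divff// scale1r addrC addKr.
  rewrite ZZ /X.
  have -> : f - Z f - (Z f - (2%:C *: Z f - (f - (K^-1)%:C *: V f))) = (K^-1)%:C *: V f.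
    have -> : 2%:C = 1 + 1 :> R[i] by rewrite -[2]/(1 + 1) rmorphD rmorph1.
    by rewrite scalerDl scale1r opprB [X in _ + X = _]addrAC addrK addrA subrK subKr.
  by rewrite scalerA -rmorphM /= divff ?gt_eqF// scale1r.
Qed.

End sqrt.

(** * Completeness of L2(0,1) *)

Section real_L2_complete.
Variable R : realType.
Local Notation mu := (@lebesgue_measure R).
Local Notation I01 := (@I01 R).
Implicit Types f g : measurableTypeR R -> R.

Definition sqintr f := measurable_fun I01 f /\ mu.-integrable I01 (EFin \o (fun x => f x ^+ 2)).

Lemma sqintr_sub f g : sqintr f -> sqintr g -> sqintr (fun x => f x - g x).
Proof.
move=> [mf fi] [mg gi]; split; first exact: measurable_funB.
apply: le_integrable (integrable_addr _ (integrableMl_cst 2 _ fi) (integrableMl_cst 2 _ gi)) => //.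
  by apply/measurable_EFinP; apply: measurable_funX; exact: measurable_funB.
move=> x _ /=; rewrite lee_fin ger0_norm ?sqr_ge0// (le_trans _ (ler_norm _))//.
by have := sqr_ge0 (f x + g x); nra.
Qed.

Lemma limn_einf_le (u : nat -> \bar R) (e : \bar R) : (forall n, (u n <= e)%E) -> (limn_einf u <= e)%E.
Proof.
move=> ue; rewrite limn_einf_lim; apply: lime_le; first exact: is_cvg_einfs.
by apply: nearW => n; apply: le_trans (ue n); apply: ereal_inf_lbound; exists n => /=.
Qed.

(** Riesz-Fischer: the increments of a fast subsequence have summable integrals, so the subsequence
    converges almost everywhere, and Fatou turns the pointwise limit into a limit in the mean. *)
Lemma real_L2_complete (a : nat -> measurableTypeR R -> R) : (forall n, sqintr (a n)) ->
  (forall e, 0 < e -> exists N, forall m n, (N <= m)%N -> (N <= n)%N ->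
     \int[mu]_(x in I01) (a m x - a n x) ^+ 2 < e) ->
  exists l, sqintr l /\ forall e, 0 < e -> exists N, forall n, (N <= n)%N ->
     \int[mu]_(x in I01) (a n x - l x) ^+ 2 <= e.
Proof.
move=> sa ca.
pose eta k : R := 1 / (2 ^ (k + 1))%:R.
have eta0 k : 0 < eta k by rewrite divr_gt0// ltr0n expn_gt0.
have /choice[N_ hN_] := fun k => ca (eta k ^+ 2) (exprn_gt0 2 (eta0 k)).
(* The maximum puts both [s k] and [s k.+1] beyond [N_ k], as the estimate of the k-th increment
   requires. *)
pose s k := (\max_(i < k.+1) N_ i)%N.
have sN k : (N_ k <= s k)%N by exact: (leq_bigmax (@ord_max k)).
have sNS k : (N_ k <= s k.+1)%N.
  have lt : (k < k.+2)%N by rewrite ltnS leqnSn.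
  exact: (@leq_bigmax _ (fun i : 'I_k.+2 => N_ i) (Ordinal lt)).
pose h k x := `|a (s k.+1) x - a (s k) x|.
have dsq m n := sqintr_sub (sa m) (sa n).
have mh k : measurable_fun I01 (h k).
  by apply: measurableT_comp => //; case: (dsq (s k.+1) (s k)).
(* The inequality |d| <= (d^2 / eta + eta) / 2 plays the part of Cauchy-Schwarz on an interval of
   length 1: since the integral of d^2 is below eta^2, that of |d| is at most eta. *)
have hle k x : h k x <= ((eta k)^-1 * (a (s k.+1) x - a (s k) x) ^+ 2 + eta k) / 2.
  rewrite /h; have := eta0 k; move: (eta k) (a _ x - a _ x) => t d t0.
  rewrite -(real_normK (num_real d)) -subr_ge0.
  rewrite (_ : _ - _ = t^-1 / 2 * (`|d| - t) ^+ 2); last by field; rewrite gt_eqF.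
  by rewrite mulr_ge0 ?sqr_ge0// divr_ge0// invr_ge0 ltW.
have bi k : mu.-integrable I01 (EFin \o (fun x => ((eta k)^-1 * (a (s k.+1) x - a (s k) x) ^+ 2 + eta k) / 2)).
  under eq_fun do rewrite mulrC; apply: integrableMl_cst => //.
  apply: integrable_addr => //; first by apply: integrableMl_cst => //; case: (dsq (s k.+1) (s k)).
  exact: (integrable_cst_lty _ measurable_I01 (@I01_lty R)).
have hi k : (\int[mu]_(x in I01) (h k x)%:E <= (eta k)%:E)%E.
  apply: (@le_trans _ _ (\int[mu]_(x in I01) (((eta k)^-1 * (a (s k.+1) x - a (s k) x) ^+ 2 + eta k) / 2)%:E)%E).
    apply: ge0_le_integral => //.
    - by move=> x _; rewrite lee_fin normr_ge0.
    - exact/measurable_EFinP.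
    - exact: measurable_int (bi k).
    - by move=> x _; rewrite lee_fin.
  rewrite integrable_fin// lee_fin.
  under eq_Rintegral do rewrite mulrC.
  have i1 : mu.-integrable I01 (EFin \o (fun x => (eta k)^-1 * (a (s k.+1) x - a (s k) x) ^+ 2)).
    by apply: integrableMl_cst => //; case: (dsq (s k.+1) (s k)).
  have i2 := integrable_cst_lty (eta k) (measurable_I01 (R := R)) (@I01_lty R).
  rewrite RintegralZl//; last exact: integrable_addr.
  rewrite RintegralD// RintegralZl//; last by case: (dsq (s k.+1) (s k)).
  rewrite Rintegral_cst// [X in fine X]lebesgue_measure_itv/= lte_fin ltr01 /= subr0 mulr1.
  have := hN_ k _ _ (sNS k) (sN k); have e0 := eta0 k.
  rewrite -(ltr_pM2l (x := (eta k)^-1)) ?invr_gt0// expr2 mulKf ?gt_eqF//.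
  lra.
pose G x := (\sum_(k <oo) (h k x)%:E)%E.
have h0 k x : I01 x -> (0 <= (h k x)%:E)%E by rewrite lee_fin normr_ge0.
have mhE k : measurable_fun I01 (fun x => (h k x)%:E) by exact/measurable_EFinP.
have mG : measurable_fun I01 G by apply: ge0_emeasurable_sum => // k x _ _; rewrite lee_fin normr_ge0.
have G0 x : (0 <= G x)%E by apply: nneseries_ge0 => n _ _; rewrite lee_fin normr_ge0.
have Gi : mu.-integrable I01 G.
  apply/integrableP; split => //.
  under eq_integral do rewrite gee0_abs//.
  rewrite integral_nneseries//.
  apply: (@le_lt_trans _ _ (\sum_(k <oo) (eta k)%:E)%E).
    apply: lee_nneseries => k _; last exact: hi.
    by move=> _; apply: integral_ge0 => x Ix; exact: h0.
  have := @cvg_geometric_eseries_half R 1 0 => /cvg_lim; rewrite expr0 divr1.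
  by move=> -> //; rewrite ltry.
(* Where the series [G] of the absolute increments is finite, the subsequence converges by
   telescoping; outside [E] everything is set to 0, so that the limit is measurable. *)
pose E := I01 `&` [set x | G x \is a fin_num].
have mE : measurable E by exact: emeasurable_fin_num.
have aeE : {ae mu, forall x, I01 x -> E x}.
  by have := integrable_ae measurable_I01 Gi; apply: ae_imp => x hx Ix; split => //; exact: hx.
have cE x : E x -> cvgn (fun k => a (s k) x).
  move=> [Ix Gx].
  have : cvgn (series (telescope (fun k => a (s k) x))).
    apply: normed_cvg; apply: nondecreasing_is_cvgn.
      apply/nondecreasing_seqP => n; rewrite /= !seriesEnat/= big_nat_recr//=.
      by rewrite lerDl.
    exists (fine (G x)) => _ [n _ <-]; rewrite -lee_fin fineK//.
    rewrite /normed_series_of /= seriesEnat/= -sumEFin; apply: nneseries_lim_ge => k _ _.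
    by rewrite lee_fin normr_ge0.
  rewrite telescopeK => /cvg_ex[L hL]; apply/cvg_ex; exists (L + a (s 0%N) x).
  rewrite (_ : (fun k => a (s k) x) =
    (fun k => (a (s k) x - a (s 0%N) x) + a (s 0%N) x)).
    exact: cvgD hL (cvg_cst (a (s 0%N) x)).
  by apply/funext => k; rewrite subrK.
pose b k := a (s k) \_ E.
pose l := (fun x => limn (fun k => a (s k) x)) \_ E.
have bl x : (fun k => b k x) @ \oo --> l x.
  rewrite /b /l /=.
  have -> : (fun k => (a (s k) \_ E) x) = (if x \in E then fun k => a (s k) x else fun=> 0).
    by apply/funext => k; rewrite patchE; case: ifP.
  rewrite patchE; case: ifPn => [|_]; last exact: cvg_cst.
  by rewrite inE => /cE.
have mb k : measurable_fun I01 (b k).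
  apply: (@measurable_funTS _ _ _ _ I01).
  apply: (measurable_restrictT (a (s k)) mE).1.
  by apply: measurable_funS (sa (s k)).1 => // x [].
have ml : measurable_fun I01 l by apply: (measurable_fun_cvg mb) => x _; exact: bl.
have aeb k : {ae mu, forall x, I01 x -> b k x = a (s k) x}.
  by move: aeE; apply: ae_imp => x /[apply] Ex; rewrite /b patchE mem_set.
(* Fatou along the subsequence shifted by [N]; it will be used with [c] a fixed term of the original
   sequence. *)
have fat (c : measurableTypeR R -> R) N (e : R) : measurable_fun I01 c -> (forall k, (N <= k)%N ->
    (\int[mu]_(x in I01) ((a (s k) x - c x) ^+ 2)%:E <= e%:E)%E) ->
    (\int[mu]_(x in I01) ((l x - c x) ^+ 2)%:E <= e%:E)%E.
  move=> mc he.
  pose f k x := ((b (k + N)%N x - c x) ^+ 2)%:E.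
  have mf k : measurable_fun I01 (f k).
    by apply/measurable_EFinP; apply: measurable_funX; exact: measurable_funB.
  have f0 k x : I01 x -> (0 <= f k x)%E by rewrite lee_fin sqr_ge0.
  have := fatou mu measurable_I01 mf f0.
  have -> : (\int[mu]_(x in I01) limn_einf (f^~ x) = \int[mu]_(x in I01) ((l x - c x) ^+ 2)%:E)%E.
    apply: eq_integral => x _.
    have fc : f ^~ x @ \oo --> ((l x - c x) ^+ 2)%:E.
      apply: cvg_EFin; first by apply: nearW.
      have bN : (fun k => b (k + N)%N x) @ \oo --> l x by rewrite (cvg_shiftn N (fun k => b k x)).
      rewrite /f expr2 (_ : fine \o _ = (fun k => (b (k + N)%N x - c x) * (b (k + N)%N x - c x))).
        exact: cvgM (cvgB bN (cvg_cst (c x))) (cvgB bN (cvg_cst (c x))).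
      by apply/funext => k /=; rewrite expr2.
    rewrite is_cvg_limn_einfE; last by apply/cvg_ex; eexists; exact: fc.
    exact/cvg_lim.
  move=> h1; apply: le_trans h1 _; apply: limn_einf_le => k.
  apply: le_trans (he (k + N)%N (leq_addl _ _)).
  rewrite le_eqVlt; apply/orP; left; apply/eqP; apply: ae_eq_integral => //.
    apply/measurable_EFinP; apply: measurable_funX; apply: measurable_funB => //.
    by case: (sa (s (k + N)%N)).
  by have := aeb (k + N)%N; apply: ae_imp => x /[apply]; rewrite /f => ->.
have scof m : exists K, forall k, (K <= k)%N -> (N_ m <= s k)%N.
  exists m => k mk; apply: (@leq_trans (N_ m)) => //.
  have lt : (m < k.+1)%N by rewrite ltnS.
  exact: (@leq_bigmax _ (fun i : 'I_k.+1 => N_ i) (Ordinal lt)).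
have dist e : 0 < e -> exists N, forall n, (N <= n)%N ->
    (\int[mu]_(x in I01) ((l x - a n x) ^+ 2)%:E <= e%:E)%E.
  move=> e0; have [m me] : exists m, eta m ^+ 2 <= e.
    have [m /(_ m (leqnn m)) hm] := invn_small e0.
    exists m; apply: le_trans (ltW hm).
    have em : eta m <= (m.+1%:R)^-1.
      by rewrite /eta div1r lef_pV2 ?posrE ?ltr0n ?expn_gt0// ler_nat addn1 ltnW// ltn_expl.
    have m1 : (m.+1%:R)^-1 <= 1 :> R by rewrite invf_le1 ?ltr0n// ler1n.
    have := eta0 m; move: em m1; move: (m.+1%:R^-1) => y; nra.
  have [K hK] := scof m.
  exists (N_ m) => n hn; apply: (fat _ K) => [|k Kk]; first by case: (sa n).
  rewrite integrable_fin//; last by case: (dsq (s k) n).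
  rewrite lee_fin ltW// (lt_le_trans _ me)//; exact: hN_ (hK _ Kk) hn.
(* l = a_N - (a_N - l), where the distance bound just proved makes the second term square
   integrable. *)
have sl : sqintr l.
  have [N /(_ N (leqnn N)) hN] := dist 1 ltr01.
  have md : measurable_fun I01 (fun x => a N x - l x).
    by apply: measurable_funB => //; case: (sa N).
  have sd : sqintr (fun x => a N x - l x).
    split => //; apply/integrableP; split.
      by apply/measurable_EFinP; apply: measurable_funX.
    apply: (@le_lt_trans _ _ 1%:E); last by rewrite ltry.
    apply: le_trans hN; rewrite le_eqVlt; apply/orP; left; apply/eqP.
    by apply: eq_integral => x _; rewrite gee0_abs/= ?lee_fin ?sqr_ge0// -sqrrN opprB.
  have := sqintr_sub (sa N) sd; congr sqintr; apply/funext => x.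
  by rewrite opprB addrC subrK.
exists l; split => // e /dist[N hN]; exists N => n /hN.
rewrite integrable_fin//; last by case: (sqintr_sub sl (sa n)).
rewrite lee_fin; congr (_ <= _); apply: eq_Rintegral => x _.
by rewrite -sqrrN opprB.
Qed.

End real_L2_complete.

Section L2_hilbert.
Variable R : realType.
Local Notation mu := (@lebesgue_measure R).
Local Notation I01 := (@I01 R).

Lemma sqintr_of (f : L2 R) : sqintr (fun x => Re (f x)) /\ sqintr (fun x => Im (f x)).
Proof.
have /sqintP[m1 m2 fi] := L2_sqint f.
split; split => //; apply: le_integrable fi => //;
  try (by apply/measurable_EFinP; exact: measurable_funX);
  move=> x _ /=; rewrite lee_fin !ger0_norm ?addr_ge0 ?sqr_ge0//.
  by rewrite lerDl sqr_ge0.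
by rewrite lerDr sqr_ge0.
Qed.

Lemma sqint_of (h : measurableTypeR R -> R[i]) :
  sqintr (fun x => Re (h x)) -> sqintr (fun x => Im (h x)) -> h \in @sqint R.
Proof. by move=> [m1 i1] [m2 i2]; apply/sqintP; split => //; exact: integrable_addr. Qed.

Lemma Re_inner_sub (f : L2 R) (h : measurableTypeR R -> R[i]) (g : L2 R) : ae_eq01 g h -> h \in @sqint R ->
  Re (inner (f - g) (f - g)) =
  \int[mu]_(x in I01) (Re (f x) - Re (h x)) ^+ 2 + \int[mu]_(x in I01) (Im (f x) - Im (h x)) ^+ 2.
Proof.
move=> gh /sqintP[m1 m2 hi].
have [hr him] : sqintr (fun x => Re (h x)) /\ sqintr (fun x => Im (h x)).
  split; split => //; apply: le_integrable hi => //;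
  try (by apply/measurable_EFinP; exact: measurable_funX);
  move=> x _ /=; rewrite lee_fin !ger0_norm ?addr_ge0 ?sqr_ge0//.
    by rewrite lerDl sqr_ge0.
  by rewrite lerDr sqr_ge0.
have [fr fim] := sqintr_of f.
have d1 := sqintr_sub fr hr; have d2 := sqintr_sub fim him.
rewrite -RintegralD//; [|exact: d1.2|exact: d2.2].
rewrite inner_self /=; apply: Rintegral_ae => //.
- by have /sqintP[] := L2_sqint (f - g).
- exact: integrable_addr d1.2 d2.2.
- have := L2_aeZD (-1) g f; rewrite scaleN1r addrC.
  by move: gh; apply: ae_imp2 => x gx fg Ix; rewrite fg// gx// !ReImE /=; ring.
Qed.

Lemma L2_complete (u : nat -> L2 R) :
  (forall e, 0 < e -> exists N, forall m n, (N <= m)%N -> (N <= n)%N ->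
     Re (inner (u m - u n) (u m - u n)) < e) ->
  exists l : L2 R, forall e, 0 < e -> exists N, forall n, (N <= n)%N ->
     Re (inner (u n - l) (u n - l)) < e.
Proof.
move=> cu.
have sub m n : Re (inner (u m - u n) (u m - u n)) =
  \int[mu]_(x in I01) (Re (u m x) - Re (u n x)) ^+ 2 + \int[mu]_(x in I01) (Im (u m x) - Im (u n x)) ^+ 2.
  by apply: Re_inner_sub; [exact: ae_eq01_refl|exact: L2_sqint].
have int0 (f : measurableTypeR R -> R) : 0 <= \int[mu]_(x in I01) f x ^+ 2.
  by apply: Rintegral_ge0 => x _; exact: sqr_ge0.
(* By [sub] the squared distance is a sum of two nonnegative integrals, so real and imaginary parts
   are Cauchy separately. *)
have [l1 [sl1 hl1]] := @real_L2_complete R (fun n x => Re (u n x)) (fun n => (sqintr_of (u n)).1)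
  (fun e e0 => let: ex_intro N hN := cu e e0 in ex_intro _ N (fun m n Nm Nn =>
    le_lt_trans (eq_ind _ (fun z => _ <= z) (ler_wpDr (int0 _) (lexx _)) _ (esym (sub m n))) (hN m n Nm Nn))).
have [l2 [sl2 hl2]] := @real_L2_complete R (fun n x => Im (u n x)) (fun n => (sqintr_of (u n)).2)
  (fun e e0 => let: ex_intro N hN := cu e e0 in ex_intro _ N (fun m n Nm Nn =>
    le_lt_trans (eq_ind _ (fun z => _ <= z) (ler_wpDl (int0 _) (lexx _)) _ (esym (sub m n))) (hN m n Nm Nn))).
pose h x := (l1 x +i* l2 x).
have sh : h \in @sqint R by exact: sqint_of.
exists (L2_of h) => e e0.
have e3 : 0 < e / 3 by rewrite divr_gt0.
have [N1 h1] := hl1 _ e3; have [N2 h2] := hl2 _ e3.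
exists (maxn N1 N2) => n; rewrite geq_max => /andP[/h1 {}h1 /h2 {}h2].
by rewrite (Re_inner_sub (u n) (L2_ofE sh) sh) /h /=; lra.
Qed.

Lemma L2_hilbert : @hilbert R (L2 R) (@inner R).
Proof.
split.
- exact: innerZDr.
- exact: innerJ.
- exact: inner_ge0.
- exact: inner_def.
- exact: L2_complete.
Qed.

End L2_hilbert.

(** * Uniqueness of the continuous representative *)

Section continuous_unique.
Variable R : realType.
Local Notation mu := (@lebesgue_measure R).

(** At an interior point where they differed, they would differ on a whole ball, which is not a null
    set; the endpoints follow by one-sided limits. *)
Lemma cts_ae_unique (p q : R -> R) :
  {within `[0, 1], continuous p} -> {within `[0, 1], continuous q} ->
  {ae mu, forall x, @I01 R x -> p x = q x} -> forall x, x \in `[0, 1] -> p x = q x.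
Proof.
move=> /(continuous_within_itvP _ (@ltr01 R))[cp p0 p1].
move=> /(continuous_within_itvP _ (@ltr01 R))[cq q0 q1] [N [mN N0 sub]].
have inside x : x \in `]0, 1[ -> p x = q x.
  move=> x01; apply/eqP; rewrite -subr_eq0 -normr_le0 leNgt; apply/negP => d0.
  have cd : {for x, continuous (p \- q)} by apply: cvgB; [exact: cp|exact: cq].
  have n1 : \forall t \near x, `|(p x - q x) - (p t - q t)| < `|p x - q x|.
    by move/cvgrPdist_lt : cd => /(_ _ d0).
  have n2 : \forall t \near x, t \in `]0, 1[ by exact: near_in_itvoo.
  have /nbhs_ballP[e /= e0 be] : \forall t \near x, N t.
    near=> t; apply: sub => /=; apply/not_implyP; split.
      by near: t; exact: n2.
    move=> pq; have : `|(p x - q x) - (p t - q t)| < `|p x - q x| by near: t; exact: n1.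
    by rewrite pq subrr subr0 ltxx.
  have : (mu (ball x e : set (measurableTypeR R)) <= mu N)%E.
    by apply: le_measure; rewrite ?inE//; exact: measurable_ballR.
  rewrite N0; have /= -> := lebesgue_measure_ball x (ltW e0).
  by rewrite lee_fin leNgt mulrn_wgt0.
move=> x; rewrite in_itv/= => /andP[]; rewrite le_eqVlt => /predU1P[<- _|x0].
  have h : p t @[t --> 0^'+] --> q 0.
    apply: cvg_trans q0; apply: near_eq_cvg; near=> t; apply/esym/inside.
    by rewrite in_itv/=; apply/andP; split.
  exact: (cvg_unique (@Rhausdorff R) p0 h).
rewrite le_eqVlt => /predU1P[->|x1]; last by apply: inside; rewrite in_itv/= x0.
have h : p t @[t --> 1^'-] --> q 1.
  apply: cvg_trans q1; apply: near_eq_cvg; near=> t; apply/esym/inside.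
  by rewrite in_itv/=; apply/andP; split.
exact: (cvg_unique (@Rhausdorff R) p1 h).
Unshelve. all: by end_near. Qed.

End continuous_unique.

(** * Sobolev functions on (0,1) *)

Section real_primitive.
Variable R : realType.
Local Notation mu := (@lebesgue_measure R).
Local Notation I01 := (@I01 R).
Implicit Types f g : measurableTypeR R -> R.

Lemma patch_integrable f : mu.-integrable I01 (EFin \o f) ->
  mu.-integrable setT (EFin \o (f \_ I01)).
Proof. by move=> fi; rewrite -restrict_EFin; apply/(integrable_mkcond _ measurable_I01).1. Qed.

(** Cutting [f] off outside ]0, 1[ makes this the primitive that vanishes at 0, and lets the results
    on the whole line apply. *)
Definition rprim f : R -> R := primNy (f \_ I01).

Lemma rprim_continuous f : mu.-integrable I01 (EFin \o f) -> continuous (rprim f).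
Proof. by move=> /patch_integrable; exact: primNy_continuous. Qed.

Lemma rprim0 f : rprim f 0 = 0.
Proof.
apply: primNy_eq0 => y y0; rewrite patchE; case: ifPn => //.
by rewrite inE /Defs.I01/= in_itv/= ltNge y0.
Qed.

Lemma rprim1 f : mu.-integrable I01 (EFin \o f) -> rprim f 1 = \int[mu]_(x in I01) f x.
Proof.
move=> /patch_integrable fi; rewrite Rintegral_mkcond; apply/esym/primNy_setT => // y y0.
rewrite patchE; case: ifPn => //.
by rewrite inE /Defs.I01/= in_itv/= [y < 1]ltNge y0 andbF.
Qed.

Lemma rprim_mul f g : mu.-integrable I01 (EFin \o f) -> mu.-integrable I01 (EFin \o g) ->
  mu.-integrable I01 (EFin \o (fun x => f x * rprim g x)) /\
  \int[mu]_(x in I01) (f x * rprim g x) =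
  \int[mu]_(x in I01) f x * \int[mu]_(x in I01) g x - \int[mu]_(x in I01) (g x * rprim f x).
Proof.
move=> fi gi; have fi' := patch_integrable fi; have gi' := patch_integrable gi.
have pE (a b : measurableTypeR R -> R) : (fun x => a x * rprim b x) \_ I01 = (fun x => (a \_ I01) x * primNy (b \_ I01) x).
  by apply/funext => x; rewrite !patchE; case: ifP => // _; rewrite mul0r.
split.
  apply/(integrable_mkcond _ measurable_I01).2; rewrite restrict_EFin pE.
  by have [] := primNy_Fubini fi' gi'.
rewrite [LHS]Rintegral_mkcond pE primNy_mulr//.
congr (_ * _ - _); [by rewrite [RHS]Rintegral_mkcond|by rewrite [RHS]Rintegral_mkcond|].
by rewrite [RHS]Rintegral_mkcond pE.
Qed.

Lemma rprim_ae f g : mu.-integrable I01 (EFin \o f) -> mu.-integrable I01 (EFin \o g) ->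
  {ae mu, forall x, I01 x -> f x = g x} -> rprim f = rprim g.
Proof.
move=> /patch_integrable fi /patch_integrable gi fg; apply/funext => x.
apply: Rintegral_ae.
- exact: measurable_itv.
- by apply: integrableS fi => //; exact: measurable_itv.
- by apply: integrableS gi => //; exact: measurable_itv.
- move: fg; apply: ae_imp => y h _; rewrite !patchE; case: ifPn => //.
  by rewrite inE => /h.
Qed.

Lemma rprimZD (a b : R) f g : mu.-integrable I01 (EFin \o f) -> mu.-integrable I01 (EFin \o g) ->
  forall x, rprim (fun y => a * f y + b * g y) x = a * rprim f x + b * rprim g x.
Proof.
move=> /patch_integrable fi /patch_integrable gi x.
have mI : measurable (`]-oo, x]%classic : set (measurableTypeR R)) by exact: measurable_itv.
have fx : mu.-integrable `]-oo, x] (EFin \o (f \_ I01)) by apply: integrableS fi.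
have gx : mu.-integrable `]-oo, x] (EFin \o (g \_ I01)) by apply: integrableS gi.
rewrite /rprim /primNy -!RintegralZl// -RintegralD//; try exact: integrableMl_cst.
apply: eq_Rintegral => y _; rewrite !patchE; case: ifP => // _.
by rewrite !mulr0 addr0.
Qed.

Lemma rprim_cst_ae0 f c : mu.-integrable I01 (EFin \o f) ->
  (forall x, I01 x -> rprim f x = c) -> {ae mu, forall x, I01 x -> f x = 0}.
Proof.
move=> /patch_integrable fi h.
have oI : open I01 by exact: interval_open.
have := primNy_cst_ae0 fi oI h; apply: ae_imp => x hx Ix.
by have := hx Ix; rewrite patchE mem_set.
Qed.

Lemma test_fun_out (phi : R -> R) x : test_fun phi -> ~ I01 x -> phi x = 0 /\ derive1 phi x = 0.
Proof.
move=> [_ _ [a [b [a0 b1 h]]]] Ix.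
have xab : x \notin `[a, b].
  apply/negP; rewrite in_itv/= => /andP[ax xb]; apply: Ix.
  by rewrite /Defs.I01/= in_itv/= (lt_le_trans a0 ax) (le_lt_trans xb b1).
by split; [exact: h|exact: test_fun_derive0 h _ xab].
Qed.

Lemma test_fun_rprim (phi : R -> R) : test_fun phi ->
  mu.-integrable I01 (EFin \o derive1 phi) /\ rprim (derive1 phi) = phi.
Proof.
move=> tphi; have [di _ pE] := test_fun_integrable tphi.
split; first by apply: integrableS di.
rewrite /rprim -[RHS]pE; congr primNy; apply/funext => x; rewrite patchE.
case: ifPn => //; rewrite notin_setE => nx.
by have [_ ->] := test_fun_out tphi nx.
Qed.

Lemma du_bois_reymond01 f : mu.-integrable I01 (EFin \o f) ->
  (forall phi, test_fun phi -> \int[mu]_(x in I01) (f x * derive1 phi x) = 0) ->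
  exists c, {ae mu, forall x, I01 x -> f x = c}.
Proof.
move=> fi h.
have [|c hc] := du_bois_reymond (patch_integrable fi).
  move=> phi tphi; rewrite -(h _ tphi) [RHS]Rintegral_mkcond; apply: eq_Rintegral => x _.
  by rewrite !patchE; case: ifP => // _; rewrite mul0r.
exists c; move: hc; apply: ae_imp => x hx Ix.
by have := hx Ix; rewrite patchE mem_set.
Qed.

End real_primitive.

Section complex_primitive.
Variable R : realType.
Local Notation mu := (@lebesgue_measure R).
Local Notation I01 := (@I01 R).
Implicit Types h k : measurableTypeR R -> R[i].

Definition cprim h (x : R) : R[i] := rprim (fun y => Re (h y)) x +i* rprim (fun y => Im (h y)) x.

Lemma cprim0 h : cprim h 0 = 0.
Proof. by rewrite /cprim !rprim0. Qed.

Lemma cprim1 h : cintegrable h -> cprim h 1 = Cintegral01 h.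
Proof. by move=> [h1 h2]; rewrite /cprim !rprim1. Qed.

Lemma cprim_ae h k : cintegrable h -> cintegrable k -> ae_eq01 h k -> cprim h = cprim k.
Proof.
move=> [h1 h2] [k1 k2] hk; apply/funext => x; rewrite /cprim.
rewrite (rprim_ae h1 k1); last by move: hk; apply: ae_imp => y /[apply] ->.
by rewrite (rprim_ae h2 k2)//; move: hk; apply: ae_imp => y /[apply] ->.
Qed.

Lemma cprimZD (a : R[i]) h k : cintegrable h -> cintegrable k ->
  forall x, cprim (fun y => a * h y + k y) x = a * cprim h x + cprim k x.
Proof.
move=> [h1 h2] [k1 k2] x; rewrite /cprim; apply: complex_eqP; rewrite !ReImE /=.
  have -> : (fun y => Re (a * h y + k y)) =
    (fun y => 1 * (Re a * Re (h y) + (- Im a) * Im (h y)) + 1 * Re (k y)).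
    by apply/funext => y; rewrite !ReImE; ring.
  rewrite !rprimZD//; first by ring.
  by apply: integrable_addr => //; exact: integrableMl_cst.
have -> : (fun y => Im (a * h y + k y)) =
  (fun y => 1 * (Re a * Im (h y) + Im a * Re (h y)) + 1 * Im (k y)).
  by apply/funext => y; rewrite !ReImE; ring.
rewrite !rprimZD//; first by ring.
by apply: integrable_addr => //; exact: integrableMl_cst.
Qed.

Lemma cprimJ h : cintegrable h -> forall x, cprim (fun y => (h y)^*) x = (cprim h x)^*.
Proof.
move=> [h1 h2] x; rewrite /cprim; apply: complex_eqP; rewrite /= ?ReImE //.
  by under [X in rprim X]eq_fun do rewrite cReJ.
have -> : (fun y => Im (h y)^*) = (fun y => (-1) * Im (h y) + 0 * Im (h y)).
  by apply/funext => y; rewrite cImJ; ring.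
by rewrite rprimZD//; ring.
Qed.

Lemma cprim_mul h k : cintegrable h -> cintegrable k ->
  cintegrable (fun x => h x * cprim k x) /\
  Cintegral01 (fun x => h x * cprim k x) =
  Cintegral01 h * Cintegral01 k - Cintegral01 (fun x => k x * cprim h x).
Proof.
move=> [h1 h2] [k1 k2].
have [i11 e11] := rprim_mul h1 k1; have [i12 e12] := rprim_mul h1 k2.
have [i21 e21] := rprim_mul h2 k1; have [i22 e22] := rprim_mul h2 k2.
have [j11 _] := rprim_mul k1 h1; have [j12 _] := rprim_mul k1 h2.
have [j21 _] := rprim_mul k2 h1; have [j22 _] := rprim_mul k2 h2.
split.
  split; under eq_fun do rewrite ReImE /=; [exact: integrable_subr|exact: integrable_addr].
have eR (p q : measurableTypeR R -> R[i]) x : Re (p x * cprim q x) =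
    Re (p x) * rprim (fun y => Re (q y)) x - Im (p x) * rprim (fun y => Im (q y)) x.
  by rewrite /cprim; case: (p x).
have eI (p q : measurableTypeR R -> R[i]) x : Im (p x * cprim q x) =
    Re (p x) * rprim (fun y => Im (q y)) x + Im (p x) * rprim (fun y => Re (q y)) x.
  by rewrite /cprim; case: (p x).
have auxB (a b p q : R) : a - p - (b - q) = a - b - (p - q) by ring.
have auxD (a b p q : R) : a - p + (b - q) = a + b - (q + p) by ring.
apply: complex_eqP; rewrite !ReImE /=.
  rewrite (@eq_Rintegral _ _ _ mu I01 _ _ (fun x _ => eR h k x)) (@eq_Rintegral _ _ _ mu I01 _ _ (fun x _ => eR k h x)).
  rewrite (RintegralB measurable_I01 i11 i22) (RintegralB measurable_I01 j11 j22) e11 e22.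
  exact: auxB.
rewrite (@eq_Rintegral _ _ _ mu I01 _ _ (fun x _ => eI h k x)) (@eq_Rintegral _ _ _ mu I01 _ _ (fun x _ => eI k h x)).
rewrite (RintegralD measurable_I01 i12 i21) (RintegralD measurable_I01 j12 j21) e12 e21.
exact: auxD.
Qed.

Lemma sqint_continuous h : {within `[0, 1], continuous (fun x => Re (h x) : R)} ->
  {within `[0, 1], continuous (fun x => Im (h x) : R)} -> h \in @sqint R.
Proof.
move=> c1 c2.
have sub : I01 `<=` (`[0, 1]%classic : set (measurableTypeR R)) by exact: subset_itv_oo_cc.
have mm (p : R -> R) : {within `[0, 1], continuous p} -> measurable_fun I01 p.
  move=> cp; apply: (@measurable_funS _ _ _ _ (`[0, 1]%classic : set (measurableTypeR R))) => //.
  by apply: subspace_continuous_measurable_fun => //.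
apply/sqintP; split; [exact: mm|exact: mm|].
apply: (@integrableS _ _ _ mu (`[0, 1]%classic : set (measurableTypeR R))) => //.
apply: continuous_compact_integrable; first exact: segment_compact.
move=> x; apply: cvgD; rewrite ?expr2.
  by apply: cvgM; exact: c1.
by apply: cvgM; exact: c2.
Qed.

Lemma cprim_within_continuous (c : R[i]) h : cintegrable h ->
  {within `[0, 1], continuous (fun x => Re (c + cprim h x) : R)} /\
  {within `[0, 1], continuous (fun x => Im (c + cprim h x) : R)}.
Proof.
move=> [h1 h2]; split; apply: continuous_subspaceT => x; under eq_fun do rewrite ReImE /=.
  by apply: cvgD; [exact: cvg_cst|exact: rprim_continuous].
by apply: cvgD; [exact: cvg_cst|exact: rprim_continuous].
Qed.

End complex_primitive.

Section prim01.
Variable R : realType.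
Local Notation mu := (@lebesgue_measure R).
Local Notation I01 := (@I01 R).
Implicit Types (f g u v : L2 R) (c d : R[i]).

Lemma L2_cintegrable f : cintegrable f.
Proof. exact: sqint_cintegrable (L2_sqint f). Qed.

Lemma prim01_exists : exists F : R[i] -> L2 R -> L2 R,
  forall c g, ae_eq01 (F c g) (fun x => c + cprim g x).
Proof.
exists (fun c g => L2_of (fun x => c + cprim g x)) => c g.
apply: L2_ofE; have [c1 c2] := cprim_within_continuous c (L2_cintegrable g).
exact: sqint_continuous.
Qed.

(** The class with value [c] at 0 and weak derivative [g]. Weak derivatives, boundary values and
    integration by parts are all computed on classes of this form. As with [L2_of], going through
    [cid] hides the quotient from unification. *)
Definition prim01 : R[i] -> L2 R -> L2 R := projT1 (cid prim01_exists).

Lemma prim01E c g : ae_eq01 (prim01 c g) (fun x => c + cprim g x).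
Proof. exact: (projT2 (cid prim01_exists)). Qed.

Lemma cprim_L2ZD (a : R[i]) f g x : cprim (a *: f + g : L2 R) x = a * cprim f x + cprim g x.
Proof.
rewrite -cprimZD; [|exact: L2_cintegrable|exact: L2_cintegrable].
congr (_ x); apply: cprim_ae; [exact: L2_cintegrable| |exact: L2_aeZD].
by apply: cintegrableD; [apply: cintegrableZ|]; exact: L2_cintegrable.
Qed.

Lemma cprim_L2_0 x : cprim (0 : L2 R) x = 0.
Proof. by have := cprim_L2ZD (-1) 0 0 x; rewrite scaler0 addr0 mulN1r addNr. Qed.

Lemma prim01ZD (a : R[i]) c d f g : prim01 (a * c + d) (a *: f + g) = a *: prim01 c f + prim01 d g.
Proof.
apply: L2_ext; apply: ae_eq01_trans (prim01E _ _) _.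
apply: ae_eq01_sym; apply: ae_eq01_trans (L2_aeZD _ _ _) _.
have := prim01E d g; have := prim01E c f; apply: ae_imp2 => x h1 h2 Ix.
move: (h1 Ix) (h2 Ix) => {}h1 {}h2.
rewrite cprim_L2ZD; apply: (eq_trans (congr2 (fun p q => a * p + q) h1 h2)).
by rewrite mulrDr addrACA.
Qed.

Definition CintL2 f : R[i] := Cintegral01 f.

Lemma cprim_L2_1 g : cprim g 1 = Cintegral01 g.
Proof. exact/cprim1/L2_cintegrable. Qed.

Lemma test_fun_cprim (phi : R -> R) : test_fun phi ->
  cintegrable (fun x => (derive1 phi x)%:C) /\
  cprim (fun x => (derive1 phi x)%:C) = (fun x => (phi x)%:C).
Proof.
move=> tphi; have [di pE] := test_fun_rprim tphi.
have i0 : mu.-integrable I01 (EFin \o (fun=> (0:R))).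
  exact: (integrable_cst_lty _ measurable_I01 (@I01_lty R)).
split; first by split.
apply/funext => x; rewrite /cprim /=; congr (_ +i* _); first by rewrite -[in RHS]pE.
have -> : (fun=> (0:R)) = (fun x : R => 0 * (fun=> (0:R)) x + 0 * (fun=> (0:R)) x).
  by apply/funext => y; ring.
by rewrite rprimZD//; ring.
Qed.

Lemma prim01_weak_deriv c g : weak_deriv (prim01 c g) g.
Proof.
move=> phi tphi; have [di pE] := test_fun_cprim tphi.
have gi := L2_cintegrable g.
have [i1 e1] := cprim_mul di gi; have [i2 _] := cprim_mul gi di.
rewrite pE in e1 i2.
(* The integral of phi' is phi(1) = 0; this removes both the boundary term and the contribution of
   the constant [c]. *)
have p1 : Cintegral01 (fun x => (derive1 phi x)%:C) = 0.
  rewrite -cprim1// pE; have [|-> _ //] := test_fun_out tphi (x := 1).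
  by rewrite /Defs.I01/= in_itv/= ltxx andbF.
rewrite p1 mul0r sub0r in e1; rewrite -e1.
transitivity (Cintegral01 (fun x => c * (derive1 phi x)%:C + (derive1 phi x)%:C * cprim g x)).
  apply: Cintegral_ae.
  - have sd : (fun x => (derive1 phi x)%:C) \in @sqint R.
      have [_ cd _] := tphi; apply: sqint_continuous; apply: continuous_subspaceT => //=.
      exact: cst_continuous.
    exact: sqint_mul (L2_sqint _) sd.
  - by apply: cintegrableD => //; exact: cintegrableZ.
  - by have := prim01E c g; apply: ae_imp => x h Ix; rewrite h//; ring.
rewrite CintegralD//; last exact: cintegrableZ.
by rewrite CintegralZ// p1 mulr0 add0r.
Qed.

Lemma weak_derivB f g u v : weak_deriv f g -> weak_deriv u v -> weak_deriv (f - u) (g - v).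
Proof.
move=> fg uv phi tphi.
have sphi (p : R -> R) : continuous p -> (fun x => (p x)%:C) \in @sqint R.
  move=> cp; apply: sqint_continuous; apply: continuous_subspaceT => //=.
  exact: cst_continuous.
have [dphi cd _] := tphi.
have s1 := sphi _ cd.
have s2 : (fun x => (phi x)%:C) \in @sqint R.
  apply: sphi => x; apply: differentiable_continuous; exact/derivable1_diffP.
have key (a b : L2 R) (p : measurableTypeR R -> R[i]) : p \in @sqint R ->
   Cintegral01 (fun x => (a - b : L2 R) x * p x) = Cintegral01 (fun x => a x * p x) - Cintegral01 (fun x => b x * p x).
  move=> sp; have ia := sqint_mul (L2_sqint a) sp; have ib := sqint_mul (L2_sqint b) sp.
  rewrite -mulN1r -CintegralZ// addrC -CintegralD//; last exact: cintegrableZ.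
  apply: Cintegral_ae.
  - exact: sqint_mul (L2_sqint _) sp.
  - by apply: cintegrableD => //; exact: cintegrableZ.
  - have := L2_aeZD (-1) b a; rewrite scaleN1r addrC; apply: ae_imp => x h Ix.
    by rewrite h//; ring.
by rewrite !key// fg// uv//; ring.
Qed.

Lemma weak_deriv0 f : weak_deriv f 0 -> exists c, f = prim01 c 0.
Proof.
move=> f0; have [fr fi] := L2_cintegrable f.
have z phi : test_fun phi -> Cintegral01 (fun x => f x * (derive1 phi x)%:C) = 0.
  move=> tphi; rewrite f0//; apply/eqP; rewrite oppr_eq0; apply/eqP.
  have sp : (fun x => (phi x)%:C) \in @sqint R.
    have [dphi _ _] := tphi; apply: sqint_continuous; apply: continuous_subspaceT => /=.
      by move=> x; apply: differentiable_continuous; exact/derivable1_diffP.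
    exact: cst_continuous.
  transitivity (Cintegral01 (fun x => 0 * (phi x)%:C)); last first.
    by rewrite CintegralZ ?mul0r//; exact: sqint_cintegrable.
  apply: Cintegral_ae.
  - exact: sqint_mul (L2_sqint _) sp.
  - by apply: cintegrableZ; exact: sqint_cintegrable.
  - by have := @L2_ae0 R; apply: ae_imp => x h Ix; rewrite (h Ix).
have [|c1 h1] := du_bois_reymond01 fr.
  move=> phi tphi; have /(congr1 (@complex.Re R)) /= <- := z _ tphi.
  by apply: eq_Rintegral => x _; rewrite cReM /=; ring.
have [|c2 h2] := du_bois_reymond01 fi.
  move=> phi tphi; have /(congr1 (@complex.Im R)) /= <- := z _ tphi.
  by apply: eq_Rintegral => x _; rewrite cImM /=; ring.
exists (c1 +i* c2); apply: L2_ext; apply: ae_eq01_trans (ae_eq01_sym (prim01E _ _)).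
move: h1 h2; apply: ae_imp2 => x h1 h2 Ix; rewrite cprim_L2_0 addr0; apply: complex_eqP.
  exact: h1.
exact: h2.
Qed.

(** The difference [f - prim01 0 g] has weak derivative 0, hence is constant by the du Bois-Reymond
    lemma. *)
Lemma weak_derivP f g : weak_deriv f g <-> exists c, f = prim01 c g.
Proof.
split=> [fg|[c ->]]; last exact: prim01_weak_deriv.
have := weak_derivB fg (@prim01_weak_deriv 0 g); rewrite subrr => /weak_deriv0[c hc].
exists c; rewrite -(subrK (prim01 0 g) f) hc.
have := prim01ZD 1 c 0 0 g; rewrite !scale1r mul1r addr0 add0r => ->//.
Qed.

Lemma continuous_repr_prim01 c g x : x \in `[0, 1] -> continuous_repr (prim01 c g) x = c + cprim g x.
Proof.
move=> x01; have [c1 c2] := cprim_within_continuous c (L2_cintegrable g).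
rewrite /continuous_repr; case: xgetP => [h _ [h1 h2 h3]|/(_ (fun x => c + cprim g x))]; last first.
  by case; split => //; exact: prim01E.
have hE := ae_eq01_trans (ae_eq01_sym h3) (prim01E c g).
apply: complex_eqP.
  by apply: (cts_ae_unique h1 c1) => //; move: hE; apply: ae_imp => y /[apply] ->.
by apply: (cts_ae_unique h2 c2) => //; move: hE; apply: ae_imp => y /[apply] ->.
Qed.

Lemma val0_prim01 c g : Defs.val0 (prim01 c g) = c.
Proof. by rewrite /Defs.val0 continuous_repr_prim01 ?cprim0 ?addr0// in_itv/= lexx ler01. Qed.

Lemma val1_prim01 c g : Defs.val1 (prim01 c g) = c + CintL2 g.
Proof. by rewrite /Defs.val1 continuous_repr_prim01 ?cprim_L2_1// in_itv/= lexx ler01. Qed.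

(** Uniqueness of the weak derivative, on which [wD] depends: an integrand whose primitive vanishes
    on ]0, 1[ is null almost everywhere. *)
Lemma prim01_inj c d f g : prim01 c f = prim01 d g -> c = d /\ f = g.
Proof.
move=> e; have cd : c = d by rewrite -(val0_prim01 c f) e val0_prim01.
split => //; apply/eqP; rewrite -subr_eq0; apply/eqP.
have pz x : I01 x -> cprim (f - g : L2 R) x = 0.
  move=> Ix; have x01 : x \in `[0, 1] by exact: (@subset_itv_oo_cc _ R 0 1).
  have := continuous_repr_prim01 c f x01; rewrite e continuous_repr_prim01// cd => /addrI h.
  have := cprim_L2ZD (-1) g f x; rewrite scaleN1r [- g + f]addrC => ->.
  by rewrite h mulN1r addNr.
have [i1 i2] := L2_cintegrable (f - g).
have a1 := rprim_cst_ae0 i1 (fun x Ix => congr1 (@complex.Re R) (pz x Ix)).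
have a2 := rprim_cst_ae0 i2 (fun x Ix => congr1 (@complex.Im R) (pz x Ix)).
apply: L2_ext; apply: ae_eq01_trans (ae_eq01_sym (@L2_ae0 R)).
by move: a1 a2; apply: ae_imp2 => x h1 h2 Ix; apply: complex_eqP; [exact: h1|exact: h2].
Qed.

Lemma wD_prim01 c g : wD (prim01 c g) = g.
Proof.
rewrite /wD; case: xgetP => [h _ /weak_derivP[d /prim01_inj[]]//|/(_ g)].
by case; exact: prim01_weak_deriv.
Qed.

Lemma H2P f : H2 f <-> exists c d h, f = prim01 c (prim01 d h).
Proof.
split=> [[g [h [/weak_derivP[c ->] /weak_derivP[d ->]]]]|[c [d [h ->]]]].
  by exists c, d, h.
by exists (prim01 d h), h; split; exact: prim01_weak_deriv.
Qed.

Lemma inner_parts c d f g :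
  inner (prim01 c f) g + inner f (prim01 d g) =
  (Defs.val1 (prim01 c f))^*%C * Defs.val1 (prim01 d g) - c^*%C * d.
Proof.
have fi := L2_cintegrable f; have gi := L2_cintegrable g.
have fJ := cintegrableJ fi.
have [i1 e1] := cprim_mul fJ gi; have [i2 _] := cprim_mul gi fJ.
rewrite !val1_prim01.
have -> : inner (prim01 c f) g = c^*%C * CintL2 g + Cintegral01 (fun x => g x * cprim (fun y => (f y)^*) x).
  rewrite /CintL2 -CintegralZ// -CintegralD//; last exact: cintegrableZ.
  apply: Cintegral_ae; [exact: inner_cintegrable| |].
    by apply: cintegrableD => //; exact: cintegrableZ.
  have := prim01E c f; apply: ae_imp => x h Ix; rewrite (h Ix) cprimJ//.
  by rewrite rmorphD [g x * _]mulrC mulrDl.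
have -> : inner f (prim01 d g) = d * (CintL2 f)^*%C + Cintegral01 (fun x => (f x)^* * cprim g x).
  rewrite /CintL2 -CintegralJ// -CintegralZ// -CintegralD//; last exact: cintegrableZ.
  apply: Cintegral_ae; [exact: inner_cintegrable| |].
    by apply: cintegrableD => //; exact: cintegrableZ.
  have := prim01E d g; apply: ae_imp => x h Ix; rewrite (h Ix); ring.
rewrite e1 (CintegralJ fi) rmorphD /= -/(CintL2 f) -/(CintL2 g).
ring.
Qed.

End prim01.

Section sobolev.
Variable R : realType.
Implicit Types (f g h u v : L2 R) (a c d : R[i]).
Let hL2 := L2_hilbert R.

Lemma prim01_0 : prim01 0 0 = 0 :> L2 R.
Proof.
apply: L2_ext; apply: ae_eq01_trans (prim01E _ _) _; apply: ae_eq01_sym.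
have := @L2_ae0 R; apply: ae_imp => x /[apply] ->.
by rewrite cprim_L2_0 addr0.
Qed.

Lemma prim01Z a c g : a *: prim01 c g = prim01 (a * c) (a *: g).
Proof. by have := prim01ZD a c 0 g 0; rewrite !addr0 prim01_0 addr0. Qed.

Lemma prim01D c d f g : prim01 c f + prim01 d g = prim01 (c + d) (f + g).
Proof. by have := prim01ZD 1 c d f g; rewrite !scale1r mul1r. Qed.

Lemma CintL2_0 : CintL2 (0 : L2 R) = 0.
Proof. by rewrite /CintL2 -cprim_L2_1 cprim_L2_0. Qed.

(** The functions 1 and x span the kernel of [S^*], and orthogonality to both describes the range of
    S. *)
Definition one01 : L2 R := prim01 1 0.
Definition id01 : L2 R := prim01 0 one01.

Lemma inner_one g : inner one01 g = CintL2 g.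
Proof.
have := inner_parts 1 0 0 g; rewrite (ip0l hL2) addr0 -/one01 => ->.
by rewrite /one01 !val1_prim01 CintL2_0 addr0 rmorph1 !mul1r add0r subr0.
Qed.

Lemma inner_one_one : inner one01 one01 = 1.
Proof.
rewrite inner_one /CintL2.
have s1 := sqint_cintegrable (@sqint_cst R 1).
rewrite (Cintegral_ae (L2_cintegrable _) s1); last first.
  by have := prim01E 1 (0 : L2 R); apply: ae_imp => x /[apply] ->; rewrite cprim_L2_0 addr0.
apply: complex_eqP => /=; rewrite (Rintegral_cst _ measurable_I01) ?mul0r//.
rewrite mul1r.
by have := @lebesgue_measure_itv R `]0, 1[; rewrite /= lte_fin ltr01 oppr0 adde0 => ->.
Qed.

Lemma one_neq0 : one01 <> 0.
Proof. by move=> h; have := inner_one_one; rewrite h (ip0r hL2) => /esym/eqP; rewrite oner_eq0. Qed.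

Lemma val1_id : val1 id01 = 1.
Proof. by rewrite /id01 val1_prim01 add0r -inner_one inner_one_one. Qed.

Lemma inner_id h : inner id01 h = CintL2 h - CintL2 (prim01 0 h).
Proof.
have := inner_parts 0 0 one01 h; rewrite -/id01 val1_id val1_prim01 inner_one rmorph1 mul1r add0r mulr0 subr0.
by move=> <-; rewrite addrK.
Qed.

Definition ort01 : L2 R := id01 - inner one01 id01 *: one01.

Lemma inner_one_ort : inner one01 ort01 = 0.
Proof. by rewrite /ort01 (ipBr hL2) (ipZr hL2) inner_one_one mulr1 subrr. Qed.

Lemma ort_neq0 : inner ort01 ort01 != 0.
Proof.
apply/eqP => /(ip_def hL2)/eqP; rewrite subr_eq0 => /eqP.
by rewrite /one01 prim01Z => /prim01_inj[_]; rewrite -/one01 scaler0; exact: one_neq0.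
Qed.

Lemma affineE a c : a *: one01 + c *: id01 = prim01 a (prim01 c 0).
Proof. by rewrite /id01 /one01 !prim01Z prim01D !mulr1 mulr0 addr0 scaler0 add0r scaler0. Qed.

(** Choosing the two moments of f'' amounts to choosing f(1) and f'(1) once f(0) and f'(0) are
    fixed. The solution is sought in the span of 1 and x, in the orthogonal basis [one01],
    [ort01]. *)
Lemma moments_exist (a c : R[i]) : exists h, inner one01 h = a /\ inner id01 h = c.
Proof.
pose m := inner one01 id01.
pose b := (c - m^*%C * a) / inner ort01 ort01.
exists (a *: one01 + b *: ort01); split.
  by rewrite (ipDr hL2) !(ipZr hL2) inner_one_one inner_one_ort mulr1 mulr0 addr0.
have -> : id01 = ort01 + m *: one01 by rewrite /ort01 subrK.
rewrite (ipDl hL2) (ipZl hL2) !(ipDr hL2) !(ipZr hL2) inner_one_one inner_one_ort.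
have -> : inner ort01 one01 = 0 by rewrite (ipJ hL2) inner_one_ort rmorph0.
rewrite /b divfK ?ort_neq0//; ring.
Qed.

Lemma affine_projection u : exists a c, inner one01 (u - prim01 a (prim01 c 0)) = 0 /\
  inner id01 (u - prim01 a (prim01 c 0)) = 0.
Proof.
pose m := inner one01 id01.
pose b := inner ort01 u / inner ort01 ort01.
exists (inner one01 u - b * m), b.
have -> : prim01 (inner one01 u - b * m) (prim01 b 0) = inner one01 u *: one01 + b *: ort01.
  rewrite -affineE /ort01 scalerBr scalerBl scalerA -addrA; congr (_ + _).
  by rewrite addrC.
have h1 : inner one01 (u - (inner one01 u *: one01 + b *: ort01)) = 0.
  by rewrite (ipBr hL2) (ipDr hL2) !(ipZr hL2) inner_one_one inner_one_ort mulr1 mulr0 addr0 subrr.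
split => //.
have -> : id01 = ort01 + m *: one01 by rewrite /ort01 subrK.
rewrite (ipDl hL2) (ipZl hL2) h1 mulr0 addr0 (ipBr hL2) (ipDr hL2) !(ipZr hL2).
have -> : inner ort01 one01 = 0 by rewrite (ipJ hL2) inner_one_ort rmorph0.
by rewrite mulr0 add0r /b divfK ?ort_neq0// subrr.
Qed.

Lemma wD2_prim01 c d h : wD (wD (prim01 c (prim01 d h))) = h.
Proof. by rewrite !wD_prim01. Qed.

(** The traces at 0 are the two constants of integration. Those at 1 are then the integrals of [h]
    and of its primitive, and by [inner_id] both vanish exactly when [h] is orthogonal to 1 and
    x. *)
Lemma dom_opSP g : dom (opS R) g <->
  exists h, [/\ inner one01 h = 0, inner id01 h = 0 & g = prim01 0 (prim01 0 h)].
Proof.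
split=> [[/H2P[c [d [h ->]]]]|[h [h1 h2 ->]]].
  rewrite wD_prim01 !val0_prim01 !val1_prim01 => c0 + d0; rewrite c0 d0 !add0r => h1 h2.
  by exists h; split => //; [rewrite inner_one|rewrite inner_id h2 h1 subrr].
rewrite inner_one in h1; move: h2; rewrite inner_id h1 sub0r => /eqP.
rewrite oppr_eq0 => /eqP h2.
split; first by apply/H2P; exists 0, 0, h.
- by rewrite val0_prim01.
- by rewrite val1_prim01 add0r.
- by rewrite wD_prim01 val0_prim01.
- by rewrite wD_prim01 val1_prim01 add0r.
Qed.

Lemma dom_opS_H2 g : dom (opS R) g -> H2 g.
Proof. by case. Qed.

Lemma H2_subspace : Defs.subspace (@H2 R).
Proof.
split; first by apply: (H2P _).2; exists 0, 0, (0 : L2 R); rewrite !prim01_0.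
move=> a f g /H2P[c [d [h ->]]] /H2P[c' [d' [h' ->]]]; apply/H2P.
by exists (a * c + c'), (a * d + d'), (a *: h + h'); rewrite !prim01ZD.
Qed.

Lemma wD2_linear a f g : H2 f -> H2 g ->
  wD (wD (a *: f + g)) = a *: wD (wD f) + wD (wD g).
Proof.
move=> /H2P[c [d [h ->]]] /H2P[c' [d' [h' ->]]].
by rewrite -!prim01ZD !wD2_prim01.
Qed.

Lemma CintL2_linear a f g : CintL2 (a *: f + g) = a * CintL2 f + CintL2 g.
Proof. by rewrite /CintL2 -!cprim_L2_1 cprim_L2ZD. Qed.

Lemma traces_linear a f g : H2 f -> H2 g ->
  [/\ val0 (a *: f + g) = a * val0 f + val0 g, val1 (a *: f + g) = a * val1 f + val1 g,
      val0 (wD (a *: f + g)) = a * val0 (wD f) + val0 (wD g) &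
      val1 (wD (a *: f + g)) = a * val1 (wD f) + val1 (wD g)].
Proof.
move=> /H2P[c [d [h ->]]] /H2P[c' [d' [h' ->]]].
rewrite -!prim01ZD !wD_prim01 !val0_prim01 !val1_prim01 !(prim01ZD, CintL2_linear); split => //.
- by rewrite mulrDr addrACA.
- by rewrite mulrDr addrACA.
Qed.

Lemma traces_surjective (a0 a1 b0 b1 : R[i]) : exists f,
  [/\ H2 f, val0 f = a0, val1 f = a1, val0 (wD f) = b0 & val1 (wD f) = b1].
Proof.
(* f'(1) = b0 + <1, h> fixes the first moment. The second is <x, h> = <1, h> minus the integral of
   the primitive of h, and that integral must be a1 - a0 - b0. *)
have [h [h1 h2]] := moments_exist (b1 - b0) (b1 - (a1 - a0)).
have h0 : CintL2 h = b1 - b0 by rewrite -inner_one.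
exists (prim01 a0 (prim01 b0 h)); split.
- by apply/H2P; exists a0, b0, h.
- by rewrite val0_prim01.
- rewrite val1_prim01.
  have : prim01 b0 h = b0 *: one01 + prim01 0 h by rewrite /one01 prim01Z prim01D mulr1 addr0 scaler0 add0r.
  move=> ->; rewrite CintL2_linear -inner_one inner_one_one.
  by have := inner_id h; rewrite h2 h0 => e; rewrite (_ : CintL2 (prim01 0 h) = (b1 - b0) - (b1 - (a1 - a0))); [ring|rewrite e; ring].
- by rewrite wD_prim01 val0_prim01.
- by rewrite wD_prim01 val1_prim01 h0 addrC subrK.
Qed.

Lemma Green f g : H2 f -> H2 g ->
  inner f (wD (wD g)) - inner (wD (wD f)) g =
  ((val1 f)^*%C * val1 (wD g) - (val0 f)^*%C * val0 (wD g)) -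
  ((val1 (wD f))^*%C * val1 g - (val0 (wD f))^*%C * val0 g).
Proof.
move=> /H2P[c [d [h ->]]] /H2P[c' [d' [h' ->]]].
have e1 := inner_parts c d' (prim01 d h) h'.
have e2 := inner_parts d c' h (prim01 d' h').
rewrite !wD2_prim01 !wD_prim01 !val0_prim01 -e1 -e2; ring.
Qed.

(** One integration by parts leaves the boundary terms and <f', f'>, which is real. *)
Lemma Im_inner_wD2 f : H2 f ->
  Im (inner f (- wD (wD f))) =
  Im ((val0 f)^*%C * val0 (wD f) - (val1 f)^*%C * val1 (wD f)).
Proof.
move=> /H2P[c [d [h ->]]].
have e1 := inner_parts c d (prim01 d h) h.
rewrite wD2_prim01 !wD_prim01 !val0_prim01 (ipNr hL2) -(addrK (inner (prim01 d h) (prim01 d h)) (inner _ h)) e1.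
by rewrite [in X in - (_ - X)](ip_self hL2) !ReImE /=; ring.
Qed.

Lemma symmetric_opS g f : dom (opS R) g -> H2 f ->
  inner (wD (wD g)) f = inner g (wD (wD f)).
Proof.
move=> [Hg a0 a1 b0 b1] Hf; have := Green Hg Hf; rewrite a0 a1 b0 b1 !rmorph0 !mul0r !subrr.
by move/eqP; rewrite subr_eq0 => /eqP.
Qed.

(** Let p be the orthogonal projection of u onto the affine functions. Then u - p is orthogonal to 1
    and x, hence is itself g'' for some g in D(S), and so it is orthogonal to u and to p. *)
Lemma ort_rg_opS u : (forall g, dom (opS R) g -> inner (wD (wD g)) u = 0) ->
  exists a c, u = prim01 a (prim01 c 0).
Proof.
move=> h; have [a [c [h1 h2]]] := affine_projection u; exists a, c.
set p := prim01 a (prim01 c 0) in h1 h2 *.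
have : dom (opS R) (prim01 0 (prim01 0 (u - p))) by apply/dom_opSP; exists (u - p).
move/h; rewrite wD2_prim01 => up.
apply/eqP; rewrite -subr_eq0; apply/eqP; apply: (ip_def hL2).
rewrite (ipBr hL2) up /p -affineE (ipDr hL2) !(ipZr hL2).
rewrite (ipJ hL2 one01) (ipJ hL2 id01) affineE h1 h2 !rmorph0 !mulr0 addr0 subrr//.
Qed.

(** Write h = u''. By symmetry u is orthogonal to the range of S, so u is affine and its second
    derivative vanishes. *)
Lemma ort_dom_opS h : (forall g, dom (opS R) g -> inner g h = 0) -> h = 0.
Proof.
move=> H; have Hu : H2 (prim01 0 (prim01 0 h)) by apply/H2P; exists 0, 0, h.
have [|a [c e]] := @ort_rg_opS (prim01 0 (prim01 0 h)).
  by move=> g Dg; rewrite symmetric_opS// wD2_prim01 H.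
by move: e => /prim01_inj[_ /prim01_inj[]].
Qed.

Lemma dom_opS_subspace : Defs.subspace (dom (opS R)).
Proof.
split.
  by apply/dom_opSP; exists 0; rewrite !(ip0r hL2) !prim01_0; split.
move=> a f g /dom_opSP[h [h1 h2 ->]] /dom_opSP[k [k1 k2 ->]]; apply/dom_opSP.
exists (a *: h + k); rewrite -!prim01ZD mulr0 addr0; split => //.
  by rewrite (ipZDr hL2) h1 k1 mulr0 addr0.
by rewrite (ipZDr hL2) h2 k2 mulr0 addr0.
Qed.

(** The vector [k] that represents g |-> <g, f> lies in the closure of D(S), and f - k is orthogonal
    to D(S), hence 0. *)
Lemma dom_opS_dense f (e : R) : 0 < e -> exists2 g, dom (opS R) g & nrm (@inner R) (f - g) < e.
Proof.
move=> e0.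
have [| |k [k1 k2]] := @riesz_factor R (L2 R) (@inner R) hL2 (L2 R) (dom (opS R)) id
    (fun g => inner g f) (sqn (@inner R) f) dom_opS_subspace (fun _ _ _ _ _ => erefl) _ (sqn_ge0 hL2 f).
- by move=> a g h _ _; rewrite (ipDl hL2) (ipZl hL2).
- by move=> g _; rewrite mulrC; exact: (ip_CauchySchwarz hL2).
have fk : f = k.
  apply/eqP; rewrite -subr_eq0; apply/eqP; apply: ort_dom_opS => g Dg.
  by rewrite (ipBr hL2) (k1 _ Dg) subrr.
by have [g Dg hg] := k2 _ e0; exists g => //; rewrite (nrmBC hL2) fk.
Qed.

(** Riesz gives h with <g'', f> = <g, h> for g in D(S). Subtracting from f the double primitive of h
    leaves a vector orthogonal to the range of S, that is, an affine function. *)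
Lemma adjoint_opS f (C : R) : 0 <= C ->
  (forall g, dom (opS R) g -> csq (inner (wD (wD g)) f) <= C * sqn (@inner R) g) -> H2 f.
Proof.
move=> C0 hC.
have [| |h [h1 _]] := @riesz_factor R (L2 R) (@inner R) hL2 (L2 R) (dom (opS R)) id
    (fun g => inner (wD (wD g)) f) C dom_opS_subspace (fun _ _ _ _ _ => erefl) _ C0.
- by move=> a g h /dom_opS_H2 Hg /dom_opS_H2 Hh; rewrite wD2_linear// (ipDl hL2) (ipZl hL2).
- exact: hC.
have Hu : H2 (prim01 0 (prim01 0 h)) by apply/H2P; exists 0, 0, h.
have [|a [c e]] := @ort_rg_opS (f - prim01 0 (prim01 0 h)).
  by move=> g Dg; rewrite (ipBr hL2) h1// (symmetric_opS Dg Hu) wD2_prim01 subrr.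
rewrite -(subrK (prim01 0 (prim01 0 h)) f) e prim01D prim01D; apply/H2P.
by exists (a + 0), (c + 0), (0 + h).
Qed.

End sobolev.

(** * Dissipative extensions *)

Section dissipative_extensions.
Variables (R : realType) (V : L2 R -> L2 R).
Hypothesis V_bounded : bounded_op V.
Hypothesis V_ge0 : nonneg_op V.
Implicit Types (f g h u v : L2 R) (a c d : R[i]).
Let hL2 := L2_hilbert R.
Local Notation sqn := (sqn (@inner R)).
Local Notation nrm := (nrm (@inner R)).
Local Notation T := (sqrt_op V).
Local Notation D0 := (dom (opS R)).

Lemma bounded_op_lin : linear_map V.
Proof. by case: V_bounded => Vl _ a f g; exact: Vl. Qed.

Lemma sqrt_opP : [/\ bounded_op T, nonneg_op T & T \o T = V].
Proof.
rewrite /sqrt_op; case: xgetP => [S _ //|].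
have [_ [M VM]] := V_bounded.
have [S [Sl [N SN] S0 SS]] := hilbert_sqrt hL2 bounded_op_lin VM V_ge0.
move=> /(_ S); case; split => //; split; last by exists N.
by move=> a f g _ _; exact: Sl.
Qed.

Lemma sqrt_op_lin : linear_map T.
Proof. by have [[Tl _] _ _] := sqrt_opP; move=> a f g; exact: Tl. Qed.

Lemma sqrt_op_sqr f : T (T f) = V f.
Proof. by have [_ _ h] := sqrt_opP; exact: (congr1 (@^~ f) h). Qed.

Lemma sqrt_op_sym f g : inner f (T g) = inner (T f) g.
Proof. by have [_ T0 _] := sqrt_opP; exact: (nonneg_symmetric hL2 _ _ sqrt_op_lin T0). Qed.

Lemma inner_sqrt_op f g : inner f (V g) = inner (T f) (T g).
Proof. by rewrite -sqrt_op_sqr sqrt_op_sym. Qed.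

Lemma sqrt_op_bounded : exists2 M, 0 <= M & forall f, sqn (T f) <= M * sqn f.
Proof.
have [[_ [M TM]] _ _] := sqrt_opP; exists (M ^+ 2) => [|f]; first exact: sqr_ge0.
rewrite -!(sqr_nrm hL2) -exprMn.
have h := TM f; rewrite ler_pXn2r ?nnegrE ?nrm_ge0//.
exact: le_trans (nrm_ge0 _ _) h.
Qed.

Lemma ker_VE f : V f = 0 <-> T f = 0.
Proof.
split=> [Vf|Tf]; last by rewrite -sqrt_op_sqr Tf (linear_map0 sqrt_op_lin).
by apply: (ip_def hL2); rewrite -inner_sqrt_op Vf (ip0r hL2).
Qed.

Lemma ker_perp_sub a f g : ker_perp V f -> ker_perp V g -> ker_perp V (a *: f + g).
Proof. by move=> hf hg k Vk; rewrite (ipZDr hL2) hf// hg// mulr0 addr0. Qed.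

Lemma ker_perp_inj f g : ker_perp V f -> ker_perp V g -> T f = T g -> f = g.
Proof.
move=> hf hg Tfg; apply/eqP; rewrite -subr_eq0; apply/eqP; apply: (ip_def hL2).
have Tz : T (f - g) = 0 by rewrite (linear_mapB _ _ sqrt_op_lin) Tfg subrr.
have := ker_perp_sub (-1) hg hf; rewrite scaleN1r addrC; apply.
exact/ker_VE.
Qed.

(** A Douglas-type factorization: the bound says that g |-> <g, f> factors through V^(1/2), and its
    Riesz vector [k] satisfies <g, f> = <T g, k> = <g, T k> on the dense D(S). *)
Lemma sqrt_op_factor f (C : R) : 0 <= C ->
  (forall g, D0 g -> csq (inner g f) <= C * sqn (T g)) ->
  exists k, [/\ ker_perp V k, T k = f &
    forall e, 0 < e -> exists2 g, D0 g & nrm (T g - k) < e].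
Proof.
move=> C0 hC.
have [| |k [k1 k2]] := @riesz_factor R (L2 R) (@inner R) hL2 (L2 R) D0 T
    (fun g => inner g f) C (dom_opS_subspace R) (fun a u v _ _ => sqrt_op_lin a u v) _ C0.
- by move=> a g h _ _; rewrite (ipDl hL2) (ipZl hL2).
- exact: hC.
exists k; split => //.
(* As n is orthogonal to every T g, <n, k> = - <n, T g - k>, which is arbitrarily small. *)
- move=> n /ker_VE Tn; apply: csq_eq0; apply/eqP; rewrite eq_le csq_ge0 andbT.
  apply/ler_addgt0Pr => e e0; rewrite add0r.
  have e2 : 0 < e / (sqn n + 1) by rewrite divr_gt0// ltr_wpDl ?(sqn_ge0 hL2).
  have e1 : 0 < Num.sqrt (e / (sqn n + 1)) by rewrite sqrtr_gt0.
  have [g Dg] := k2 _ e1; rewrite (nrm_lt hL2)// sqr_sqrtr ?(ltW e2)//.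
  rewrite ltr_pdivlMr; last by rewrite ltr_wpDl ?(sqn_ge0 hL2).
  move=> h.
  have -> : inner n k = - inner n (T g - k).
    by rewrite (ipBr hL2) sqrt_op_sym Tn (ip0l hL2) sub0r opprK.
  have -> : csq (- inner n (T g - k)) = csq (inner n (T g - k)).
    by rewrite /csq !ReImE !sqrrN.
  apply: le_trans (ip_CauchySchwarz hL2 _ _) _.
  have := sqn_ge0 hL2 (T g - k); nra.
- apply/eqP; rewrite -subr_eq0; apply/eqP; apply: ort_dom_opS => g Dg.
  by rewrite (ipBr hL2) sqrt_op_sym -k1// subrr.
Qed.

(** Factoring T k anew gives a vector in the closure of T(D(S)) with the same image under T; it
    equals [k] because T is injective on the orthogonal of ker V. *)
Lemma ker_perp_approx k e : ker_perp V k -> 0 < e -> exists2 g, D0 g & nrm (T g - k) < e.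
Proof.
move=> hk e0; have [|k' [hk' Tk' h]] := @sqrt_op_factor (T k) (sqn k) (sqn_ge0 hL2 k).
  by move=> g _; rewrite sqrt_op_sym mulrC; exact: (ip_CauchySchwarz hL2).
by rewrite (ker_perp_inj hk hk' (esym Tk')); exact: h.
Qed.

Lemma inv_sqrt_opE k : ker_perp V k -> inv_sqrt_op V (T k) = k.
Proof.
move=> hk; rewrite /inv_sqrt_op; case: xgetP => [h _ [hh Th]|/(_ k)].
  exact: ker_perp_inj.
by case.
Qed.

Lemma range_sqrt_op f : range T f -> exists2 k, ker_perp V k & T k = f.
Proof.
move=> [h _ <-]; have [|k [hk Tk _]] := @sqrt_op_factor (T h) (sqn h) (sqn_ge0 hL2 h).
  by move=> g _; rewrite sqrt_op_sym mulrC; exact: (ip_CauchySchwarz hL2).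
by exists k.
Qed.

Lemma inv_sqrt_op_linear a f g : range T f -> range T g ->
  inv_sqrt_op V (a *: f + g) = a *: inv_sqrt_op V f + inv_sqrt_op V g.
Proof.
move=> /range_sqrt_op[k hk <-] /range_sqrt_op[k' hk' <-].
by rewrite -sqrt_op_lin !inv_sqrt_opE//; exact: ker_perp_sub.
Qed.

(** The form q, equal to Im <f, S^* f> on H^2. *)
Definition bform f : R :=
  Im ((val0 f)^*%C * val0 (wD f) - (val1 f)^*%C * val1 (wD f)).

Lemma Im_numerical_range f k : H2 f ->
  Im (inner f (- wD (wD f) + 'i%C *: V f + T k)) =
  bform f + sqn (T f - (0 +i* 2^-1) *: k) - sqn k / 4.
Proof.
move=> Hf; rewrite !(ipDr hL2) (ipZr hL2) (sqrt_op_sym f k) inner_sqrt_op (ip_self hL2) !cImD Im_inner_wD2//.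
rewrite -/(bform f) (sqnB hL2) (sqnZ hL2) (ipZr hL2) !ReImE /csq /=.
by field.
Qed.

Lemma bform_dom_opS f g : D0 g -> H2 f -> bform (g + f) = bform f.
Proof.
move=> Dg Hf; have Hg := dom_opS_H2 Dg; rewrite /bform.
have [e1 e2 e3 e4] := traces_linear 1 Hg Hf; rewrite !scale1r !mul1r in e1 e2 e3 e4.
by rewrite e1 e2 e3 e4; case: Dg => _ -> -> -> ->; rewrite !add0r.
Qed.

Lemma bform_ge f k : H2 f -> ker_perp V k ->
  (forall g, D0 g ->
    0 <= Im (inner (g + f) (- wD (wD (g + f)) + 'i%C *: V (g + f) + T k))) ->
  sqn k / 4 <= bform f.
Proof.
move=> Hf hk h; rewrite -subr_ge0; apply/ler_addgt0Pr => e e0.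
have s0 : 0 < Num.sqrt e / 2 by rewrite divr_gt0// sqrtr_gt0.
have hik : ker_perp V ((0 +i* 2^-1) *: k).
  by rewrite -[_ *: k]addr0; apply: ker_perp_sub => // n _; rewrite (ip0r hL2).
(* [g1] brings T g1 close to (i/2) k and [g2] is close to f, so for g = g1 - g2 the vector T(g + f)
   = T g1 + T(f - g2) is close to (i/2) k. The square in [Im_numerical_range] is then at most
   [e]. *)
have [g1 Dg1 h1] := ker_perp_approx hik s0.
have [M M0 TM] := sqrt_op_bounded.
have s1 : 0 < Num.sqrt e / (2 * (M + 1)) by rewrite divr_gt0 ?sqrtr_gt0// mulr_gt0// ltr_wpDl.
have [g2 Dg2 h2] := dom_opS_dense f s1.
have Dg : D0 (g1 - g2).
  by have [_ l] := dom_opS_subspace R; have := l (-1) _ _ Dg2 Dg1; rewrite scaleN1r addrC.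
have Hg := dom_opS_H2 Dg.
have HD : H2 ((g1 - g2) + f) by have [_ l] := H2_subspace R; have := l 1 _ _ Hg Hf; rewrite scale1r.
have := h _ Dg; rewrite (Im_numerical_range _ HD) bform_dom_opS//.
have small : sqn (T (g1 - g2 + f) - (0 +i* 2^-1) *: k) <= e.
  suff hn : nrm (T (g1 - g2 + f) - (0 +i* 2^-1) *: k) <= Num.sqrt e.
    rewrite -(sqr_nrm hL2) -[leRHS](sqr_sqrtr (ltW e0)).
    by apply: lerXn2r; rewrite ?nnegrE ?nrm_ge0 ?sqrtr_ge0.
  have -> : T (g1 - g2 + f) - (0 +i* 2^-1) *: k = (T g1 - (0 +i* 2^-1) *: k) + T (f - g2).
    by rewrite (linear_mapD _ _ sqrt_op_lin) !(linear_mapB _ _ sqrt_op_lin); rewrite addrAC -!addrA; congr (_ + _); rewrite addrCA; congr (_ + _); rewrite addrC.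
  apply: le_trans (nrmD hL2 _ _) _.
  have h3 : nrm (T (f - g2)) <= Num.sqrt e / 2.
    have : nrm (T (f - g2)) <= (M + 1) * nrm (f - g2).
      rewrite -ler_sqr ?nnegrE ?nrm_ge0 ?mulr_ge0 ?addr_ge0 ?nrm_ge0// exprMn !(sqr_nrm hL2).
      apply: le_trans (TM _) _; apply: ler_wpM2r; first exact: sqn_ge0.
      by nra.
    move=> h4; apply: le_trans h4 _.
    have -> : Num.sqrt e / 2 = (M + 1) * (Num.sqrt e / (2 * (M + 1))) by field; apply/eqP; lra.
    by rewrite ler_wpM2l ?addr_ge0// ltW.
  by move: h1 h3; lra.
lra.
Qed.

End dissipative_extensions.

Lemma csqD_le (R : rcfType) (z w : R[i]) : csq (z + w) <= 2 * csq z + 2 * csq w.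
Proof.
rewrite /csq !ReImE; have := sqr_ge0 (Re z - Re w); have := sqr_ge0 (Im z - Im w); nra.
Qed.

Lemma lin_subM (K : comNzRingType) (a i x y x' y' : K) :
  a * x + y - i * (a * x' + y') = a * (x - i * x') + (y - i * y').
Proof. by ring. Qed.

Lemma lin_addM (K : comNzRingType) (a i x y x' y' : K) :
  a * x + y + i * (a * x' + y') = a * (x + i * x') + (y + i * y').
Proof. by ring. Qed.

Lemma seal_exists (A : Type) (x : A) : exists y, y = x.
Proof. by exists x. Qed.

(* Keeps unification from unfolding boundary values. *)
Definition seal (A : Type) (x : A) : A := projT1 (cid (seal_exists x)).

Lemma sealE (A : Type) (x : A) : seal x = x.
Proof. exact: (projT2 (cid (seal_exists x))). Qed.

(** * The boundary coordinates delta and eta *)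

Section boundary_map.
Variable R : realType.
Implicit Types (f g u v : L2 R) (a b c : R[i]).
Local Notation D0 := (dom (opS R)).

Definition delta0 : L2 R -> R[i] := seal (fun f => val0 f - 'i%C * val0 (wD f)).
Definition delta1 : L2 R -> R[i] := seal (fun f => val1 f + 'i%C * val1 (wD f)).
Definition eta0 : L2 R -> R[i] := seal (fun f => val0 f + 'i%C * val0 (wD f)).
Definition eta1 : L2 R -> R[i] := seal (fun f => val1 f - 'i%C * val1 (wD f)).

Lemma delta0E f : delta0 f = val0 f - 'i%C * val0 (wD f).
Proof. by rewrite /delta0 sealE. Qed.
Lemma delta1E f : delta1 f = val1 f + 'i%C * val1 (wD f).
Proof. by rewrite /delta1 sealE. Qed.
Lemma eta0E f : eta0 f = val0 f + 'i%C * val0 (wD f).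
Proof. by rewrite /eta0 sealE. Qed.
Lemma eta1E f : eta1 f = val1 f - 'i%C * val1 (wD f).
Proof. by rewrite /eta1 sealE. Qed.

Lemma bform_delta f :
  bform f = (csq (delta0 f) + csq (delta1 f) - (csq (eta0 f) + csq (eta1 f))) / 4.
Proof. by rewrite /bform /csq delta0E delta1E eta0E eta1E !ReImE /=; field. Qed.

Lemma delta_eta_linear a f g : H2 f -> H2 g ->
  [/\ delta0 (a *: f + g) = a * delta0 f + delta0 g,
      delta1 (a *: f + g) = a * delta1 f + delta1 g,
      eta0 (a *: f + g) = a * eta0 f + eta0 g &
      eta1 (a *: f + g) = a * eta1 f + eta1 g].
Proof.
move=> Hf Hg; rewrite !(delta0E, delta1E, eta0E, eta1E).
have [-> -> -> ->] := traces_linear a Hf Hg.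
by split; [exact: lin_subM|exact: lin_addM|exact: lin_addM|exact: lin_subM].
Qed.

Lemma delta_eta_dom_opS f : D0 f -> [/\ delta0 f = 0, delta1 f = 0, eta0 f = 0 & eta1 f = 0].
Proof.
case=> _ h1 h2 h3 h4; rewrite delta0E delta1E eta0E eta1E h1 h2 h3 h4.
by rewrite !mulr0 !addr0 subrr.
Qed.

(** With delta = 0 one has 4 q = - |eta|^2, so q >= 0 forces eta = 0, and delta and eta together
    determine the four traces. *)
Lemma delta_eq0_dom_opS f : H2 f -> 0 <= bform f -> delta0 f = 0 -> delta1 f = 0 -> D0 f.
Proof.
move=> Hf; rewrite bform_delta => + d0 d1; rewrite d0 d1.
have -> : csq (0 : R[i]) = 0 by rewrite /csq /= expr0n addr0.
rewrite addr0 sub0r => h.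
have c0 := csq_ge0 (eta0 f); have c1 := csq_ge0 (eta1 f).
have e0 : eta0 f = 0 by apply: csq_eq0; lra.
have e1 : eta1 f = 0 by apply: csq_eq0; lra.
have i2 : 2 * 'i%C != 0 :> R[i].
  by rewrite mulf_neq0// ?pnatr_eq0// eq_complex /= oner_eq0 andbF.
have v0 : val0 f = 0.
  have : 2 * val0 f = delta0 f + eta0 f by rewrite delta0E eta0E; ring.
  by rewrite d0 e0 addr0 => /eqP; rewrite mulf_eq0 pnatr_eq0 => /eqP.
have v1 : val1 f = 0.
  have : 2 * val1 f = delta1 f + eta1 f by rewrite delta1E eta1E; ring.
  by rewrite d1 e1 addr0 => /eqP; rewrite mulf_eq0 pnatr_eq0 => /eqP.
split => //.
  have : (2 * 'i%C) * val0 (wD f) = eta0 f - delta0 f by rewrite delta0E eta0E; ring.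
  by rewrite d0 e0 subr0 => /eqP; rewrite mulf_eq0 (negbTE i2) => /eqP.
have : (2 * 'i%C) * val1 (wD f) = delta1 f - eta1 f by rewrite delta1E eta1E; ring.
by rewrite d1 e1 subr0 => /eqP; rewrite mulf_eq0 (negbTE i2) => /eqP.
Qed.

Lemma delta_eta_surjective (d0 d1 : R[i]) : exists w,
  [/\ H2 w, delta0 w = d0, delta1 w = d1, eta0 w = 0 & eta1 w = 0].
Proof.
(* The derivatives are chosen to cancel in eta, so each half contributes equally to delta. *)
have [w [Hw h1 h2 h3 h4]] := traces_surjective (d0 / 2) (d1 / 2) ('i%C * d0 / 2) (- 'i%C * d1 / 2).
have ii : 'i%C * 'i%C = -1 :> R[i] by rewrite -expr2 sqr_i.
exists w; rewrite delta0E delta1E eta0E eta1E h1 h2 h3 h4; split => //.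
- by rewrite !mulrA ii; field.
- by rewrite mulNr mulNr mulrN !mulrA ii; field.
- by rewrite !mulrA ii; field.
- by rewrite mulNr mulNr mulrN !mulrA ii; field.
Qed.

(** Nonzero exactly when the vectors delta u and delta v form a basis of C^2; it replaces any count
    of dimensions modulo D(S). *)
Definition delta_det u v : R[i] := delta0 u * delta1 v - delta1 u * delta0 v.

Lemma lin2_H2 a b u v : H2 u -> H2 v -> H2 (a *: u + b *: v).
Proof.
have [h0 hl] := H2_subspace R => Hu Hv.
by rewrite -[b *: v]addr0; exact: (hl _ _ _ Hu (hl _ _ _ Hv h0)).
Qed.

Lemma delta_lin2 a b u v : H2 u -> H2 v ->
  delta0 (a *: u + b *: v) = a * delta0 u + b * delta0 v /\
  delta1 (a *: u + b *: v) = a * delta1 u + b * delta1 v.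
Proof.
move=> Hu Hv; have [h0 hl] := H2_subspace R.
have Hbv : H2 (b *: v) by rewrite -[_ *: _]addr0; exact: hl.
have [-> -> _ _] := delta_eta_linear a Hu Hbv.
have [] := delta_eta_linear b Hv h0; rewrite addr0 => -> -> _ _.
have [-> -> _ _] := delta_eta_dom_opS (dom_opS_subspace R).1.
by rewrite !addr0.
Qed.

Lemma delta_det_indep a b u v : H2 u -> H2 v -> delta_det u v != 0 ->
  D0 (a *: u + b *: v) -> a = 0 /\ b = 0.
Proof.
move=> Hu Hv det0 /delta_eta_dom_opS[e0 e1 _ _].
have [f0 f1] := delta_lin2 a b Hu Hv; rewrite e0 in f0; rewrite e1 in f1.
split; apply/eqP.
  have : a * delta_det u v = 0.
    transitivity ((a * delta0 u + b * delta0 v) * delta1 v - (a * delta1 u + b * delta1 v) * delta0 v).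
      by rewrite /delta_det; ring.
    by rewrite -f0 -f1 !mul0r subrr.
  by move/eqP; rewrite mulf_eq0 (negbTE det0) orbF.
have : b * delta_det u v = 0.
  transitivity ((a * delta1 u + b * delta1 v) * delta0 u - (a * delta0 u + b * delta0 v) * delta1 u).
    by rewrite /delta_det; ring.
  by rewrite -f0 -f1 !mul0r subrr.
by move/eqP; rewrite mulf_eq0 (negbTE det0) orbF.
Qed.

Lemma delta_det_span f u v : H2 f -> H2 u -> H2 v -> delta_det u v != 0 ->
  (forall a b, 0 <= bform (f - (a *: u + b *: v))) ->
  exists a b, D0 (f - (a *: u + b *: v)).
Proof.
move=> Hf Hu Hv det0 pos.
(* Cramer's rule for delta f = a delta u + b delta v. *)
pose a := (delta0 f * delta1 v - delta1 f * delta0 v) / delta_det u v.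
pose b := (delta0 u * delta1 f - delta1 u * delta0 f) / delta_det u v.
exists a, b; have Hw := lin2_H2 a b Hu Hv.
have E : f - (a *: u + b *: v) = (-1) *: (a *: u + b *: v) + f by rewrite scaleN1r addrC.
have [e0 e1 _ _] := delta_eta_linear (-1) Hw Hf.
have [f0 f1] := delta_lin2 a b Hu Hv.
have det1 : delta0 u * delta1 v - delta1 u * delta0 v != 0 by exact: det0.
apply: delta_eq0_dom_opS => //.
- by have [_ hl] := H2_subspace R; rewrite E; exact: hl.
- by rewrite E e0 f0 /a /b /delta_det; field.
- by rewrite E e1 f1 /a /b /delta_det; field.
Qed.

Lemma delta_det0_dependent u v : H2 u -> H2 v -> delta_det u v = 0 ->
  (forall a b, 0 <= bform (a *: u + b *: v)) ->
  exists a b, D0 (a *: u + b *: v) /\ ~ (a = 0 /\ b = 0).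
Proof.
move=> Hu Hv det0 pos.
have use a b : a * delta0 u + b * delta0 v = 0 -> a * delta1 u + b * delta1 v = 0 ->
    D0 (a *: u + b *: v).
  move=> h0 h1; have [f0 f1] := delta_lin2 a b Hu Hv.
  by apply: delta_eq0_dom_opS; rewrite ?f0 ?f1//; exact: lin2_H2.
have [[z1 z2]|nz] := pselect (delta0 u = 0 /\ delta1 u = 0).
  exists 1, 0; split; last by case=> /eqP; rewrite oner_eq0.
  by apply: use; rewrite ?z1 ?z2 !mulr0 mul0r addr0.
(* The coefficients of a dependence are read off one coordinate of delta, chosen where delta u is
   nonzero so that they are not both 0. *)
have [z1|/eqP z1] := eqVneq (delta0 u) 0.
  exists (delta1 v), (- delta1 u); split.
    by apply: use; [have := det0; rewrite /delta_det => <-; ring|ring].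
  by case=> _ /eqP; rewrite oppr_eq0 => /eqP z2; apply: nz.
exists (delta0 v), (- delta0 u); split.
  by apply: use; [ring|rewrite -[RHS]oppr0 -[in RHS]det0 /delta_det; ring].
by case=> _ /eqP; rewrite oppr_eq0 => /eqP.
Qed.

End boundary_map.

(** * Quadratic forms of two-by-two matrices *)

Lemma qform2E (R : realType) (N : 'M[R[i]]_2) (x : 'cV[R[i]]_2) :
  (ctr x *m N *m x) ord0 ord0 =
  (x ord0 ord0)^*%C * (N ord0 ord0 * x ord0 ord0 + N ord0 ord_max * x ord_max ord0) +
  (x ord_max ord0)^*%C * (N ord_max ord0 * x ord0 ord0 + N ord_max ord_max * x ord_max ord0).
Proof.
have E : lift ord0 (ord0 : 'I_1) = ord_max :> 'I_2 by exact/val_inj.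
rewrite !mxE !big_ord_recl !big_ord0 !mxE !big_ord_recl !big_ord0 !mxE !E !addr0.
by rewrite !mulrDr !mulrDl !mulrA addrACA.
Qed.

Lemma ctr_mulE (R : realType) (A B : 'M[R[i]]_2) (i j : 'I_2) :
  (ctr A *m B) i j = (A ord0 i)^*%C * B ord0 j + (A ord_max i)^*%C * B ord_max j.
Proof.
have E : lift ord0 (ord0 : 'I_1) = ord_max :> 'I_2 by exact/val_inj.
by rewrite !mxE !big_ord_recl big_ord0 !mxE E addr0.
Qed.

Lemma mx2E (K : Type) (a b c d : K) : [/\ mx2 a b c d ord0 ord0 = a, mx2 a b c d ord0 ord_max = b,
  mx2 a b c d ord_max ord0 = c & mx2 a b c d ord_max ord_max = d].
Proof. by rewrite !mxE. Qed.

(** The primed variables stand for complex conjugates and [k] for 1 / (2 i); treating them as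
    independent makes this a polynomial identity. *)
Lemma sesquilinear2 (K : comNzRingType) (a b a' b' u0 u1 v0 v1 u0' u1' v0' v1' y0 y1 z0 z1 y0' y1' z0' z1' k : K) :
  a' * (k * (u0' * y0 + u1' * y1 - (u0 * y0' + u1 * y1')) * a +
        k * (u0' * z0 + u1' * z1 - (v0 * y0' + v1 * y1')) * b) +
  b' * (k * (v0' * y0 + v1' * y1 - (u0 * z0' + u1 * z1')) * a +
        k * (v0' * z0 + v1' * z1 - (v0 * z0' + v1 * z1')) * b) =
  k * ((a' * u0' + b' * v0') * (a * y0 + b * z0) + (a' * u1' + b' * v1') * (a * y1 + b * z1) -
       ((a * u0 + b * v0) * (a' * y0' + b' * z0') + (a * u1 + b * v1) * (a' * y1' + b' * z1'))).
Proof. by ring. Qed.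

Lemma scaled_form2 (K : comNzRingType) (a b a' b' k e1 e2 e3 e4 : K) :
  a' * (k * e1 * a + k * e2 * b) + b' * (k * e3 * a + k * e4 * b) =
  k * (a' * (a * e1) + a' * (b * e2) + (b' * (a * e3) + b' * (b * e4))).
Proof. by ring. Qed.

(** If w is the value of the form of M at x, then the form of its adjoint has the value w^* there,
    and (w - w^* ) / (2 i) = Im w. For M a product of an adjoint with a matrix, w is an inner
    product in C^2. *)
Lemma Im_mx_qform (R : realType) (u0 u1 v0 v1 y0 y1 z0 z1 : R[i]) (x : 'cV[R[i]]_2) :
  let a := x ord0 ord0 in let b := x ord_max ord0 in
  (ctr x *m Im_mx (ctr (mx2 u0 v0 u1 v1) *m mx2 y0 z0 y1 z1) *m x) ord0 ord0 =
  (Im ((a * u0 + b * v0)^*%C * (a * y0 + b * z0) + (a * u1 + b * v1)^*%C * (a * y1 + b * z1)))%:C.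
Proof.
move=> a b.
have [p1 p2 p3 p4] := mx2E u0 v0 u1 v1; have [q1 q2 q3 q4] := mx2E y0 z0 y1 z1.
have ME (M : 'M[R[i]]_2) i j : Im_mx M i j = (2 * 'i%C)^-1 * (M i j - (M j i)^*%C) by rewrite !mxE.
have JJ (w z : R[i]) : (w^*%C * z)^*%C = w * z^*%C.
  by apply: complex_eqP; rewrite !ReImE; ring.
have JD (w z : R[i]) : (w + z)^*%C = w^*%C + z^*%C.
  by apply: complex_eqP; rewrite !ReImE; ring.
have JM (w z : R[i]) : (w * z)^*%C = w^*%C * z^*%C.
  by apply: complex_eqP; rewrite !ReImE; ring.
rewrite qform2E !ME !ctr_mulE p1 p2 p3 p4 q1 q2 q3 q4 -/a -/b !JD !JJ.
rewrite (sesquilinear2 a b a^*%C b^*%C u0 u1 v0 v1 u0^*%C u1^*%C v0^*%C v1^*%C y0 y1 z0 z1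
  y0^*%C y1^*%C z0^*%C z1^*%C).
rewrite -!JM -!JD.
set s := a * u0 + b * v0; set t := a * y0 + b * z0.
set s' := a * u1 + b * v1; set t' := a * y1 + b * z1.
have -> : s * t^*%C + s' * t'^*%C = (s^*%C * t + s'^*%C * t')^*%C.
  by move: s t s' t' => p q p' q'; apply: complex_eqP; rewrite !ReImE; ring.
move: (s^*%C * t + s'^*%C * t') => w.
have -> : (2 * 'i%C)^-1 = 0 +i* (- 2^-1) :> R[i].
  apply: (@mulfI _ (2 * 'i%C)); first by rewrite mulf_neq0// ?pnatr_eq0// eq_complex /= oner_eq0 andbF.
  rewrite divff; last by rewrite mulf_neq0// ?pnatr_eq0// eq_complex /= oner_eq0 andbF.
  by apply: complex_eqP; rewrite !ReImE /=; field.
by apply: complex_eqP; rewrite !ReImE /=; field.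
Qed.

(** * Structure of dissipative extensions, and maximality of A_{W,L} *)

Section main.
Variables (R : realType) (V : L2 R -> L2 R).
Hypothesis V_bounded : bounded_op V.
Hypothesis V_ge0 : nonneg_op V.
Implicit Types (f g h u v w : L2 R) (a b c d : R[i]).
Let hL2 := L2_hilbert R.
Local Notation sqn := (sqn (@inner R)).
Local Notation nrm := (nrm (@inner R)).
Local Notation T := (sqrt_op V).
Local Notation D0 := (dom (opS R)).

Definition Aop f : L2 R := - wD (wD f) + 'i%C *: V f.

Lemma Aop_linear a f g : H2 f -> H2 g -> Aop (a *: f + g) = a *: Aop f + Aop g.
Proof.
move=> Hf Hg; rewrite /Aop wD2_linear// (bounded_op_lin V_bounded) scalerDr scalerA.
by rewrite opprD -scalerN addrACA scalerDr scalerA [a * _]mulrC.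
Qed.

Lemma inner_sqrt_opl f g : inner (V f) g = inner (T f) (T g).
Proof. by rewrite (ipJ hL2) (inner_sqrt_op V_bounded V_ge0) -(ipJ hL2). Qed.

Lemma dissipative_form_bound (B : operator R) : dissipative B -> op_ext B (opA V) ->
  forall f g, dom B f -> D0 g ->
  csq (inner g (B f) - inner (Aop g) f) <= 4 * (sqn (T g) * Im (inner f (B f))).
Proof.
move=> [[Bsub Blin] _ B0] [DB BE] f g Bf Dg.
(* s = 1 / (2 i) makes [b] Hermitian with diagonal Im <x, B x>. Its squared modulus 1/4 is the
   origin of the factor 4 in the statement. *)
pose s : R[i] := 0 +i* (- 2^-1).
pose b x y := s * (inner x (B y) - inner (B x) y).
have bself x : Re (b x x) = Im (inner x (B x)).
  by rewrite /b (ipJ hL2 x (B x)) !ReImE /=; field.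
have CS := @form_CauchySchwarz R (L2 R) (dom B) b Bsub.
have {}CS : csq (b g f) <= Re (b g g) * Re (b f f).
  apply: CS => //; last exact: DB.
  - move=> a x y z Dx Dy Dz; rewrite /b Blin// !(ipZDr hL2).
    by move: (inner x (B y)) (inner x (B z)) (inner (B x) y) (inner (B x) z) => p q r t; ring.
  - move=> x y _ _; rewrite /b (ipJ hL2 x (B y)) (ipJ hL2 (B x) y).
    by apply: complex_eqP; rewrite !ReImE /=; ring.
  - by move=> x Dx; rewrite bself; exact: B0.
have BgE : B g = Aop g by exact: BE.
have bgg : Re (b g g) = sqn (T g).
  rewrite bself BgE.
  have := Im_numerical_range V_bounded V_ge0 0 (dom_opS_H2 Dg).
  rewrite (linear_map0 (sqrt_op_lin V_bounded V_ge0)) addr0 scaler0 subr0 (sqn0 hL2) mul0r subr0 => ->.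
  by have [_ h1 h2 h3 h4] := Dg; rewrite /bform h1 h2 h3 h4 !mulr0 subrr add0r.
rewrite bgg bself /b csqM BgE in CS.
have -> : csq (inner g (B f) - inner (Aop g) f) = 4 * (csq s * csq (inner g (B f) - inner (Aop g) f)).
  by rewrite {2}/csq /s /=; move: (csq _) => z; field.
by rewrite ler_pM2l.
Qed.

Lemma dissipative_extension (B : operator R) : dissipative B -> op_ext B (opA V) ->
  forall f, dom B f -> H2 f /\ exists k, [/\ ker_perp V k, B f = Aop f + T k & sqn k / 4 <= bform f].
Proof.
move=> dB eB f Bf.
have FB := dissipative_form_bound dB eB Bf.
have [[Bsub Blin] _ B0] := dB; have [DB BE] := eB.
have bf0 := B0 _ Bf; set bf := Im (inner f (B f)) in FB bf0.
have [M M0 TM] := sqrt_op_bounded V_bounded V_ge0.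
have s1 := sqn_ge0 hL2 (B f); have s2 := sqn_ge0 hL2 (T f).
have AE g : inner (Aop g) f = - inner (wD (wD g)) f - 'i%C * inner (T g) (T f).
  rewrite /Aop (ipDl hL2) (ipNl hL2) (ipZl hL2) inner_sqrt_opl.
  by congr (_ + _); apply: complex_eqP; rewrite !ReImE /=; ring.
have ci : csq ('i%C : R[i]) = 1 by rewrite /csq /= expr0n expr1n add0r.
have csqN (z : R[i]) : csq (- z) = csq z by rewrite /csq !ReImE; ring.
have Hf : H2 f.
  (* Here <g'', f> is (<g, Bf> - <Ag, f>) - <g, Bf> - i <Tg, Tf>. Applying |x + y|^2 <= 2 |x|^2 + 2
     |y|^2 twice, with ||T g||^2 <= M ||g||^2, gives this constant. *)
  apply: (@adjoint_opS R f (8 * M * bf + 4 * sqn (B f) + 4 * M * sqn (T f))).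
    by rewrite !addr_ge0 ?mulr_ge0.
  move=> g Dg.
  have E : inner (wD (wD g)) f = (inner g (B f) - inner (Aop g) f) +
      (- inner g (B f) + - ('i%C * inner (T g) (T f))).
    by rewrite AE; move: (inner _ _) (inner _ _) (_ * _) => p q r; ring.
  rewrite E; apply: le_trans (csqD_le _ _) _.
  have h1 := FB _ Dg; have h2 := csqD_le (- inner g (B f)) (- ('i%C * inner (T g) (T f))).
  rewrite !csqN csqM ci mul1r in h2.
  have h3 := ip_CauchySchwarz hL2 g (B f); have h4 := ip_CauchySchwarz hL2 (T g) (T f).
  have h5 := TM g; have s3 := sqn_ge0 hL2 g.
  have h6 : sqn (T g) * bf <= M * sqn g * bf by rewrite ler_wpM2r.
  have h7 : sqn (T g) * sqn (T f) <= M * sqn g * sqn (T f) by rewrite ler_wpM2r.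
  move: h1 h2 h3 h4 h6 h7.
  move: (csq _) (csq _) (csq _) (csq _) => x1 x2 x3 x4.
  move: (sqn g) (sqn (B f)) (sqn (T f)) (sqn (T g)) => y1 y2 y3 y4; nra.
split => //.
pose psi := B f - Aop f.
(* Now that f is in H^2, the second-derivative terms cancel by symmetry and <g, psi> = (<g, Bf> -
   <Ag, f>) - 2 i <Tg, Tf>; both terms are controlled by ||T g||, which is what the factorization
   asks for. *)
have [|g Dg|k [hk Tk _]] := @sqrt_op_factor R V V_bounded V_ge0 psi (8 * (bf + sqn (T f))).
- by rewrite mulr_ge0// addr_ge0.
- have E : inner g psi = (inner g (B f) - inner (Aop g) f) + - (2 * 'i%C * inner (T g) (T f)).
    rewrite /psi AE /Aop (ipBr hL2) (ipDr hL2) (ipNr hL2) (ipZr hL2).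
    rewrite (inner_sqrt_op V_bounded V_ge0) -(symmetric_opS Dg Hf).
    by move: (inner _ _) (inner _ _) (inner _ _) => p q r; ring.
  rewrite E; apply: le_trans (csqD_le _ _) _; rewrite csqN !csqM ci mulr1.
  have -> : csq (2 : R[i]) = 4 by rewrite /csq /=; ring.
  have h1 := FB _ Dg; have h4 := ip_CauchySchwarz hL2 (T g) (T f).
  move: h1 h4; move: (csq _) (csq _) (sqn _) (sqn _) => x1 x2 y1 y2; nra.
have BfE : B f = Aop f + T k by rewrite Tk /psi addrC subrK.
exists k; split => //; apply: (bform_ge V_bounded V_ge0 Hf hk) => g Dg.
have Hg := dom_opS_H2 Dg.
have := B0 (g + f).
have -> : B (g + f) = - wD (wD (g + f)) + 'i%C *: V (g + f) + T k.
  have := Blin 1 g f (DB _ Dg) Bf; rewrite !scale1r => ->.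
  have := Aop_linear 1 Hg Hf; rewrite !scale1r -/(Aop (g + f)) => ->.
  by rewrite BfE addrA; congr (_ + _ + _); exact: BE.
apply; have [_ l] := Bsub; have := l 1 _ _ (DB _ Dg) Bf.
by rewrite scale1r.
Qed.

(** At the column (a, b) the left matrix is a Gram form and the right one is given by [Im_mx_qform];
    the minus signs in its last row produce the one in front of the boundary term of q at 1. *)
Lemma boundary_ineqP (L : L2 R -> L2 R) u v : H2 u -> H2 v ->
  boundary_ineq V L u v <-> forall a b,
    sqn (a *: inv_sqrt_op V (L u) + b *: inv_sqrt_op V (L v)) / 4 <= bform (a *: u + b *: v).
Proof.
move=> Hu Hv; rewrite /boundary_ineq /qform_le.
set Ku := inv_sqrt_op V (L u); set Kv := inv_sqrt_op V (L v).
have LHS (x : 'cV[R[i]]_2) :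
  (ctr x *m (4^-1 *: mx2 (L2norm Ku ^+ 2)%:C (inner Ku Kv) (inner Kv Ku) (L2norm Kv ^+ 2)%:C) *m x) ord0 ord0
   = (sqn (x ord0 ord0 *: Ku + x ord_max ord0 *: Kv) / 4)%:C.
  have [p1 p2 p3 p4] := mx2E (L2norm Ku ^+ 2)%:C (inner Ku Kv) (inner Kv Ku) (L2norm Kv ^+ 2)%:C.
  have SE (M : 'M[R[i]]_2) i j : (4^-1 *: M) i j = 4^-1 * M i j by rewrite !mxE.
  rewrite qform2E !SE p1 p2 p3 p4.
  have -> : (L2norm Ku ^+ 2)%:C = inner Ku Ku by rewrite (ip_self hL2) -(sqr_nrm hL2).
  have -> : (L2norm Kv ^+ 2)%:C = inner Kv Kv by rewrite (ip_self hL2) -(sqr_nrm hL2).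
  have -> : (sqn (x ord0 ord0 *: Ku + x ord_max ord0 *: Kv) / 4)%:C =
     4^-1 * inner (x ord0 ord0 *: Ku + x ord_max ord0 *: Kv) (x ord0 ord0 *: Ku + x ord_max ord0 *: Kv).
    by rewrite (ip_self hL2) mulrC rmorphM fmorphV rmorph_nat.
  rewrite !(ipDl hL2) !(ipDr hL2) !(ipZl hL2) !(ipZr hL2).
  exact: scaled_form2.
have RHS (x : 'cV[R[i]]_2) :
  (ctr x *m Im_mx (ctr (mx2 (val0 u) (val0 v) (val1 u) (val1 v)) *m
            mx2 (val0 (wD u)) (val0 (wD v)) (- val1 (wD u)) (- val1 (wD v))) *m x) ord0 ord0
   = (bform (x ord0 ord0 *: u + x ord_max ord0 *: v))%:C.
  have [h0 hl] := H2_subspace R.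
  have Hbv b : H2 (b *: v) by rewrite -[b *: v]addr0; exact: hl.
  rewrite Im_mx_qform /bform.
  have [-> -> -> ->] := traces_linear (x ord0 ord0) Hu (Hbv (x ord_max ord0)).
  have := traces_linear (x ord_max ord0) Hv h0; rewrite addr0 => -[-> -> -> ->].
  have [_ -> -> -> ->] := (dom_opS_subspace R).1.
  move: (val0 u) (val0 v) (val1 u) (val1 v) (val0 (wD u)) (val0 (wD v)) (val1 (wD u)) (val1 (wD v)).
  move: (x ord0 ord0) (x ord_max ord0) => a b u0 v0 u1 v1 y0 z0 y1 z1.
  by rewrite !(@addr0 R[i]) !(@mulrN R[i]) -(@opprD R[i]) (@mulrN R[i]).
move: (4^-1 *: mx2 _ _ _ _) (Im_mx _) LHS RHS => M N LHS RHS.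
split=> [h a b|h x]; last by move: (h (x ord0 ord0) (x ord_max ord0)); rewrite -lecR -LHS -RHS.
have := h (\col_i (if i == ord0 then a else b)).
by rewrite (LHS (\col_i _)) (RHS (\col_i _)) lecR !mxE.
Qed.

Lemma component_unique (W : set (L2 R)) f w : W `&` D0 = [set 0] -> Defs.subspace W ->
  W w -> D0 (f - w) -> component D0 W f = w.
Proof.
move=> WD [_ lW] Ww Dfw; rewrite /component; case: xgetP => [w' _ [Ww' Dfw']|/(_ w)]; last by case.
have [_ lD] := dom_opS_subspace R.
apply/eqP; rewrite -subr_eq0; apply/eqP.
have : (W `&` D0) (w' - w).
  split; first by have := lW (-1) _ _ Ww Ww'; rewrite scaleN1r addrC.
  have := lD (-1) _ _ Dfw' Dfw; rewrite scaleN1r opprB.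
  by rewrite (_ : w' - f + (f - w) = w' - w)// addrA subrK.
by rewrite WD.
Qed.

Section extension_of_WL.
Variables (W : set (L2 R)) (L : L2 R -> L2 R).
Hypothesis adm : admissible V W L.

Lemma admissible_sub : Defs.subspace W. Proof. by case: adm. Qed.
Lemma admissible_H2 w : W w -> H2 w. Proof. by case: adm => _ h _ _ _; exact: h. Qed.
Lemma admissible_cap0 : W `&` D0 = [set 0]. Proof. by case: adm. Qed.
Lemma admissible_lin : linear_on W L. Proof. by case: adm => _ _ _ _ []. Qed.
Lemma admissible_range w : W w -> range T (L w). Proof. by case: adm => _ _ _ _ [_ h]; exact: h. Qed.

Lemma componentE g w : D0 g -> W w -> component D0 W (g + w) = w.
Proof. by move=> Dg Ww; apply: component_unique admissible_cap0 admissible_sub Ww _; rewrite addrK. Qed.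

Lemma opAWLE g w : D0 g -> W w -> opAWL V W L (g + w) = Aop (g + w) + L w.
Proof. by move=> Dg Ww; rewrite /opAWL /= componentE. Qed.

Lemma admissible_L0 : L 0 = 0.
Proof.
have [W0 _] := admissible_sub; have := admissible_lin (-1) W0 W0.
by rewrite scaler0 addr0 scaleN1r addNr.
Qed.

Lemma opAWL_ext : op_ext (opAWL V W L) (opA V).
Proof.
have [W0 _] := admissible_sub.
split=> [g Dg|g Dg]; first by exists g => //; exists 0 => //; rewrite addr0.
by rewrite -[in LHS](addr0 g) (opAWLE Dg W0) admissible_L0 !addr0.
Qed.

Lemma basis_in u v : is_basis2 W u v -> W u /\ W v.
Proof.
case=> _ ->; split; first by exists 1, 0; rewrite scale1r scale0r addr0.
by exists 0, 1; rewrite scale1r scale0r add0r.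
Qed.

(** The right-hand side no longer mentions the basis, which is how the inequality passes from one
    basis to every other. *)
Lemma basis_ineqP u v : is_basis2 W u v -> boundary_ineq V L u v <->
  forall w, W w -> sqn (inv_sqrt_op V (L w)) / 4 <= bform w.
Proof.
move=> bas; have [Wu Wv] := basis_in bas; have [W0 lW] := admissible_sub.
have Wbv b : W (b *: v) by rewrite -[b *: v]addr0; exact: lW.
have LZ b : L (b *: v) = b *: L v by have := admissible_lin b Wv W0; rewrite !addr0 admissible_L0 addr0.
have KE a b : inv_sqrt_op V (L (a *: u + b *: v)) =
    a *: inv_sqrt_op V (L u) + b *: inv_sqrt_op V (L v).
  have r0 : range T 0 by rewrite -admissible_L0; exact: admissible_range.
  have Tbv : range T (b *: L v) by rewrite -LZ; exact: admissible_range.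
  have -> : L (a *: u + b *: v) = a *: L u + b *: L v by rewrite (admissible_lin a Wu (Wbv b)) LZ.
  rewrite (inv_sqrt_op_linear V_bounded V_ge0 a (admissible_range Wu) Tbv).
  congr (_ + _).
  have := inv_sqrt_op_linear V_bounded V_ge0 (-1) r0 r0.
  rewrite scaler0 addr0 scaleN1r addNr => i0.
  by have := inv_sqrt_op_linear V_bounded V_ge0 b (admissible_range Wv) r0; rewrite !addr0 i0 addr0.
rewrite (boundary_ineqP L (admissible_H2 Wu) (admissible_H2 Wv)); split=> [h w|h a b].
  by case: (bas) => _ -> [a [b ->]]; rewrite KE.
by rewrite -KE; apply: h; exact: lW.
Qed.

Hypothesis ineq : forall w, W w -> sqn (inv_sqrt_op V (L w)) / 4 <= bform w.

Lemma opAWL_dissipative : dissipative (opAWL V W L).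
Proof.
have [W0 lW] := admissible_sub; have [D00 lD] := dom_opS_subspace R.
have [_ lH] := H2_subspace R.
have comb a g w g' w' : a *: (g + w) + (g' + w') = (a *: g + g') + (a *: w + w') :> L2 R.
  by rewrite scalerDr addrACA.
split.
- split.
    split; first by exists 0 => //; exists 0 => //; rewrite addr0.
    move=> a _ _ [g Dg [w Ww <-]] [g' Dg' [w' Ww' <-]]; rewrite comb.
    by exists (a *: g + g'); [exact: lD|exists (a *: w + w') => //; exact: lW].
  move=> a _ _ [g Dg [w Ww <-]] [g' Dg' [w' Ww' <-]].
  rewrite [in LHS]comb (opAWLE (lD a _ _ Dg Dg') (lW a _ _ Ww Ww')) !opAWLE// -comb.
  have HH h k : D0 h -> W k -> H2 (h + k).
    by move=> Dh Wk; rewrite -[h]scale1r; apply: lH; [exact: dom_opS_H2|exact: admissible_H2].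
  rewrite (Aop_linear a (HH _ _ Dg Ww) (HH _ _ Dg' Ww')) (admissible_lin a Ww Ww').
  exact/esym/comb.
- move=> f e e0; have [g Dg h] := dom_opS_dense f e0.
  by exists g => //; exists g => //; exists 0 => //; rewrite addr0.
- move=> _ [g Dg [w Ww <-]]; rewrite opAWLE//.
  have Hgw : H2 (g + w).
    by rewrite -[g]scale1r; apply: lH; [exact: dom_opS_H2|exact: admissible_H2].
  have [k hk Tk] := range_sqrt_op V_bounded V_ge0 (admissible_range Ww).
  have := ineq Ww; rewrite -Tk (inv_sqrt_opE V_bounded V_ge0 hk) => iw.
  rewrite /Aop (Im_numerical_range V_bounded V_ge0 _ Hgw) (bform_dom_opS Dg (admissible_H2 Ww)).
  by have := sqn_ge0 hL2 (T (g + w) - (0 +i* 2^-1) *: k); lra.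
Qed.

Lemma opAWL_max : max_dissipative (opAWL V W L).
Proof.
split; first exact: opAWL_dissipative.
move=> B dB [eD eE].
have [eD0 eE0] := opAWL_ext.
have eA : op_ext B (opA V).
  by split=> [g Dg|g Dg]; [exact/eD/eD0|rewrite eE ?eE0//; exact: eD0].
have ext := dissipative_extension dB eA.
have pos f : dom B f -> 0 <= bform f.
  move=> /ext[_ [k [_ _]]]; apply: le_trans.
  by rewrite divr_ge0// (sqn_ge0 hL2).
have [[[_ lB] _] _ _] := dB.
have [_ _ _ [u [v bas]] _] := adm.
have [Wu Wv] := basis_in bas; have [W0 lW] := admissible_sub.
have [D00 lD] := dom_opS_subspace R.
have WB w : W w -> dom B w by move=> Ww; apply: eD; exists 0 => //; exists w => //; rewrite add0r.
have Wab a b : W (a *: u + b *: v) by have := basis_in bas; case: (bas) => _ -> _; exists a, b.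
(* Otherwise a nontrivial combination of the basis would lie in both W and D(S). *)
have det0 : delta_det u v != 0.
  apply/eqP => det0.
  have [a [b [Dab nab]]] := delta_det0_dependent (admissible_H2 Wu) (admissible_H2 Wv) det0
    (fun a b => pos _ (WB _ (Wab a b))).
  apply: nab; case: (bas) => + _; apply.
  have : (W `&` D0) (a *: u + b *: v) by split.
  by rewrite admissible_cap0.
have domE : dom B = dom (opAWL V W L).
  apply/seteqP; split => // f Bf.
  have [Hf _] := ext _ Bf.
  have [a [b Dab]] : exists a b, D0 (f - (a *: u + b *: v)).
    apply: delta_det_span => //; [exact: admissible_H2|exact: admissible_H2|] => a b.
    apply: pos; have := lB (-1) _ _ (WB _ (Wab a b)) Bf.
    by rewrite scaleN1r addrC.
  by exists (f - (a *: u + b *: v)) => //; exists (a *: u + b *: v); rewrite ?subrK.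
by split => // f; rewrite domE; exact: eE.
Qed.

End extension_of_WL.

End main.

(** * Maximality *)

(** Pythagoras in C^2. *)
Lemma csqD_orthogonal (R : rcfType) (a z0 z1 e0 e1 : R[i]) : e0^*%C * z0 + e1^*%C * z1 = 0 ->
  csq (z0 + a * e0) + csq (z1 + a * e1) = csq z0 + csq z1 + csq a * (csq e0 + csq e1).
Proof.
move=> o; have := congr1 (@complex.Re R) o; have := congr1 (@complex.Im R) o.
rewrite /csq !ReImE /= => h1 h2; apply/eqP; rewrite -subr_eq0; apply/eqP.
transitivity (2 * Re a * (Re e0 * Re z0 - - Im e0 * Im z0 + (Re e1 * Re z1 - - Im e1 * Im z1))
  + 2 * Im a * (Re e0 * Im z0 + - Im e0 * Re z0 + (Re e1 * Im z1 + - Im e1 * Re z1))); first by ring.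
by rewrite h1 h2 !mulr0 addr0.
Qed.

Section characterization.
Variables (R : realType) (V : L2 R -> L2 R).
Hypothesis V_bounded : bounded_op V.
Hypothesis V_ge0 : nonneg_op V.
Implicit Types (f g h u v w : L2 R) (a b c d : R[i]).
Let hL2 := L2_hilbert R.
Local Notation sqn := (sqn (@inner R)).
Local Notation T := (sqrt_op V).
Local Notation D0 := (dom (opS R)).

Lemma max_dissipative_delta (B : operator R) (e0 e1 : R[i]) :
  max_dissipative B -> op_ext B (opA V) ->
  (forall f, dom B f -> e0^*%C * delta0 f + e1^*%C * delta1 f = 0) ->
  csq e0 + csq e1 = 0.
Proof.
move=> [dB maxB] eB orth; apply/eqP/negPn/negP => n0.
have [[[B0 Bsub] Blin] Bden Bge0] := dB.
have ext := dissipative_extension V_bounded V_ge0 dB eB.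
have [w [Hw w0 w1 w2 w3]] := delta_eta_surjective e0 e1.
have nC0 : (csq e0 + csq e1)%:C != 0 :> R[i].
  by rewrite eq_complex /= (negbTE n0).
have eeE : e0^*%C * e0 + e1^*%C * e1 = (csq e0 + csq e1)%:C.
  by apply: complex_eqP; rewrite /csq !ReImE /=; ring.
have HB f : dom B f -> H2 f by move/ext => [].
have [_ lH] := H2_subspace R.
(* The coordinate along [w] in the span of [w] and D(B): since delta vanishes against e on D(B) and
   equals e at [w], the normalized pairing with e reads it off, and the extension [B'] gets an
   explicit formula. *)
have [c [c_lin c_B c_w]] : exists c : L2 R -> R[i],
    [/\ forall a f g, H2 f -> H2 g -> c (a *: f + g) = a * c f + c g,
        forall f, dom B f -> c f = 0 & c w = 1].
  exists (fun x => (e0^*%C * delta0 x + e1^*%C * delta1 x) / (csq e0 + csq e1)%:C); split.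
  - move=> a f g Hf Hg; have [-> -> _ _] := delta_eta_linear a Hf Hg.
    by move: (_%:C) nC0 => n nC0; field.
  - by move=> f Bf; rewrite orth// mul0r.
  - by rewrite w0 w1 eeE divff.
have cE a f : dom B f -> c (a *: w + f) = a.
  by move=> Bf; rewrite c_lin ?c_w ?c_B ?addr0 ?mulr1//; exact: HB.
pose D' : set (L2 R) := [set x | exists a f, dom B f /\ x = a *: w + f].
pose B' := Operator D' (fun x => c x *: Aop V w + B (x - c x *: w)).
have B'E a f : dom B f -> B' (a *: w + f) = a *: Aop V w + B f.
  by move=> Bf; rewrite /B' /= cE// [_ *: w + f]addrC addrK.
have comb (a a1 a2 : R[i]) (x f g : L2 R) :
    a *: (a1 *: x + f) + (a2 *: x + g) = (a * a1 + a2) *: x + (a *: f + g).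
  by rewrite scalerDr scalerDl scalerA addrACA.
have extB : op_ext B' B.
  have E f : f = 0 *: w + f by rewrite scale0r add0r.
  split=> [f Bf|f Bf]; first by exists 0, f; split => //; exact: E.
  by rewrite [in LHS](E f) B'E// scale0r add0r.
have dB' : dissipative B'.
  split.
  - split.
      split; first by exists 0, 0; rewrite scale0r addr0.
      move=> a _ _ [a1 [f [Bf ->]]] [a2 [g [Bg ->]]]; rewrite comb.
      by exists (a * a1 + a2), (a *: f + g); split => //; exact: Bsub.
    move=> a _ _ [a1 [f [Bf ->]]] [a2 [g [Bg ->]]].
    by rewrite comb !B'E//; [rewrite Blin// comb|exact: Bsub].
  - move=> f e e_gt0; have [g Bg h] := Bden f e e_gt0.
    by exists g => //; exact: extB.1.
  - move=> _ [a [f [Bf ->]]]; rewrite B'E//.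
    have [Hf [k [hk -> bk]]] := ext _ Bf.
    rewrite addrA -(Aop_linear V_bounded a Hw Hf).
    rewrite /Aop (Im_numerical_range V_bounded V_ge0 _ (lH a _ _ Hw Hf)).
    (* Adding a multiple of [w] leaves eta unchanged and enlarges |delta|^2 by orthogonality; [k]
       stays the same because the extension has no perturbation along [w]. *)
    have bE : bform f <= bform (a *: w + f).
      rewrite !bform_delta; have [-> -> -> ->] := delta_eta_linear a Hw Hf.
      rewrite w0 w1 w2 w3 !mulr0 !add0r.
      rewrite [_ * e0 + _]addrC [_ * e1 + _]addrC csqD_orthogonal; last exact: orth.
      have := mulr_ge0 (csq_ge0 a) (addr_ge0 (csq_ge0 e0) (csq_ge0 e1)).
      by move: (csq a * _) (csq (delta0 f)) (csq (delta1 f)) (csq (eta0 f)) (csq (eta1 f)) => *; lra.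
    have := sqn_ge0 hL2 (T (a *: w + f) - (0 +i* 2^-1) *: k).
    by move: (sqn _) (sqn _) (bform _) (bform _) bE bk => *; lra.
(* Maximality puts [w] into D(B), where delta w = e would have to be orthogonal to itself. *)
have [domE _] := maxB _ dB' extB.
have Bw : dom B w.
  by rewrite -domE; exists 1, 0; rewrite scale1r addr0.
have := orth _ Bw; rewrite w0 w1 eeE => /eqP; by rewrite (negbTE nC0).
Qed.

(** If all determinants vanished, delta would map D(B) into a line spanned by some delta u, and (-
    delta1 u^*, delta0 u^* ) would be orthogonal to it; if delta vanished on D(B), (1, 0) would do.
    Both contradict [max_dissipative_delta]. *)
Lemma max_dissipative_delta_det (B : operator R) : max_dissipative B -> op_ext B (opA V) ->
  exists u v, [/\ dom B u, dom B v & delta_det u v != 0].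
Proof.
move=> mB eB; apply: contrapT => no.
have det0 u v : dom B u -> dom B v -> delta_det u v = 0.
  by move=> Bu Bv; apply/eqP/negPn/negP => h; apply: no; exists u, v.
have csq10 : csq (1 : R[i]) + csq (0 : R[i]) != 0.
  by rewrite /csq /= !expr0n expr1n !addr0 oner_eq0.
have [[u [Bu nz]]|z] := pselect (exists u, dom B u /\ ~ (delta0 u = 0 /\ delta1 u = 0)).
  have JJ (z : R[i]) : (z^*%C)^*%C = z by apply: complex_eqP; rewrite !ReImE ?opprK.
  have JN (z : R[i]) : (- z)^*%C = - z^*%C by apply: complex_eqP; rewrite !ReImE.
  have h := @max_dissipative_delta B (- (delta1 u)^*%C) ((delta0 u)^*%C) mB eB.
  have : csq (- (delta1 u)^*%C) + csq ((delta0 u)^*%C) = 0.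
    by apply: h => f Bf; rewrite JN !JJ -[RHS](det0 _ _ Bu Bf) /delta_det; ring.
  rewrite -mulN1r csqM !csqJ (_ : csq (-1) = 1) ?mul1r; last first.
    by rewrite /csq /= oppr0 expr0n addr0 sqrrN expr1n.
  have c0 := csq_ge0 (delta0 u); have c1 := csq_ge0 (delta1 u).
  by move=> E; apply: nz; split; apply: csq_eq0; lra.
have h := @max_dissipative_delta B 1 0 mB eB.
have : csq (1 : R[i]) + csq (0 : R[i]) = 0.
  apply: h => f Bf; have [-> ->] : delta0 f = 0 /\ delta1 f = 0.
    by apply: contrapT => nf; apply: z; exists f.
  by rewrite !mulr0 addr0.
by apply/eqP.
Qed.

(** W is spanned by two vectors of D(B) with nonzero determinant, and L is B minus S^* + i V. The
    vector [k] from [dissipative_extension] then gives both the range condition and the inequality,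
    and [delta_det_span] shows that W fills D(B) modulo D(S). *)
Lemma max_dissipative_ext_WL (B : operator R) : op_ext B (opA V) -> max_dissipative B ->
  exists (W : set (L2 R)) (L : L2 R -> L2 R),
    [/\ admissible V W L, exists u v : L2 R, is_basis2 W u v /\ boundary_ineq V L u v
      & op_eq B (opAWL V W L)].
Proof.
move=> eB mB; have [[[[B0 lB] Blin] _ _] _] := mB.
have ext := dissipative_extension V_bounded V_ge0 mB.1 eB.
have HB f : dom B f -> H2 f by move/ext => [].
have pos f : dom B f -> 0 <= bform f.
  move=> /ext[_ [k [_ _]]]; apply: le_trans.
  by rewrite divr_ge0// (sqn_ge0 hL2).
have [u [v [Bu Bv det0]]] := max_dissipative_delta_det mB eB.
have [Hu Hv] := (HB _ Bu, HB _ Bv).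
have [D00 lD] := dom_opS_subspace R; have [eD eE] := eB.
have Bab a b : dom B (a *: u + b *: v).
  by rewrite -[b *: v]addr0; exact: (lB a _ _ Bu (lB b _ _ Bv B0)).
pose W : set (L2 R) := [set f | exists a b : R[i], f = a *: u + b *: v].
pose L x : L2 R := B x - Aop V x.
have WB w : W w -> dom B w by move=> [a [b ->]].
have bas : is_basis2 W u v.
  by split => // a b E; apply: (delta_det_indep Hu Hv det0); rewrite E.
have adm : admissible V W L.
  split.
  - split; first by exists 0, 0; rewrite !scale0r addr0.
    move=> a _ _ [a1 [b1 ->]] [a2 [b2 ->]]; exists (a * a1 + a2), (a * b1 + b2).
    by rewrite scalerDr !scalerDl !scalerA addrACA.
  - by move=> w /WB; exact: HB.
  - apply/seteqP; split => [w [[a [b ->]] Dw]|_ ->].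
      have [-> ->] := delta_det_indep Hu Hv det0 Dw.
      by rewrite !scale0r addr0.
    by split => //; exists 0, 0; rewrite !scale0r addr0.
  - by exists u, v.
  - split=> [a f g /WB Bf /WB Bg|w /WB Bw].
      rewrite /L Blin// (Aop_linear V_bounded a (HB _ Bf) (HB _ Bg)) scalerBr.
      by rewrite opprD addrACA.
    have [_ [k [_ E _]]] := ext _ Bw.
    by exists k => //; rewrite /L E addrC addKr.
exists W, L; split; first exact: adm.
  exists u, v; split; first exact: bas.
  apply: (basis_ineqP V_bounded V_ge0 adm bas).2 => w /WB Bw.
  have [_ [k [hk E bk]]] := ext _ Bw.
  have -> : L w = T k by rewrite /L E addrC addKr.
  by rewrite (inv_sqrt_opE V_bounded V_ge0 hk).
have E g w : D0 g -> W w -> B (g + w) = opAWL V W L (g + w).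
  move=> Dg Ww; rewrite (opAWLE adm Dg Ww) /L.
  have Dg' : dom B g by exact: eD.
  have := Blin 1 _ _ Dg' (WB _ Ww); rewrite !scale1r => ->.
  have := Aop_linear V_bounded 1 (HB _ Dg') (HB _ (WB _ Ww)); rewrite !scale1r => ->.
  have -> : B g = Aop V g by exact: eE.
  by move: (Aop V g) (Aop V w) (B w) => x y z; rewrite -addrA [y + _]addrC subrK.
have domE : dom B = dom (opAWL V W L).
  apply/seteqP; split=> [f Bf|_ [g Dg [w Ww <-]]]; last first.
    by have := lB 1 _ _ (eD _ Dg) (WB _ Ww); rewrite scale1r.
  have [a [b Dab]] : exists a b, D0 (f - (a *: u + b *: v)).
    apply: delta_det_span => //; first exact: HB.
    move=> a b; apply: pos; have := lB (-1) _ _ (Bab a b) Bf.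
    by rewrite scaleN1r addrC.
  exists (f - (a *: u + b *: v)) => //; exists (a *: u + b *: v); last by rewrite subrK.
  by exists a, b.
by split => // f; rewrite domE => -[g Dg [w Ww <-]]; exact: E.
Qed.

End characterization.

Lemma op_eq_max_dissipative (R : realType) (B B' : operator R) :
  op_eq B B' -> max_dissipative B' -> max_dissipative B.
Proof.
move=> [dE E] [[[B0 Blin] Bden Bge0] Bmax]; split.
  split.
  - split; rewrite dE// => a f g Bf Bg; rewrite !E ?dE//; first exact: Blin.
    exact: B0.2.
  - by move=> f e e0; rewrite dE; exact: Bden.
  - by move=> f Bf; rewrite E//; apply: Bge0; rewrite -dE.
move=> C dC [eD eE]; have [|h1 h2] := Bmax C dC.
  by split=> [f|f]; rewrite -dE; [exact: eD|move=> Bf; rewrite eE// E].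
by split=> [|f Cf]; rewrite ?dE// h2// E// dE -h1.
Qed.

Theorem theorem3p4 (R : realType) (V : L2 R -> L2 R)
    (V_bounded : bounded_op V) (V_ge0 : nonneg_op V) :
  (forall B : operator R,
     op_ext B (opA V) /\ max_dissipative B <->
     exists (W : set (L2 R)) (L : L2 R -> L2 R),
       [/\ admissible V W L,
           exists u v : L2 R, is_basis2 W u v /\ boundary_ineq V L u v
         & op_eq B (opAWL V W L)]) /\
  (forall (W : set (L2 R)) (L : L2 R -> L2 R), admissible V W L ->
     (exists u v : L2 R, is_basis2 W u v /\ boundary_ineq V L u v) ->
     forall u v : L2 R, is_basis2 W u v -> boundary_ineq V L u v).
Proof.
split=> [B|W L adm [u [v [bas ineq]]] u' v' bas'].
  split=> [[eB mB]|[W [L [adm [u [v [bas ineq]]] BE]]]].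
    exact: max_dissipative_ext_WL.
  have ineqW := (basis_ineqP V_bounded V_ge0 adm bas).1 ineq.
  split; last exact: (op_eq_max_dissipative BE (opAWL_max V_bounded V_ge0 adm ineqW)).
  have [eD eE] := opAWL_ext adm; have [dE E] := BE.
  split=> [f Df|f Df]; first by rewrite dE; exact: eD.
  by rewrite E ?eE// dE; exact: eD.
apply: (basis_ineqP V_bounded V_ge0 adm bas').2.
exact: ((basis_ineqP V_bounded V_ge0 adm bas).1 ineq).
Qed.
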